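(* Fix $\tau\in(0,1)$ and $\beta\in(0,\infty]$, and for every $n\ge 1$ let $m=\lfloor n\tau\rfloor$ (so $0\le m\le n-1$). Let $(P_{n,k})_{0\le k\le n}$, $n \geq 1$, be the sequences of random polynomials with parameter $\beta$ defined in the context, with roots $\lambda^{(n,k)}_1\le\dots\le\lambda^{(n,k)}_{n-k}$. Assume that for some $A>0$ all zeros of $P_{n,0}$ lie in $[-A,A]$ for all $n\ge1$, and that the empirical measure $$\mu_{n,0}:=\frac1n\sum_{j=1}^n\delta_{\lambda^{(n,0)}_j}$$ almost surely converges (weakly, as $n\to\infty$) to a deterministic limiting probability measure $\mu$ (necessarily supported in $[-A,A]$). Then the empirical distribution of the zeros of $P_{n,m}$, $$\mu_{n,m}:=\frac1{n-m}\sum_{j=1}^{n-m}\delta_{\lambda^{(n,m)}_j},$$ almost surely converges weakly, as $n\to\infty$, to the same limit as the empirical distribution of the zeros (counted with multiplicity) of the $m$-th derivative of $P_{n,0}$; that is, this limit exists and is independent of $\beta\in(0,\infty]$.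
   Context: Construction with parameter $\beta\in(0,\infty]$. For each $n\ge1$, let $\lambda^{(n,0)}_1\le\dots\le\lambda^{(n,0)}_n$ be a (possibly random) nondecreasing sequence of real numbers and set $P_{n,0}(z)=\prod_{j=1}^n(z-\lambda^{(n,0)}_j)$. For $1\le m\le n$, if $\beta<\infty$ let $(\rho^{(n,m)}_j)_{1\le j\le n+1-m}$ be a random vector following the Dirichlet distribution with all parameters equal to $\beta/2$, these random vectors (for $1\le m\le n$) and the initial polynomial $P_{n,0}$ being all independent; if $\beta=\infty$ set $\rho^{(n,m)}_j:=1/(n+1-m)$. Inductively for $1\le m\le n$ define $$P_{n,m}(z)=\sum_{j=1}^{n+1-m}\rho^{(n,m)}_j\prod_{1\le k\le n+1-m,\ k\ne j}\bigl(z-\lambda^{(n,m-1)}_k\bigr),$$ and let $(\lambda^{(n,m)}_j)_{1\le j\le n-m}$ be the nondecreasing sequence such that $P_{n,m}(z)=\prod_{j=1}^{n-m}(z-\lambda^{(n,m)}_j)$ (all roots are real, interlacing those of $P_{n,m-1}$). Random variables for all $n$ are defined on a common probability space. *)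

(* Defs.v *)
From HB Require Import structures.
From mathcomp Require Import all_boot all_order all_algebra.
From mathcomp Require Import all_classical all_reals all_analysis.

Set Implicit Arguments.
Unset Strict Implicit.
Unset Printing Implicit Defensive.

Import Order.TTheory GRing.Theory Num.Theory.
Import numFieldTopology.Exports numFieldNormedType.Exports.

Local Open Scope classical_set_scope.
Local Open Scope ring_scope.

Section zeros.
Context {R : realType}.

Definition monic_of_zeros (s : seq R) : {poly R} :=
  \prod_(x <- s) ('X - x%:P).

(* The zeros of p with multiplicity, in nondecreasing order, when p is a
   nonzero polynomial all of whose zeros are real; [::] otherwise
   ([%=] is equality up to a nonzero constant factor). *)
Definition ordered_zeros (p : {poly R}) : seq R :=
  xget [::] [set s | sorted <=%R s /\ p %= monic_of_zeros s].

Definition weighted_derivative k (r : k.+1.-tuple R) (s : seq R) : {poly R} :=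
  \sum_(j < k.+1) tnth r j *: \prod_(i < k.+1 | i != j) ('X - (s`_i)%:P).

(* P_{n,m}, built from the zeros s of P_{n,0} and the weight vectors
   r m = rho^{(n,m)} for 1 <= m <= n. Such a vector has n + 1 - m entries,
   written (n - m).+1; the entries of r outside 1 <= m <= n are not used
   by P_{n,m} with m <= n. *)
Fixpoint poly_chain n (s : seq R) (r : forall m, (n - m).+1.-tuple R) (m : nat)
    : {poly R} :=
  if m is m'.+1
  then weighted_derivative (r m'.+1) (ordered_zeros (poly_chain s r m'))
  else monic_of_zeros s.

Definition empirical_measure (s : seq R) : {measure set R -> \bar R} :=
  mscale ((size s)%:R^-1)%:nng (msum (fun i => \d_(s`_i)) (size s)).

Definition weak_cvg (mu_ : nat -> {measure set R -> \bar R})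
    (mu : {measure set R -> \bar R}) : Prop :=
  forall f : R -> R, continuous f -> [bounded f x | x in [set: R]] ->
    (\int[mu_ n]_x (f x)%:E)%E @[n --> \oo] --> (\int[mu]_x (f x)%:E)%E.

End zeros.

Section dirichlet.
Context {R : realType}.

Fixpoint tuple_integral k : (k.-tuple R -> \bar R) -> \bar R :=
  if k is k'.+1
  then fun f => (\int[lebesgue_measure]_x
         tuple_integral (fun y : k'.-tuple R => f [tuple of x :: y]))%E
  else fun f => f [tuple].

Definition simplex_point k (y : k.-tuple R) : k.+1.-tuple R :=
  [tuple of rcons y (1 - \sum_(z <- y) z)].

Definition dirichlet_kernel k (a : 'I_k.+1 -> R) (x : k.+1.-tuple R) : R :=
  if [forall i, 0 < tnth x i] then \prod_(i < k.+1) tnth x i `^ (a i - 1)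
  else 0.

(* The unnormalized Dirichlet measure: the density is taken with respect to
   Lebesgue measure on the first k coordinates, the last one being 1 minus
   their sum. For k = 0 it is the Dirac mass at the 1-tuple (1). *)
Definition dirichlet_mass k (a : 'I_k.+1 -> R) (B : set (k.+1.-tuple R))
    : \bar R :=
  tuple_integral (fun y : k.-tuple R =>
    (dirichlet_kernel a (simplex_point y) * \1_B (simplex_point y))%:E).

Definition dirichlet_law k (a : 'I_k.+1 -> R) (B : set (k.+1.-tuple R))
    : \bar R :=
  ((fine (dirichlet_mass a setT))^-1%:E * dirichlet_mass a B)%E.

End dirichlet.

Section construction.
Context {R : realType} {d : measure_display} {Omega : measurableType d}.
Variable P : probability Omega R.

Definition mutually_independent (I : finType) (F : I -> set (set Omega)) :=
  forall (J : {set I}) (E : I -> set Omega),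
    (forall i, i \in J -> F i (E i)) ->
    P (\bigcap_(i in [set` J]) E i) = (\big[*%E/1]_(i in J) P (E i))%E.

Definition generated_sigma_algebra d' (T : measurableType d') (X : Omega -> T)
  : set (set Omega) := preimage_set_system setT X measurable.

Section parameter.
Variable zeros0 : forall n, {RV P >-> n.-tuple R}.
Variable rho : forall n m, {RV P >-> (n - m).+1.-tuple R}.

(* Index 0 stands for the initial polynomial P_{n,0} (through its ordered
   zeros), index m >= 1 for the weight vector rho^{(n,m)}. *)
Definition construction_family n (i : 'I_n.+1) : set (set Omega) :=
  if val i is m.+1 then generated_sigma_algebra (rho n m.+1)
  else generated_sigma_algebra (zeros0 n).

(* Independence is required for each n separately; the joint law for
   different n is arbitrary. *)
Definition weights_with_parameter (beta : \bar R) : Prop :=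
  match beta with
  | b%:E =>
      (forall n m, (1 <= m <= n)%N ->
         forall B, measurable B ->
           distribution P (rho n m) B = dirichlet_law (fun=> b / 2) B) /\
      (forall n, mutually_independent (@construction_family n))
  | +oo%E =>
      forall n m, (1 <= m <= n)%N -> forall w j,
        tnth (rho n m w) j = (n.+1 - m)%:R^-1
  | -oo%E => False
  end.

End parameter.
End construction.

(* Main.v *)
Require Import Defs.
From HB Require Import structures.
From mathcomp Require Import all_boot all_order all_algebra.
From mathcomp Require Import all_classical all_reals all_analysis.
From mathcomp Require Import measurable_realfun.
From mathcomp Require Import zify ring lra.

(** The proof follows the moments of the empirical measures along the chain.

Let s be the zeros of P_{n,m}, y those of P_{n,m+1} and r the weights. Then
P_{n,m+1}(z) / P_{n,m}(z) is the sum of the r_j / (z - s_j), and its expansion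
at infinity has the coefficients w_k = \sum_j r_j s_j^k. Its logarithmic
derivative turns this into Newton identities ([power_sums_of_derivative]): the
decrements q_k of the power sums, from s to y, are universal polynomials in
w_1, ..., w_k. If the weights are uniform, then w_k is the k-th moment M_k of
the empirical measure of s, and P_{n,m+1} is proportional to P_{n,m}^`(); so
the moments of the zeros of the derivatives satisfy the closed recursion
   M(m+1) = M(m) + (M(m) - q(M(m))) / (n - m - 1),
which is an Euler scheme of step about 1/n for a differential equation on the
time interval [0, tau]. Therefore the moments at the integer part of n tau
converge as soon as the initial ones do ([euler_cauchy]), and a discrete
Gronwall estimate ([euler_perturbation]) shows that their limits depend on the
initial limits only.

For Dirichlet weights the same recursion holds with w_k = M_k + noise, where
the noise is \sum_j r_j (s_j^k - M_k), a linear form with centered bounded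
coefficients in weights that are independent of s. Its fourth moment is
O(1/n^2) ([dirichlet_fourth_moment], [noise_fourth_moment]): the mixed moments
of a Dirichlet vector are those of a Polya urn, which a beta integral shows.
These bounds are summable in n; hence, almost surely, the average over
m < n tau of the absolute value of the noise tends to 0 ([mean_noise_ae]), and
the Gronwall estimate gives the random chain the limiting moments of the
derivatives.

All the zeros stay in [-A, A] ([pair_derivative_real_rooted]). By the
Weierstrass theorem, convergence of all moments is then weak convergence, and
the limit measure is the law of a limit of the quantile functions of the
empirical measures ([exists_limit_measure]). For beta = +oo the weights are
uniform, so the chain is, up to constants, the sequence of the derivatives. *)

Set Implicit Arguments.
Unset Strict Implicit.
Unset Printing Implicit Defensive.

Import Order.TTheory GRing.Theory Num.Theory.
Import numFieldTopology.Exports numFieldNormedType.Exports.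

Local Open Scope classical_set_scope.
Local Open Scope ring_scope.

(** * Real-rootedness of weighted derivatives *)

Section weighted_derivatives.
Context {R : realType}.
Implicit Types (l : seq (R * R)) (s y : seq R) (p : {poly R}).

(** The weighted derivative of the list of pairs (weight, node): the recursion
   is the product rule, so that all identities below go by induction on the
   list. *)
Fixpoint pair_derivative l : {poly R} :=
  if l is (r, x) :: t
  then r *: monic_of_zeros (map snd t) + ('X - x%:P) * pair_derivative t
  else 0.

Lemma monic_of_zeros_cons x s :
  monic_of_zeros (x :: s) = ('X - x%:P) * monic_of_zeros s.
Proof. by rewrite /monic_of_zeros big_cons. Qed.

Lemma monic_of_zeros_cat s1 s2 :
  monic_of_zeros (s1 ++ s2) = monic_of_zeros s1 * monic_of_zeros s2.
Proof. by rewrite /monic_of_zeros big_cat. Qed.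

Lemma pair_derivative_cat l1 l2 :
  pair_derivative (l1 ++ l2) =
  pair_derivative l1 * monic_of_zeros (map snd l2)
  + monic_of_zeros (map snd l1) * pair_derivative l2.
Proof.
elim: l1 => [|[r x] t IH] /=.
  by rewrite mul0r add0r /monic_of_zeros big_nil mul1r.
rewrite IH map_cat monic_of_zeros_cat monic_of_zeros_cons -!mul_polyC; ring.
Qed.

Lemma perm_pair_derivative l1 l2 : perm_eq l1 l2 ->
  pair_derivative l1 = pair_derivative l2.
Proof.
move=> l12; apply/esym.
have := catCA_perm_ind (P := fun l => pair_derivative l = pair_derivative l1).
apply; [|exact: l12|by []] => a b c.
by rewrite !pair_derivative_cat !map_cat !monic_of_zeros_cat => <-; ring.
Qed.

Lemma weighted_derivativeE k (r : k.+1.-tuple R) s : size s = k.+1 ->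
  weighted_derivative r s = pair_derivative (zip r s).
Proof.
move=> ss; rewrite /weighted_derivative.
under eq_bigr do rewrite (tnth_nth 0).
have : size r = k.+1 by rewrite size_tuple.
move: (tval r) ss => {}r; move: k.+1 => {}k.
elim: k r s => [|k IH] [|a r] [|x s] //=; first by move=> *; rewrite big_ord0.
move=> [ss] [sr]; rewrite big_ord_recl; congr (_ + _).
  rewrite big_mkcond big_ord_recl eqxx /= mul1r.
  congr (_ *: _); rewrite /monic_of_zeros -/unzip2 unzip2_zip ?ss ?sr//.
  rewrite (big_nth 0) big_mkord ss; apply: eq_bigr => i _.
  by [].
rewrite -IH // mulr_sumr; apply: eq_bigr => i _ /=.
rewrite -scalerAr; congr (_ *: _).
rewrite big_mkcond big_ord_recl /=; congr (_ * _).
rewrite [RHS]big_mkcond; apply: eq_bigr => j _.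
by rewrite (inj_eq lift_inj).
Qed.

Lemma size_pair_derivative l : (size (pair_derivative l) <= size l)%N.
Proof.
elim: l => [|[r x] t IH] /=; first by rewrite size_poly0.
apply: leq_trans (size_polyD _ _) _; rewrite geq_max; apply/andP; split.
  apply: leq_trans (size_scale_leq _ _) _.
  by rewrite /monic_of_zeros (size_prod_XsubC _ id) size_map.
apply: leq_trans (size_polyMleq _ _) _.
by rewrite size_XsubC addSn /=.
Qed.

Lemma coef_pair_derivative_last l :
  (pair_derivative l)`_(size l).-1 = \sum_(a <- l) a.1.
Proof.
elim: l => [|[r x] t IH] /=; first by rewrite big_nil coef0.
rewrite big_cons coefD coefZ mulrBl coefB coefXM mulrC mul_polyC coefZ.
have -> : (monic_of_zeros (map snd t))`_(size t) = 1.
  have := monic_prod_XsubC (map snd t) xpredT id.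
  by rewrite monicE /lead_coef (size_prod_XsubC _ id) size_map => /eqP.
rewrite (nth_default 0 (size_pair_derivative t)) mulr0 subr0 mul1r IH.
by case: t {IH} => [|? ?] //=; rewrite big_nil.
Qed.

(** At a node, the weighted derivative is the weight times the product of the
   differences with the other nodes. The nodes of t lie outside [x1, x2], so
   the signs at x1 and x2 are opposite. *)
Lemma pair_derivative_root r1 r2 x1 x2 t : 0 < r1 -> 0 < r2 -> x1 < x2 ->
  (forall a, a \in map snd t -> (a < x1) || (x2 < a)) ->
  exists2 z, x1 < z < x2 & root (pair_derivative ((r1, x1) :: (r2, x2) :: t)) z.
Proof.
move=> r10 r20 x12 Ht; set p := pair_derivative _.
pose g (x : R) := (monic_of_zeros (map snd t)).[x].
(* each node of t lies on the same side of x1 and x2 *)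
have gg : 0 < g x1 * g x2.
  rewrite /g; elim: (map snd t) Ht => [|a u IH] Hu.
    by rewrite /monic_of_zeros big_nil !hornerE ltr01.
  rewrite monic_of_zeros_cons !hornerM !hornerXsubC mulrACA; apply: mulr_gt0; last first.
    by apply: IH => b bu; apply: Hu; rewrite inE bu orbT.
  have /orP[h|h] := Hu a (mem_head _ _).
    by rewrite mulr_gt0 // subr_gt0 // (lt_trans h).
  by rewrite nmulr_rgt0 subr_lt0 // (lt_trans x12).
have p1 : p.[x1] = r1 * (x1 - x2) * g x1.
  by rewrite /p /= monic_of_zeros_cons /g !(hornerXsubC, hornerD, hornerZ, hornerM); ring.
have p2 : p.[x2] = r2 * (x2 - x1) * g x2.
  by rewrite /p /= monic_of_zeros_cons /g !(hornerXsubC, hornerD, hornerZ, hornerM); ring.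
have pp : p.[x1] * p.[x2] < 0.
  rewrite p1 p2 (_ : _ * _ = - (r1 * r2 * (x2 - x1) ^+ 2 * (g x1 * g x2))).
    rewrite oppr_lt0; apply: mulr_gt0 => //; apply: mulr_gt0.
      exact: mulr_gt0.
    by rewrite exprn_even_gt0 //= subr_eq0 gt_eqF.
  ring.
have [z zi rz] : exists2 z, x1 <= z <= x2 & root p z.
  have [p1n|p1p] := ltP p.[x1] 0.
    apply: poly_ivt (ltW x12) _; rewrite (ltW p1n) /=.
    by rewrite ltW // -(nmulr_rlt0 _ p1n).
  have {}p1p : 0 < p.[x1].
    rewrite lt_neqAle p1p andbT; apply: contraTneq pp => <-.
    by rewrite mul0r ltxx.
  have [|z zi rz] := @poly_ivt _ (- p) _ _ (ltW x12); last first.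
    by exists z => //; rewrite rootN in rz.
  by rewrite !hornerN oppr_le0 oppr_ge0 (ltW p1p) /= ltW // -(pmulr_rlt0 _ p1p).
have [n1 n2] : x1 != z /\ z != x2.
  by split; apply: contraTneq pp => E; rewrite -E in rz *; move/rootP: rz => ->;
    rewrite ?mul0r ?mulr0 ltxx.
by exists z => //; move: zi; rewrite !le_eqVlt (negbTE n1) (negbTE n2).
Qed.

(** A double node is a zero, and merging its two copies, with the sum of their
   weights, divides the polynomial by the corresponding factor; so one may
   assume distinct nodes. Then there is one zero between any two consecutive
   nodes, which is as many as the degree allows. *)
Lemma pair_derivative_real_rooted l (A : R) : (0 < size l)%N ->
  (forall a, a \in l -> 0 < a.1) -> (forall a, a \in l -> `|a.2| <= A) ->
  exists y, [/\ size y = (size l).-1, (forall z, z \in y -> `|z| <= A) &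
    pair_derivative l = (\sum_(a <- l) a.1) *: monic_of_zeros y].
Proof.
have [n] := ubnP (size l); elim: n l => // n IH l; rewrite ltnS => ln l0 lp lA.
have [ul|] := boolP (uniq (map snd l)); last first.
  (* two equal nodes: merge them, the common node being a zero *)
  move=> nu.
  have [[r1 x] [[r2 x'] [t [lt /= xx']]]] : exists a b t,
      perm_eq l (a :: b :: t) /\ a.2 = b.2.
    elim: l nu {ln l0 lp lA IH} => [|a l IH] //=.
    rewrite negb_and negbK => /orP[/mapP[b bl ab]|/IH[b [c [t [lt bc]]]]].
      exists a, b, (rem b l); split=> //.
      by rewrite perm_cons; exact: perm_to_rem.
    exists b, c, (a :: t); split=> //.
    rewrite -[X in perm_eq _ X]/([:: b; c] ++ a :: t) perm_sym perm_catC.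
    rewrite perm_sym -[X in perm_eq _ X]/(a :: (t ++ [:: b; c])) perm_cons.
    by rewrite (perm_trans lt) // -[X in perm_eq X _]/([:: b; c] ++ t) perm_catC.
  subst x'.
  have st : size l = (size t).+2 by rewrite (perm_size lt).
  have [||||y [sy yA yE]] := IH ((r1 + r2, x) :: t).
  - by rewrite /=; move: ln; rewrite st.
  - by [].
  - move=> a; rewrite inE => /orP[/eqP -> /=|at_].
      by rewrite addr_gt0 // ?(lp (r1, x)) ?(lp (r2, x)) // (perm_mem lt) !inE eqxx ?orbT.
    by apply: lp; rewrite (perm_mem lt) !inE at_ !orbT.
  - move=> a; rewrite inE => /orP[/eqP -> /=|at_].
      by rewrite (lA (r1, x)) // (perm_mem lt) !inE eqxx.
    by apply: lA; rewrite (perm_mem lt) !inE at_ !orbT.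
  exists (x :: y); split; first by rewrite /= sy st.
    move=> z; rewrite inE => /orP[/eqP ->|]; last exact: yA.
    by rewrite (lA (r1, x)) // (perm_mem lt) !inE eqxx.
  rewrite (perm_pair_derivative lt) (perm_big _ lt) /= monic_of_zeros_cons.
  move: yE; rewrite !big_cons /= => yE.
  rewrite monic_of_zeros_cons [RHS]scalerAr [r1 + (r2 + _)]addrA -yE -!mul_polyC polyCD; ring.
(* distinct nodes, in increasing order: one zero in each gap *)
have [l' l'l l's] : exists2 l', perm_eq l l' & sorted <%R (map snd l').
  exists (sort (fun a b => a.2 <= b.2) l); first by rewrite perm_sym perm_sort.
  rewrite lt_sorted_uniq_le; apply/andP; split.
    by rewrite (perm_uniq (perm_map _ (permEl (perm_sort _ _)))).
  rewrite sorted_map; apply: sort_sorted => a b /=; exact: le_total.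
pose sl := (size l).-1.
have sE : size l' = sl.+1 by rewrite -(perm_size l'l) /sl prednK.
pose x i := (nth (0, 0) l' i).2.
have xs i j : (i < j)%N -> (j < sl.+1)%N -> x i < x j.
  move=> ij jl; have := sorted_ltn_nth lt_trans 0 l's.
  move=> /(_ i j); rewrite !inE size_map sE jl (ltn_trans ij jl) => /(_ isT isT ij).
  by rewrite !(nth_map (0, 0)) // sE // (ltn_trans ij).
have [z zP] : {z : nat -> R & forall i, (i < sl)%N ->
    x i < z i < x i.+1 /\ root (pair_derivative l) (z i)}.
  apply: (@choice _ _ (fun i z => (i < sl)%N ->
    x i < z < x i.+1 /\ root (pair_derivative l) z)) => i.
  have [isl|] := boolP (i < sl)%N; last by exists 0.
  pose t := take i l' ++ drop i.+2 l'.
  have lt : perm_eq l (nth (0, 0) l' i :: nth (0, 0) l' i.+1 :: t).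
    rewrite (perm_trans l'l) // -{1}(cat_take_drop i l').
    rewrite (drop_nth (0, 0)) ?sE ?(ltnW isl) // 1?ltnW // (drop_nth (0, 0)) ?sE //.
    by rewrite perm_catC /= perm_cons perm_cons perm_catC.
  rewrite (perm_pair_derivative lt).
  case E1 : (nth (0, 0) l' i) => [r1 x1]; case E2 : (nth _ _ _) => [r2 x2].
  have m1 : (r1, x1) \in l by rewrite (perm_mem l'l) -E1 mem_nth // sE ltnW.
  have m2 : (r2, x2) \in l by rewrite (perm_mem l'l) -E2 mem_nth // sE.
  have x1E : x1 = x i by rewrite /x E1.
  have x2E : x2 = x i.+1 by rewrite /x E2.
  have [||||z zi rz] := @pair_derivative_root r1 r2 x1 x2 t.
  - exact: (lp _ m1).
  - exact: (lp _ m2).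
  - by rewrite x1E x2E xs.
  - move=> a /mapP[b bt ->]; rewrite x1E x2E.
    move: bt; rewrite mem_cat => /orP[|] /(nthP (0, 0))[j jl <-].
      move: jl; rewrite size_take sE ltnS (ltnW isl) => jl.
      by rewrite nth_take // [X in X || _](xs j i jl (ltnW isl)).
    move: jl; rewrite size_drop sE => jl; rewrite nth_drop.
    by apply/orP; right; apply: xs; [rewrite !addSn !ltnS leq_addr | rewrite -ltn_subRL].
  by exists z => _; rewrite -x1E -x2E.
pose y := mkseq z sl.
have sy : size y = sl by rewrite size_mkseq.
have ys : sorted <%R y.
  apply/(sortedP 0) => i; rewrite sy => isl; rewrite !nth_mkseq // 1?ltnW //.
  have [/andP[_ h1] _] := zP i (ltnW isl); have [/andP[h2 _] _] := zP i.+1 isl.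
  exact: lt_trans h1 h2.
have S0 : 0 < \sum_(a <- l) a.1.
  case: l l0 lp {ln lA ul l'l sl sE xs zP y sy ys} => // a l _ lp.
  rewrite big_cons ltr_pwDl ?lp ?mem_head // big_seq sumr_ge0 // => b bl.
  by rewrite ltW // lp // inE bl orbT.
have lc : (pair_derivative l)`_sl = \sum_(a <- l) a.1 by exact: coef_pair_derivative_last.
have szp : size (pair_derivative l) = sl.+1.
  apply/eqP; rewrite eqn_leq; apply/andP; split.
    by rewrite /sl prednK // size_pair_derivative.
  rewrite ltnNge; apply/negP => h; move: S0; rewrite -lc nth_default // ltxx.
  by [].
exists y; split; first by [].
  move=> _ /mapP[i + ->]; rewrite mem_iota => /andP[_ isl].
  have [/andP[h1 h2] _] := zP i isl.
  have xA j : (j < sl.+1)%N -> `|x j| <= A.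
    by move=> jl; apply: lA; rewrite (perm_mem l'l) mem_nth // sE.
  have := xA i (ltnW isl); have := xA i.+1 isl.
  by rewrite !ler_norml => /andP[_ h3] /andP[h4 _]; rewrite ltW ?(le_lt_trans h4) //= ltW // (lt_le_trans h2).
have ->: \sum_(a <- l) a.1 = lead_coef (pair_derivative l).
  by rewrite /lead_coef szp -lc.
apply: all_roots_prod_XsubC; first by rewrite szp sy.
  by apply/allP => _ /mapP[i + ->]; rewrite mem_iota => /andP[_ isl]; have [] := zP i isl.
by rewrite uniq_rootsE; apply: sorted_uniq ys; [exact: lt_trans|exact: ltxx].
Qed.

End weighted_derivatives.

(** * Power sums of the zeros of a weighted derivative *)

Section power_sums.
Context {R : realType}.
Implicit Types (l : seq (R * R)) (s y : seq R) (p q : {poly R}).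

Definition power_sum s k : R := \sum_(x <- s) x ^+ k.

Definition weighted_power_sum l k : R := \sum_(a <- l) a.1 * a.2 ^+ k.

(** The polynomials u^d p(1/u): they turn the expansions at infinity of
   quotients of polynomials into power series in u at 0. *)
Fixpoint reversed_monic s : {poly R} :=
  if s is x :: t then (1 - x *: 'X) * reversed_monic t else 1.

Fixpoint reversed_derivative l : {poly R} :=
  if l is (r, x) :: t
  then r *: reversed_monic (map snd t) + (1 - x *: 'X) * reversed_derivative t
  else 0.

Lemma horner_1subZX (x u : R) : (1 - x *: 'X).[u] = 1 - x * u.
Proof. by rewrite hornerD hornerN hornerZ hornerX hornerC. Qed.

Lemma horner_reversed_monic s u : u != 0 ->
  (reversed_monic s).[u] = u ^+ size s * (monic_of_zeros s).[u^-1].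
Proof.
move=> u0; elim: s => [|x s IH] /=.
  by rewrite /monic_of_zeros big_nil !hornerC expr0 mul1r.
rewrite monic_of_zeros_cons !hornerM IH hornerXsubC exprS horner_1subZX.
by field.
Qed.

Lemma horner_reversed_derivative l u : u != 0 ->
  u * (reversed_derivative l).[u] = u ^+ size l * (pair_derivative l).[u^-1].
Proof.
move=> u0; elim: l => [|[r x] t IH] /=; first by rewrite !hornerC !mulr0.
rewrite hornerD [X in _ = _ * X]hornerD !hornerM !hornerZ hornerXsubC.
rewrite horner_1subZX horner_reversed_monic // size_map mulrDr (mulrCA u (1 - _)) IH exprS.
by field.
Qed.

Lemma poly_eq_horner_neq0 p q : (forall u, u != 0 -> p.[u] = q.[u]) -> p = q.
Proof.
move=> pq; apply/eqP; rewrite -subr_eq0; apply/negPn/negP => n0.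
pose rs : seq R := [seq n.+1%:R | n <- iota 0 (size (p - q))].
have : (size rs < size (p - q)%R)%N.
  apply: max_poly_roots => //.
    apply/allP => _ /mapP[n _ ->]; rewrite /root hornerD hornerN pq ?pnatr_eq0 //.
    by rewrite subrr.
  rewrite map_inj_uniq ?iota_uniq // => i j /eqP; rewrite eqr_nat eqSS.
  by move/eqP.
by rewrite size_map size_iota ltnn.
Qed.

(** The reversals agree wherever u is nonzero, that is, at infinitely many
   points. *)
Lemma reversed_derivative_eq l y : size l = (size y).+1 ->
  pair_derivative l = monic_of_zeros y ->
  reversed_derivative l = reversed_monic y.
Proof.
move=> sl ly; apply: poly_eq_horner_neq0 => u u0.
apply: (mulfI u0); rewrite horner_reversed_derivative // sl ly.
by rewrite horner_reversed_monic // exprS mulrA.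
Qed.

Section truncation.
Variable K : nat.

(** Power series are represented by their truncations at order K; the
   identities between them hold up to a multiple of 'X^K. *)
Definition geometric x : {poly R} := \poly_(i < K) x ^+ i.

Lemma geometricE x : geometric x * (1 - x *: 'X) = 1 - x ^+ K *: 'X^K.
Proof.
rewrite /geometric; elim: K => [|k IH]; first by rewrite poly_def big_ord0 mul0r !expr0 scale1r subrr.
have -> : \poly_(i < k.+1) x ^+ i = \poly_(i < k) x ^+ i + x ^+ k *: 'X^k.
  by rewrite !poly_def big_ord_recr.
by rewrite mulrDl IH !exprS -!mul_polyC polyCM; ring.
Qed.

Definition weighted_series l := \poly_(i < K) weighted_power_sum l i.

Definition power_sum_series s := \poly_(i < K) power_sum s i.

Lemma weighted_series_cons r x t :
  weighted_series ((r, x) :: t) = r *: geometric x + weighted_series t.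
Proof.
apply/polyP => i; rewrite coefD coefZ !coef_poly /weighted_power_sum big_cons /=.
by case: ifP => _; rewrite ?mulr0 ?addr0.
Qed.

Lemma power_sum_series_cons x s :
  power_sum_series (x :: s) = geometric x + power_sum_series s.
Proof.
apply/polyP => i; rewrite coefD !coef_poly /power_sum big_cons /=.
by case: ifP => _; rewrite ?addr0.
Qed.

(** Sum of the partial fractions r_j / (1 - x_j u), each expanded as a
   geometric series. *)
Lemma weighted_seriesP l : exists h, weighted_series l *
  reversed_monic (map snd l) = reversed_derivative l + h * 'X^K.
Proof.
elim: l => [|[r x] t [h hE]].
  exists 0; rewrite mul0r addr0 /= mulr1; apply/polyP => i.
  by rewrite coef_poly coef0 /weighted_power_sum big_nil if_same.
exists (- r *: (x ^+ K *: reversed_monic (map snd t)) + (1 - x *: 'X) * h).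
rewrite weighted_series_cons /= mulrDl.
rewrite [X in _ + X](_ : _ = (1 - x *: 'X) * (weighted_series t * reversed_monic (map snd t))).
  rewrite hE -scalerAl mulrA geometricE -!mul_polyC; ring.
ring.
Qed.

(** Logarithmic derivative: each 1 / (1 - x u) equals 1 + u x / (1 - x u), and
   the derivative of 1 - x u is - x. *)
Lemma power_sum_seriesP s : exists h, power_sum_series s * reversed_monic s =
  (size s)%:R * reversed_monic s - 'X * (reversed_monic s)^`() + h * 'X^K.
Proof.
elim: s => [|x t [h hE]].
  exists 0; rewrite /= derivC !(mulr0, mul0r, mulr1, subr0, addr0); apply/polyP => i.
  by rewrite coef_poly coef0 /power_sum big_nil if_same.
exists (- (x ^+ K *: reversed_monic t) + (1 - x *: 'X) * h).
rewrite power_sum_series_cons /= derivM derivB derivC derivZ derivX mulrDl.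
rewrite [X in _ + X](_ : _ = (1 - x *: 'X) * (power_sum_series t * reversed_monic t)).
  by rewrite hE mulrA geometricE -!mul_polyC -natr1; ring.
ring.
Qed.

(** [reversed_monic s] is 1 at 0, hence coprime to 'X^K. *)
Lemma reversed_monic_cancel s p q h : (p - q) * reversed_monic s = h * 'X^K ->
  forall i, (i < K)%N -> p`_i = q`_i.
Proof.
move=> pq i iK.
have : 'X^K %| (p - q) * reversed_monic s by rewrite pq dvdp_mull.
rewrite Gauss_dvdpl; last first.
  rewrite coprimep_expl // coprimep_sym -['X]subr0 -polyC0 coprimep_XsubC /root.
  suff -> : (reversed_monic s).[0] = 1 by rewrite oner_neq0.
  elim: s {pq} => [|x s IH] /=; first by rewrite hornerC.
  by rewrite hornerM IH horner_1subZX mulr0 subr0 mul1r.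
move=> /dvdpP[g gE]; apply/eqP; rewrite -subr_eq0 -coefB gE coefMXn iK.
by [].
Qed.

End truncation.

(** With W, S and T the generating series of the weighted power sums, of the
   power sums of the nodes and of those of y, the hypothesis says that
   reversed_monic y = W * reversed_monic s. The operator u d/du applied to the
   logarithm of this identity gives W * (S - T) = W + u W', where the first W
   on the right stems from the nodes being one more than the zeros; this is
   the statement, coefficient by coefficient. *)
Theorem power_sums_of_derivative l y : size l = (size y).+1 ->
  pair_derivative l = monic_of_zeros y ->
  forall k, \sum_(i < k) weighted_power_sum l i *
     (power_sum (map snd l) (k - i) - power_sum y (k - i)) =
   k%:R * weighted_power_sum l k.
Proof.
move=> sl ly k; set s := map snd l.
have [h1] := weighted_seriesP k.+1 l; rewrite (reversed_derivative_eq sl ly) -/s.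
set W := weighted_series _ _ => h1E.
have [h2] := power_sum_seriesP k.+1 s; set S := power_sum_series _ _ => h2E.
have [h3] := power_sum_seriesP k.+1 y; set T := power_sum_series _ _ => h3E.
have ss : size s = (size y).+1 by rewrite size_map.
have yE : reversed_monic y = W * reversed_monic s - h1 * 'X^(k.+1).
  by rewrite h1E addrK.
have dyE : 'X * (reversed_monic y)^`() = 'X * W^`() * reversed_monic s
   + W * ('X * (reversed_monic s)^`()) - ('X * h1^`() + h1 * k.+1%:R) * 'X^(k.+1).
  by rewrite yE derivB !derivM derivXn -mulr_natr /= exprS; ring.
have sE : 'X * (reversed_monic s)^`() =
   (size y).+1%:R * reversed_monic s + h2 * 'X^(k.+1) - S * reversed_monic s.
  by rewrite h2E ss; ring.
(* W * (S - T) = W + 'X * W^`() up to a multiple of 'X^(k.+1) *)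
have main : exists h, (W * (S - T) - (W + 'X * W^`())) * reversed_monic s = h * 'X^(k.+1).
  exists (- T * h1 - h3 + (size y)%:R * h1 - ('X * h1^`() + h1 * k.+1%:R) + W * h2).
  move: h3E; rewrite dyE sE yE -(natr1 (size y)) => h3E.
  apply/eqP; rewrite -subr_eq0; apply/eqP.
  move/eqP: h3E; rewrite -subr_eq0 => /eqP h3E.
  rewrite -[RHS]oppr0 -h3E; ring.
case: main => h /reversed_monic_cancel /(_ k (ltnSn k)).
rewrite coefD coefXM coefM.
have cS i : (i <= k)%N -> (S - T)`_i = power_sum s i - power_sum y i.
  by move=> ik; rewrite coefB !coef_poly ltnS ik.
have cW i : (i <= k)%N -> W`_i = weighted_power_sum l i.
  by move=> ik; rewrite coef_poly ltnS ik.
rewrite big_ord_recr /= subnn cS // cW //.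
have -> : power_sum s 0 - power_sum y 0 = 1.
  rewrite /power_sum; under eq_bigr do rewrite expr0.
  under [X in _ - X]eq_bigr do rewrite expr0.
  by rewrite !big_const_seq !count_predT !iter_addr_0 ss -natrB // subSnn.
rewrite mulr1 addrC => /addrI E.
under eq_bigr => i _ do rewrite -cW ?(ltnW (ltn_ord i)) // -cS ?leq_subr //.
rewrite E; case: k {h1 h1E h2 S h2E h3 T h3E yE dyE sE h cS E} W cW => [|k] W cW.
  by rewrite mul0r.
by rewrite coef_deriv cW // mulr_natl.
Qed.

End power_sums.

(** * Stability of the moment recursion *)

Section euler.
Context {R : realType}.
Implicit Types (u v w q : nat -> R).

(** The relation that determines the decrements q of the power sums from the
   weighted power sums w; the term i = 0 of the sum is q k, so that q can be
   computed recursively. For k = 0 it is void. *)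
Definition newton_relation w q :=
  w 0%N = 1 /\ forall k, \sum_(i < k) w i * q (k - i)%N = k%:R * w k.

Definition moment_dist K u v : R := \sum_(i < K.+1) `|u i - v i|.

Lemma moment_dist_ge0 K u v : 0 <= moment_dist K u v.
Proof. by apply: sumr_ge0. Qed.

Lemma le_moment_dist K u v i : (i <= K)%N -> `|u i - v i| <= moment_dist K u v.
Proof.
move=> iK; rewrite /moment_dist (bigD1 (Ordinal (iK : (i < K.+1)%N))) //=.
by rewrite lerDl sumr_ge0.
Qed.

Lemma moment_dist_le K u v (e : R) : (forall i, (i <= K)%N -> `|u i - v i| <= e) ->
  moment_dist K u v <= K.+1%:R * e.
Proof.
move=> h; rewrite /moment_dist mulr_natl.
have -> : e *+ K.+1 = \sum_(i < K.+1) e by rewrite sumr_const card_ord.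
by apply: ler_sum => i _; apply: h; rewrite -ltnS.
Qed.

Lemma moment_dist_triangle K v u w :
  moment_dist K u w <= moment_dist K u v + moment_dist K v w.
Proof.
rewrite /moment_dist -big_split /=; apply: ler_sum => i _.
by rewrite -[u i - w i](subrKA (v i)) ler_normD.
Qed.

(** By induction on k, the solution q k of the recursion is a polynomial in
   w 1, ..., w k, hence bounded and Lipschitz on bounded sets. *)
Lemma newton_lipschitz K (B : R) : 0 <= B -> exists2 C : R, 0 <= C &
  forall w w' q q', newton_relation w q -> newton_relation w' q' ->
    (forall i, (i <= K)%N -> `|w i| <= B) ->
    (forall i, (i <= K)%N -> `|w' i| <= B) ->
  forall k, (0 < k <= K)%N ->
    `|q k| <= C /\ `|q k - q' k| <= C * moment_dist K w w'.
Proof.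
move=> B0.
suff h j : (j <= K)%N -> exists2 C : R, 0 <= C &
  forall w w' q q', newton_relation w q -> newton_relation w' q' ->
    (forall i, (i <= K)%N -> `|w i| <= B) ->
    (forall i, (i <= K)%N -> `|w' i| <= B) ->
  forall k, (0 < k <= j)%N ->
    `|q k| <= C /\ `|q k - q' k| <= C * moment_dist K w w'.
  exact: h.
elim: j => [|j IH] jK.
  by exists 0 => // w w' q q' _ _ _ _ [|k].
have [C C0 hC] := IH (ltnW jK).
exists (C + j.+1%:R * (1 + B + C + B * C)).
  by rewrite addr_ge0 // mulr_ge0 // !addr_ge0 // mulr_ge0.
move=> w w' q q' wq wq' wB wB' k /andP[k0]; set D := moment_dist K w w'.
have D0 : 0 <= D by exact: moment_dist_ge0.
rewrite leq_eqVlt => /orP[/eqP kj|]; last first.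
  rewrite ltnS => kj; have [|h1 h2] := hC w w' q q' wq wq' wB wB' k; first by rewrite k0.
  have X0 : 0 <= j.+1%:R * (1 + B + C + B * C).
    by rewrite mulr_ge0 // !addr_ge0 // mulr_ge0.
  split; first by apply: le_trans h1 _; rewrite lerDl.
  by apply: le_trans h2 _; rewrite ler_wpM2r // lerDl.
subst k.
have E v p : newton_relation v p ->
    p j.+1 = j.+1%:R * v j.+1 - \sum_(i < j) v i.+1 * p (j - i)%N.
  case=> v0 /(_ j.+1); rewrite big_ord_recl v0 mul1r subn0 => <-.
  by under eq_bigr do rewrite lift0 subSS; rewrite addrK.
have hq i : (i < j)%N -> `|q (j - i)%N| <= C /\ `|q (j - i)%N - q' (j - i)%N| <= C * D.
  by move=> ij; apply: hC => //; rewrite subn_gt0 ij leq_subr.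
have sumE (x : R) : \sum_(i < j) x = j%:R * x by rewrite sumr_const card_ord mulr_natl.
have jj : j%:R <= j.+1%:R :> R by rewrite ler_nat.
split.
  rewrite (E w) //; apply: le_trans (ler_normB _ _) _.
  have h1 : `|j.+1%:R * w j.+1| <= j.+1%:R * B by rewrite normrM normr_nat ler_wpM2l // wB.
  have h2 : `|\sum_(i < j) w i.+1 * q (j - i)%N| <= j.+1%:R * (B * C).
    apply: le_trans (ler_norm_sum _ _ _) _.
    apply: (@le_trans _ _ (\sum_(i < j) B * C)).
      apply: ler_sum => i _; rewrite normrM ler_pM //; first by apply: wB; exact: leq_trans (ltn_ord i) (ltnW jK).
      by have [] := hq i (ltn_ord i).
    by rewrite sumE ler_wpM2r // mulr_ge0.
  apply: le_trans (lerD h1 h2) _.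
  have := ler0n R j.+1; nra.
rewrite (E w q) // (E w' q') //.
rewrite (_ : _ - _ = j.+1%:R * (w j.+1 - w' j.+1) -
   \sum_(i < j) ((w i.+1 - w' i.+1) * q (j - i)%N + w' i.+1 * (q (j - i)%N - q' (j - i)%N))); last first.
  rewrite [X in _ = _ - X](_ : _ = \sum_(i < j) (w i.+1 * q (j - i)%N - w' i.+1 * q' (j - i)%N)).
    by rewrite sumrB; ring.
  by apply: eq_bigr => i _; ring.
apply: le_trans (ler_normB _ _) _.
have h1 : `|j.+1%:R * (w j.+1 - w' j.+1)| <= j.+1%:R * D.
  by rewrite normrM normr_nat ler_wpM2l // le_moment_dist.
have h2 : `|\sum_(i < j) ((w i.+1 - w' i.+1) * q (j - i)%N + w' i.+1 * (q (j - i)%N - q' (j - i)%N))|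
    <= j.+1%:R * (D * C + B * (C * D)).
  apply: le_trans (ler_norm_sum _ _ _) _.
  apply: (@le_trans _ _ (\sum_(i < j) (D * C + B * (C * D)))).
    apply: ler_sum => i _; apply: le_trans (ler_normD _ _) _.
    have [q1 q2] := hq i (ltn_ord i).
    have iK : (i.+1 <= K)%N by exact: leq_trans (ltn_ord i) (ltnW jK).
    by rewrite !normrM lerD // ler_pM // ?wB' ?le_moment_dist.
  by rewrite sumE ler_wpM2r // addr_ge0 ?mulr_ge0.
apply: le_trans (lerD h1 h2) _; have := ler0n R j.+1.
have BD : 0 <= B * D by rewrite mulr_ge0.
have CD : 0 <= C * D by rewrite mulr_ge0.
move=> j0; rewrite -subr_ge0.
rewrite (_ : _ - _ = C * D + j.+1%:R * (B * D)); last by ring.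
by rewrite addr_ge0 // mulr_ge0.
Qed.

Lemma gronwall (e d : nat -> R) (a : R) T : 0 <= a -> (forall m, 0 <= d m) ->
  0 <= e 0%N ->
  (forall m, (m < T)%N -> e m.+1 <= (1 + a) * e m + d m) ->
  e T <= (1 + a) ^+ T * (e 0%N + \sum_(m < T) d m).
Proof.
move=> a0 d0 e0; elim: T => [|T IH] h; first by rewrite big_ord0 addr0 expr0 mul1r.
apply: le_trans (h T (ltnSn _)) _.
have a1 : 1 <= (1 + a) ^+ T.+1 by rewrite exprn_ege1 // lerDl.
rewrite big_ord_recr /= addrA mulrDr; apply: lerD; last by rewrite ler_peMl.
rewrite exprS -mulrA ler_wpM2l ?addr_ge0 // IH // => m mT.
by apply: h; rewrite ltnW.
Qed.

Lemma expr_1D_le_expR (c : R) n T : 0 <= c -> (T <= n)%N ->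
  (1 + c / n%:R) ^+ T <= expR c.
Proof.
move=> c0 Tn; have [->|n0] := eqVneq n 0%N.
  by rewrite invr0 mulr0 addr0 expr1n -expR0 ler_expR.
apply: (@le_trans _ _ (expR (c / n%:R) ^+ T)).
  by rewrite lerXn2r ?nnegrE ?addr_ge0 ?divr_ge0 ?expR_ge0 ?expR_ge1Dx.
rewrite -expRM_natl ler_expR mulrCA ler_piMr // ler_pdivrMr ?ltr0n ?lt0n //.
by rewrite mul1r ler_nat.
Qed.

(** Before the time tau n, the steps 1 / (n - m - 1) are comparable to 1 / n. *)
Lemma step_ge (tau : R) n m T : tau < 1 -> (0 < n)%N -> T%:R <= n%:R * tau ->
  (m < T)%N -> 0 < (n - m.+1)%:R :> R /\
  (n - m.+1)%:R^-1 <= (1 - tau)^-1 / n%:R :> R.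
Proof.
move=> t1 n0 Tn mT.
have n0' : 0 < n%:R :> R by rewrite ltr0n.
have t1' : 0 < 1 - tau by rewrite subr_gt0.
have mn : m.+1%:R <= n%:R * tau.
  by apply: le_trans Tn; rewrite ler_nat.
have mn' : (m.+1 <= n)%N.
  by rewrite -(ler_nat R); apply: le_trans mn _; rewrite ler_piMr // ltW.
have h : (1 - tau) * n%:R <= (n - m.+1)%:R.
  by rewrite natrB // mulrBl mul1r lerD2l lerN2 mulrC.
have h0 : 0 < (1 - tau) * n%:R by rewrite mulr_gt0.
split; first exact: lt_le_trans h.
by rewrite -invfM lef_pV2 // posrE // (lt_le_trans h0).
Qed.

(** Here M is the exact recursion driven by itself, and z is a recursion driven
   by another sequence w, up to the errors err. Each step of size O(1/n)
   expands the distance by at most 1 + O(1/n), by the Lipschitz bound for the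
   decrements, and adds O(1/n) times the distance from w to z; n steps multiply
   the distance by a bounded factor (Gronwall). *)
Lemma euler_perturbation K (B tau : R) : 0 <= B -> tau < 1 -> exists2 C : R, 0 <= C &
  forall n T (z M w q q' : nat -> nat -> R) (err : nat -> R),
    (0 < n)%N -> T%:R <= n%:R * tau ->
    (forall m, 0 <= err m) ->
    (forall m, (m < T)%N -> newton_relation (w m) (q m)) ->
    (forall m, (m < T)%N -> newton_relation (M m) (q' m)) ->
    (forall m i, (m < T)%N -> (i <= K)%N -> `|w m i| <= B) ->
    (forall m i, (m < T)%N -> (i <= K)%N -> `|M m i| <= B) ->
    (forall m, (m <= T)%N -> z m 0%N = M m 0%N) ->
    (forall m k, (m < T)%N -> (0 < k <= K)%N ->
      `|z m.+1 k - (z m k + (z m k - q m k) / (n - m.+1)%:R)| <= err m) ->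
    (forall m k, (m < T)%N -> (0 < k <= K)%N ->
      M m.+1 k = M m k + (M m k - q' m k) / (n - m.+1)%:R) ->
  moment_dist K (z T) (M T) <=
    C * (moment_dist K (z 0%N) (M 0%N) +
         n%:R^-1 * (\sum_(m < T) moment_dist K (w m) (z m)) +
         \sum_(m < T) err m).
Proof.
move=> B0 t1; have [L L0 hL] := newton_lipschitz K B0.
pose c := (1 - tau)^-1; have c0 : 0 < c by rewrite invr_gt0 subr_gt0.
pose a := K.+1%:R * (c * (1 + L)).
have a0 : 0 <= a by rewrite /a !mulr_ge0 ?addr_ge0 // ltW.
have KcL0 : 0 <= K.+1%:R * (c * L) :> R by rewrite !mulr_ge0 // ltW.
exists (expR a * (1 + K.+1%:R * (c * L) + K.+1%:R)).
  by rewrite mulr_ge0 ?expR_ge0 ?addr_ge0.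
move=> n T z M w q q' err n0 Tn err0 wq Mq wB MB z0 zS MS.
set D := moment_dist K.
have D0 u v : 0 <= D u v by exact: moment_dist_ge0.
have nV0 : 0 <= n%:R^-1 :> R by rewrite invr_ge0.
pose d m := K.+1%:R * (err m + c / n%:R * (L * D (w m) (z m))).
have d0 m : 0 <= d m.
  by rewrite mulr_ge0 ?addr_ge0 // !mulr_ge0 // ltW.
have T_n : (T <= n)%N.
  by rewrite -(ler_nat R); apply: le_trans Tn _; rewrite ler_piMr // ltW.
have step m : (m < T)%N -> D (z m.+1) (M m.+1) <=
    (1 + a / n%:R) * D (z m) (M m) + d m.
  move=> mT; have [N0 Nc] := step_ge t1 n0 Tn mT.
  have [wqm Mqm] := (wq m mT, Mq m mT).
  have hk k : (k <= K)%N -> `|z m.+1 k - M m.+1 k| <= `|z m k - M m k| +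
      (err m + c / n%:R * (D (z m) (M m) + L * (D (w m) (z m) + D (z m) (M m)))).
    move=> kK; have [->|k0] := posnP k.
      rewrite !z0 ?(ltnW mT) // !subrr normr0 add0r addr_ge0 // mulr_ge0 //.
        by rewrite mulr_ge0 // ltW.
      by rewrite addr_ge0 // mulr_ge0 // addr_ge0.
    have kK' : (0 < k <= K)%N by rewrite k0.
    have [_ hq] := hL _ _ _ _ wqm Mqm (wB m ^~ mT) (MB m ^~ mT) k kK'.
    rewrite MS // (_ : _ - _ = (z m.+1 k - (z m k + (z m k - q m k) / (n - m.+1)%:R))
      + ((z m k - M m k) + ((z m k - M m k) - (q m k - q' m k)) / (n - m.+1)%:R));
      last by ring.
    apply: le_trans (ler_normD _ _) _; rewrite addrCA; apply: lerD; first exact: zS.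
    apply: le_trans (ler_normD _ _) _; apply: lerD => //.
    rewrite normrM mulrC normfV (gtr0_norm N0); apply: ler_pM => //.
    apply: le_trans (ler_normB _ _) _; apply: lerD; first exact: le_moment_dist.
    by apply: le_trans hq _; rewrite ler_wpM2l // moment_dist_triangle.
  rewrite {1}/D /moment_dist.
  apply: (le_trans (ler_sum _ (fun (k : 'I_K.+1) _ => hk k (ltnSE (ltn_ord k))))).
  rewrite big_split /= sumr_const card_ord -/(moment_dist K _ _) -/D /d /a.
  rewrite -[X in _ + X <= _]mulr_natl.
  rewrite le_eqVlt; apply/orP; left; apply/eqP; ring.
have := gronwall (e := fun m => D (z m) (M m)) _ d0 (D0 _ _) step.
move=> /(_ (divr_ge0 a0 (ler0n _ _))) h; apply: le_trans h _.
rewrite -[X in _ <= X]mulrA; apply: ler_pM.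
- by rewrite exprn_ge0 // addr_ge0 // divr_ge0.
- by rewrite addr_ge0 // ?sumr_ge0.
- exact: expr_1D_le_expR.
rewrite /d -mulr_sumr big_split /= -!mulr_sumr.
set S1 := \sum_(_ < _) _; set S2 := \sum_(_ < _) _.
have S10 : 0 <= S1 by apply: sumr_ge0.
have S20 : 0 <= n%:R^-1 * S2 by rewrite mulr_ge0 //; apply: sumr_ge0.
have := D0 (z 0%N) (M 0%N); set X := D (z _) _ => X0.
rewrite -subr_ge0 (_ : _ - _ = (K.+1%:R * (c * L) + K.+1%:R) * X +
   (n%:R^-1 * S2) * (1 + K.+1%:R) + (1 + K.+1%:R * (c * L)) * S1); last by ring.
by rewrite !addr_ge0 // mulr_ge0 // ?addr_ge0.
Qed.

End euler.

(** * Convergence of the noiseless moment recursion *)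

(** Step m of the scheme for n is compared with the steps p m + i, i < p, of the
   scheme for n p. *)
Lemma refined_step_bounds n m p i : (m.+1 < n)%N -> (i < p)%N ->
  [/\ (0 < n - m)%N, (0 < n * p - (p * m + i).+1)%N,
      (p * (n - m.+1) <= n * p - (p * m + i).+1)%N,
      (n * p - (p * m + i).+1 <= p * (n - m))%N & (n - m = (n - m.+1).+1)%N].
Proof. by move=> *; split; nia. Qed.

Section cauchy.
Context {R : realType}.

Lemma cauchy_sequence_cvg (x : nat -> R) :
  (forall e : R, 0 < e -> exists N, forall n p, (N <= n)%N -> (N <= p)%N ->
     `|x n - x p| <= e) -> cvgn x.
Proof.
move=> h; apply: cauchy_cvg; apply: cauchy_exP => e e0.
have [N hN] := h (e / 2) (divr_gt0 e0 (ltr0Sn _ 1)).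
exists (x N); exists N => // n /= Nn.
by rewrite /ball /= (le_lt_trans (hN _ _ _ Nn)) // ltr_pdivrMr // mulr_natr mulr2n ltrDl.
Qed.

Lemma cvg_cauchy_sequence (x : nat -> R) : cvgn x -> forall e : R, 0 < e ->
  exists N, forall n p, (N <= n)%N -> (N <= p)%N -> `|x n - x p| <= e.
Proof.
move=> /cvgrPdist_le xl e e0.
have [N _ hN] := xl (e / 2) (divr_gt0 e0 (ltr0Sn _ 1)).
exists N => n p Nn Np; rewrite -(subrKA (limn x)) (le_trans (ler_normD _ _)) //.
rewrite (splitr e) lerD //; last exact: hN.
by rewrite distrC; exact: hN.
Qed.

(** The schemes for n and for p are both compared with the one for n p. Grouping
   by p the steps of the scheme for n p gives a perturbation of the scheme for
   n, with an error O(1/n^2) per step, so that [euler_perturbation] yields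
   O(1/n); symmetrically for p. Hence the sequence is Cauchy. *)
Lemma euler_cauchy K (B tau : R) (U Q : nat -> nat -> nat -> R) :
  0 <= B -> 0 <= tau < 1 ->
  (forall n m, (0 < n)%N -> m%:R <= n%:R * tau -> newton_relation (U n m) (Q n m)) ->
  (forall n m i, (0 < n)%N -> m%:R <= n%:R * tau -> (i <= K)%N -> `|U n m i| <= B) ->
  (forall n m k, (0 < n)%N -> m.+1%:R <= n%:R * tau -> (0 < k <= K)%N ->
     U n m.+1 k = U n m k + (U n m k - Q n m k) / (n - m.+1)%:R) ->
  (forall i, (i <= K)%N -> cvgn (fun n => U n 0%N i)) ->
  forall k, (k <= K)%N -> cvgn (fun n => U n (Num.truncn (n%:R * tau)) k).
Proof.
move=> B0 /andP[t0 t1] UN UB US U0.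
pose T n := Num.truncn (n%:R * tau).
have Tn n : (T n)%:R <= n%:R * tau by rewrite truncn_le // mulr_ge0.
pose c := (1 - tau)^-1; have c0 : 0 < c by rewrite invr_gt0 subr_gt0.
have [L L0 hL] := @newton_lipschitz R K B B0.
have [C C0 hC] := @euler_perturbation R K B tau B0 t1.
have mono n a b : (a <= b)%N -> b%:R <= n%:R * tau -> a%:R <= n%:R * tau.
  by move=> ab; apply: le_trans; rewrite ler_nat.
have QL n m k : (0 < n)%N -> m%:R <= n%:R * tau -> (0 < k <= K)%N -> `|Q n m k| <= L.
  move=> n0 mn kK; have Um := UN n m n0 mn.
  by have [] := hL _ _ _ _ Um Um (fun i => UB n m i n0 mn) (fun i => UB n m i n0 mn) k kK.
have [S S0 SE] : exists2 S : R, 0 <= S & S = (B + L) * c.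
  by exists ((B + L) * c) => //; rewrite mulr_ge0 ?addr_ge0 // ltW.
have U00 n m : (0 < n)%N -> m%:R <= n%:R * tau -> U n m 0%N = 1.
  by move=> n0 mn; have [] := UN n m n0 mn.
have inc n a b k : (0 < n)%N -> (a <= b)%N -> b%:R <= n%:R * tau -> (k <= K)%N ->
    `|U n b k - U n a k| <= (b - a)%:R * (S / n%:R).
  move=> n0 ab bn kK; have nV0 : 0 <= n%:R^-1 :> R by rewrite invr_ge0.
  have [->|k0] := posnP k.
    rewrite (U00 n b) // (U00 n a) // ?subrr ?normr0; last exact: mono _ _ _ ab bn.
    by rewrite mulr_ge0 // divr_ge0.
  have kK' : (0 < k <= K)%N by rewrite k0.
  rewrite -(telescope_sumr (fun m => U n m k) ab).
  rewrite (le_trans (ler_norm_sum _ _ _)) //.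
  apply: (@le_trans _ _ (\sum_(a <= i < b) S / n%:R)); last first.
    by rewrite sumr_const_nat mulr_natl.
  rewrite big_nat [leRHS]big_nat; apply: ler_sum => m /andP[am mb].
  have [N0 Nc] := step_ge t1 n0 bn mb.
  have mbn : m%:R <= n%:R * tau := mono _ _ _ (ltnW mb) bn.
  rewrite US //; last exact: mono _ _ _ mb bn.
  rewrite addrAC subrr add0r normrM normfV (gtr0_norm N0) SE -mulrA.
  apply: ler_pM => //.
  by rewrite (le_trans (ler_normB _ _)) // lerD ?UB ?QL.
have incd n a b : (0 < n)%N -> (a <= b)%N -> b%:R <= n%:R * tau ->
    moment_dist K (U n b) (U n a) <= K.+1%:R * ((b - a)%:R * (S / n%:R)).
  by move=> n0 ab bn; apply: moment_dist_le => i iK; apply: inc.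
pose E := c * ((1 + L) * (K.+1%:R * S)) + c * c * (B + L).
have E0 : 0 <= E by rewrite addr_ge0 ?mulr_ge0 ?addr_ge0 ?mulr_ge0 // ltW.
(* the scheme for n p, sampled every p steps, against the scheme for n *)
have cmp n p : (0 < n)%N -> (0 < p)%N ->
    moment_dist K (U (n * p)%N (p * T n)%N) (U n (T n)) <=
    C * (moment_dist K (U (n * p)%N 0%N) (U n 0%N) + E / n%:R).
  move=> n0 p0; set N := (n * p)%N.
  have N0 : (0 < N)%N by rewrite muln_gt0 n0.
  have NR : N%:R = n%:R * p%:R :> R by rewrite natrM.
  have nR : 0 < n%:R :> R by rewrite ltr0n.
  have pR : 0 < p%:R :> R by rewrite ltr0n.
  have pm m : (m <= T n)%N -> (p * m)%N%:R <= N%:R * tau.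
    move=> mT; rewrite NR natrM mulrAC mulrC ler_pM2r //.
    exact: mono _ _ _ mT (Tn n).
  have := hC n (T n) (fun m => U N (p * m)%N) (U n) (fun m => U N (p * m)%N)
    (fun m => Q N (p * m)%N) (Q n) (fun=> E / n%:R ^+ 2) n0 (Tn n).
  have mT m : (m < T n)%N -> m%:R <= n%:R * tau by move=> mT; exact: mono _ _ _ (ltnW mT) (Tn n).
  rewrite [X in n%:R^-1 * X]big1 ?mulr0 ?addr0; last first.
    by move=> i _; rewrite /moment_dist big1 // => j _; rewrite subrr normr0.
  rewrite muln0 sumr_const card_ord => h.
  have h' := h _ _ _ _ _ _ _ _; apply: (le_trans (h' _ _ _ _ _ _ _ _)) => {h h'}.
  - by move=> _; rewrite divr_ge0 // exprn_ge0.
  - by move=> m mTn; apply: UN => //; apply: pm; exact: ltnW.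
  - by move=> m mTn; apply: UN => //; exact: mT.
  - by move=> m i mTn iK; apply: UB => //; apply: pm; exact: ltnW.
  - by move=> m i mTn iK; apply: UB => //; exact: mT.
  - move=> m mTn; rewrite !U00 //; last exact: pm.
    exact: mono _ _ _ mTn (Tn n).
  - move=> m k mTn kK.
    have [h0 hc] := step_ge t1 n0 (Tn n) mTn.
    pose F i := U N (p * m + i)%N k - Q N (p * m + i)%N k.
    pose H i : R := (N - (p * m + i).+1)%:R^-1.
    pose h : R := (n - m.+1)%:R^-1.
    have pmS : (p * m.+1)%N%:R <= N%:R * tau by exact: pm.
    have sub i : (i <= p)%N -> (p * m + i)%N%:R <= N%:R * tau.
      by move=> ip; apply: (mono _ _ _ _ pmS); rewrite mulnS addnC leq_add2r.
    have -> : U N (p * m.+1)%N k - (U N (p * m)%N k + (U N (p * m)%N k - Q N (p * m)%N k) / (n - m.+1)%:R)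
      = \sum_(0 <= i < p) (H i * (F i - F 0%N) + (H i - h / p%:R) * F 0%N).
      rewrite opprD addrA.
      have -> : U N (p * m.+1)%N k - U N (p * m)%N k = \sum_(0 <= i < p) H i * F i.
        have := @telescope_sumr _ 0%N p (fun i => U N (p * m + i)%N k) (leq0n p).
        rewrite addn0 -mulnSr => <-; rewrite big_nat [RHS]big_nat.
        apply: eq_bigr => i /andP[_ ip]; rewrite addnS US //; last first.
          by rewrite -addnS; exact: sub.
        by rewrite /H /F addrAC subrr add0r mulrC.
      rewrite -[F 0%N]/(U N (p * m + 0)%N k - Q N (p * m + 0)%N k) addn0.
      set F0 := _ - Q _ _ _.
      have -> : F0 / (n - m.+1)%:R = \sum_(0 <= i < p) (h / p%:R) * F0.
        rewrite sumr_const_nat subn0 -[RHS]mulr_natr -/h.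
        by field; rewrite gt_eqF.
      by rewrite -sumrB; apply: eq_bigr => i _; ring.
    have [kg kK2] := andP kK.
    have F0B : `|F 0%N| <= B + L.
      by rewrite (le_trans (ler_normB _ _)) // lerD ?UB ?QL ?sub.
    (* the drift F varies little over p fine steps *)
    have dF i : (i < p)%N -> `|F i - F 0%N| <= (1 + L) * (K.+1%:R * S) / n%:R.
      move=> ip; have d1 : moment_dist K (U N (p * m + i)%N) (U N (p * m + 0)%N) <= K.+1%:R * S / n%:R.
        apply: (le_trans (incd N _ _ N0 _ _)); first by rewrite leq_add2l.
          exact/sub/ltnW.
        rewrite subnDl subn0 -!mulrA ler_pM2l ?ltr0n // mulrCA; apply: ler_wpM2l => //.
        by rewrite NR invfM mulrCA ger_pMr ?invr_gt0 // ler_pdivrMr // mul1r ler_nat ltnW.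
      have q1 : `|Q N (p * m + i)%N k - Q N (p * m + 0)%N k| <=
          L * moment_dist K (U N (p * m + i)%N) (U N (p * m + 0)%N).
        have i1 := sub i (ltnW ip); have i2 := sub 0%N (leq0n p).
        by have [] := hL _ _ _ _ (UN _ _ N0 i1) (UN _ _ N0 i2)
          (fun j => UB N _ j N0 i1) (fun j => UB N _ j N0 i2) k kK.
      rewrite /F (_ : _ - _ = (U N (p * m + i)%N k - U N (p * m + 0)%N k) -
        (Q N (p * m + i)%N k - Q N (p * m + 0)%N k)); last by ring.
      rewrite (le_trans (ler_normB _ _)) // -mulrA mulrDl mul1r lerD //.
        exact: le_trans (le_moment_dist _ _ kK2) d1.
      by rewrite (le_trans q1) // ler_wpM2l.
    (* the p fine steps have almost the same length, 1/p of the coarse step *)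
    have Hh i : (i < p)%N -> 0 <= H i <= h / p%:R /\ `|H i - h / p%:R| <= c * c / n%:R ^+ 2 / p%:R.
      move=> ip.
      have n1 : (m.+1 < n)%N.
        by rewrite -subn_gt0 -(ltr_nat R).
      have [ynat z0 z1 z2 nm] := refined_step_bounds n1 ip.
      have y0 : 0 < (n - m)%:R :> R by rewrite ltr0n.
      have hp : h / p%:R = (p * (n - m.+1))%N%:R^-1 by rewrite natrM invfM mulrC.
      have H0 : 0 <= H i by rewrite invr_ge0.
      have H1 : H i <= h / p%:R.
        by rewrite hp lef_pV2 ?ler_nat // posrE ltr0n // muln_gt0 p0 subn_gt0.
      have H2 : (p * (n - m))%N%:R^-1 <= H i.
        by rewrite lef_pV2 ?ler_nat // posrE ltr0n // muln_gt0 p0.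
      split; first by rewrite H0.
      rewrite distrC ger0_norm ?subr_ge0 //.
      apply: (@le_trans _ _ (h / p%:R - (p * (n - m))%N%:R^-1)); first by rewrite lerD2l lerN2.
      have -> : h / p%:R - (p * (n - m))%N%:R^-1 = h * (n - m)%:R^-1 / p%:R.
        rewrite natrM nm -natr1 /h; field; rewrite natr1 pnatr_eq0 /= !gt_eqF //.
      rewrite ler_pM2r ?invr_gt0 // expr2 invfM mulrACA; apply: ler_pM => //; first by rewrite invr_ge0 ltW.
      by apply: le_trans hc; rewrite lef_pV2 ?posrE // ler_nat nm.
    apply: le_trans (ler_norm_sum _ _ _) _.
    apply: (@le_trans _ _ (\sum_(0 <= i < p) (E / n%:R ^+ 2 / p%:R))); last first.
      by rewrite sumr_const_nat subn0 -[X in X <= _]mulr_natr divfK // gt_eqF.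
    rewrite big_nat [leRHS]big_nat; apply: ler_sum => i /andP[_ ip].
    have [/andP[H0 H1] H2] := Hh i ip.
    apply: le_trans (ler_normD _ _) _; rewrite !normrM (ger0_norm H0).
    have e1 : H i * `|F i - F 0%N| <= (c / n%:R / p%:R) * ((1 + L) * (K.+1%:R * S) / n%:R).
      by apply: ler_pM => //; [apply: le_trans H1 _; rewrite ler_pM2r ?invr_gt0|exact: dF].
    have e2 : `|H i - h / p%:R| * `|F 0%N| <= (c * c / n%:R ^+ 2 / p%:R) * (B + L).
      by apply: ler_pM.
    apply: le_trans (lerD e1 e2) _; rewrite le_eqVlt; apply/orP; left; apply/eqP.
    by rewrite /E; field; rewrite !gt_eqF.
  - by move=> m k mTn kK; apply: US => //; exact: mono _ _ _ mTn (Tn n).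
  - rewrite ler_wpM2l // lerD2l.
    have -> : E / n%:R ^+ 2 *+ T n = E / n%:R * ((T n)%:R / n%:R).
      by rewrite expr2 invfM -[LHS]mulr_natr; ring.
    rewrite ler_piMr ?divr_ge0 // ler_pdivrMr // mul1r.
    by apply: (le_trans (Tn n)); rewrite ler_piMr // ltW.
clearbody E.
(* p * T n and n * T p differ by at most n + p steps of size 1 / (n p) *)
have CS n p k : (0 < n)%N -> (0 < p)%N -> (k <= K)%N ->
    `|U (n * p)%N (p * T n)%N k - U (p * n)%N (n * T p)%N k| <= S / n%:R + S / p%:R.
  move=> n0 p0 kK; rewrite [(p * n)%N]mulnC.
  have n0R : 0 < n%:R :> R by rewrite ltr0n.
  have p0R : 0 < p%:R :> R by rewrite ltr0n.
  have hT a : a%:R * tau < (T a).+1%:R by rewrite truncnS_gt.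
  have aux a b : (0 < a)%N -> (0 < b)%N ->
      (b * T a)%N%:R <= (a * b)%N%:R * tau /\ (b * T a <= a * T b + a)%N.
    move=> a0 b0; have ha : (b * T a)%N%:R <= (a * b)%N%:R * tau.
      by rewrite !natrM mulrAC mulrC ler_wpM2r.
    split=> //; rewrite -(ler_nat R) (le_trans ha) // -mulnSr !natrM -mulrA.
    by rewrite ler_wpM2l // ltW.
  have [h1 h2] := aux n p n0 p0; have [h3 h4] := aux p n p0 n0.
  rewrite [(p * n)%N]mulnC in h3.
  have N0 : (0 < n * p)%N by rewrite muln_gt0 n0.
  have fin (x : nat) : (x <= n + p)%N -> x%:R * (S / (n * p)%N%:R) <= S / n%:R + S / p%:R.
    move=> xnp; apply: (@le_trans _ _ ((n + p)%N%:R * (S / (n * p)%N%:R))).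
      by rewrite ler_wpM2r ?divr_ge0 // ler_nat.
    rewrite le_eqVlt natrM natrD; apply/orP; left; apply/eqP.
    by field; rewrite !gt_eqF.
  have [le|/ltnW le] := leqP (p * T n) (n * T p).
    rewrite distrC; apply: le_trans (inc _ _ _ _ N0 le h3 kK) _.
    by apply: fin; rewrite leq_subLR (leq_trans h4) // leq_add2l leq_addl.
  apply: le_trans (inc _ _ _ _ N0 le h1 kK) _.
  by apply: fin; rewrite leq_subLR (leq_trans h2) // leq_add2l leq_addr.
move=> k kK; apply: cauchy_sequence_cvg => e e0.
have C1 : 0 < C + 1 by rewrite ltr_wpDl.
pose e1 := e / 4 / (C + 1) / K.+1%:R.
have e10 : 0 < e1 by rewrite !divr_gt0.
have /choice[N_ hN] : forall i, exists N, (i <= K)%N -> forall n p, (N <= n)%N -> (N <= p)%N ->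
    `|U n 0%N i - U p 0%N i| <= e1.
  move=> i; have [iK|] := boolP (i <= K)%N; last by exists 0%N.
  by have [N hN] := cvg_cauchy_sequence (U0 i iK) e10; exists N.
pose N1 := \max_(i < K.+1) N_ i.
have N1i i : (i <= K)%N -> (N_ i <= N1)%N.
  move=> iK; have iK' : (i < K.+1)%N by [].
  exact: (@leq_bigmax _ (fun j : 'I_K.+1 => N_ j) (Ordinal iK')).
pose X := (e / 4)^-1 * (E * C + S).
pose N2 := (Num.truncn X).+1.
exists (maxn 1 (maxn N1 N2)) => n p.
rewrite !geq_max => /andP[n0 /andP[nN1 nN2]] /andP[p0 /andP[pN1 pN2]].
have init a b : (0 < b)%N -> (N1 <= a)%N -> moment_dist K (U (a * b)%N 0%N) (U a 0%N) <= K.+1%:R * e1.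
  move=> b0 Na; apply: moment_dist_le => i iK; apply: hN => //.
    apply: leq_trans (N1i i iK) _.
    by apply: leq_trans Na _; rewrite leq_pmulr.
  exact: leq_trans (N1i i iK) Na.
have small a : (0 < a)%N -> (N2 <= a)%N -> (E * C + S) / a%:R <= e / 4.
  move=> a0 Na; rewrite ler_pdivrMr ?ltr0n // -ler_pdivrMl ?divr_gt0 //.
  apply: (@le_trans _ _ N2%:R); last by rewrite ler_nat.
  by rewrite ltW // truncnS_gt.
have Ce : C * (K.+1%:R * e1) <= e / 4.
  rewrite (_ : K.+1%:R * e1 = e / 4 / (C + 1)); last first.
    by rewrite /e1; field; rewrite !gt_eqF.
  by rewrite mulrCA ger_pMr ?divr_gt0 // ler_pdivrMr // mul1r lerDl.
have c1 := cmp n p n0 p0; have c2 := cmp p n p0 n0; have c3 := CS n p k n0 p0 kK.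
have d1 := le_moment_dist (U (n * p)%N (p * T n)%N) (U n (T n)) kK.
have d2 := le_moment_dist (U (p * n)%N (n * T p)%N) (U p (T p)) kK.
have i1 := ler_wpM2l C0 (init n p p0 nN1); have i2 := ler_wpM2l C0 (init p n n0 pN1).
have s1 := small n n0 nN2; have s2 := small p p0 pN2.
rewrite (_ : _ - _ = - (U (n * p)%N (p * T n)%N k - U n (T n) k) +
  (U (n * p)%N (p * T n)%N k - U (p * n)%N (n * T p)%N k) +
  (U (p * n)%N (n * T p)%N k - U p (T p) k)); last by ring.
apply: le_trans (ler_normD _ _) _; apply: le_trans (lerD (ler_normD _ _) (lexx _)) _.
rewrite normrN.
move: d1 d2 c1 c2 c3 i1 i2 s1 s2 Ce; rewrite !mulrDr !mulrDl.
have -> : C * (E / n%:R) = E * C / n%:R by ring.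
have -> : C * (E / p%:R) = E * C / p%:R by ring.
lra.
Qed.

End cauchy.

(** * Weierstrass approximation by Bernstein polynomials *)

Section bernstein.
Context {R : realType}.
Implicit Types (h : nat -> R) (x : R).

(** The Bernstein polynomial of degree n with values h 0, ..., h n, as the
   expectation of h at a binomial variable: the recursion conditions on the
   first trial. *)
Fixpoint bernstein n h : {poly R} :=
  if n is n'.+1
  then (1 - 'X) * bernstein n' h + 'X * bernstein n' (h \o S)
  else (h 0%N)%:P.

Lemma horner_bernsteinS n h x : (bernstein n.+1 h).[x] =
  (1 - x) * (bernstein n h).[x] + x * (bernstein n (h \o S)).[x].
Proof. by rewrite /= !(hornerD, hornerM, hornerN, hornerX, hornerC). Qed.

Lemma bernstein_linear n a h k x :
  (bernstein n (fun i => a * h i + k i)).[x] =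
  a * (bernstein n h).[x] + (bernstein n k).[x].
Proof.
elim: n h k => [|n IH] h k; first by rewrite /= !hornerC.
rewrite !horner_bernsteinS IH.
have -> : (fun i => a * h i + k i) \o S = (fun i => a * (h \o S) i + (k \o S) i) by [].
by rewrite IH; ring.
Qed.

Lemma bernstein_cst n a x : (bernstein n (fun=> a)).[x] = a.
Proof.
elim: n => [|n IH]; first by rewrite /= hornerC.
by rewrite horner_bernsteinS -[(fun=> a) \o S]/(fun=> a) IH; ring.
Qed.

Lemma bernstein_id n x : (bernstein n (fun i => i%:R)).[x] = n%:R * x.
Proof.
elim: n => [|n IH]; first by rewrite /= hornerC mul0r.
rewrite horner_bernsteinS.
have -> : (fun i => i%:R : R) \o S = (fun i => 1 * i%:R + 1).
  by apply/funext => i /=; rewrite mul1r natr1.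
by rewrite bernstein_linear bernstein_cst IH -natr1; ring.
Qed.

Lemma bernstein_sqr n x : (bernstein n (fun i => i%:R ^+ 2)).[x] =
  n%:R * x + n%:R * (n%:R - 1) * x ^+ 2.
Proof.
elim: n => [|n IH]; first by rewrite /= hornerC expr2 !mul0r addr0.
rewrite horner_bernsteinS.
have -> : (fun i => i%:R ^+ 2 : R) \o S = (fun i => 1 * i%:R ^+ 2 + (2 * i%:R + 1)).
  by apply/funext => i /=; rewrite -natr1; ring.
by rewrite bernstein_linear (bernstein_linear _ _ _ (fun=> 1)) bernstein_cst bernstein_id IH -natr1; ring.
Qed.

Lemma le_bernstein n h k x : 0 <= x <= 1 -> (forall i, (i <= n)%N -> h i <= k i) ->
  (bernstein n h).[x] <= (bernstein n k).[x].
Proof.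
move=> /andP[x0 x1]; elim: n h k => [|n IH] h k hk; first by rewrite /= !hornerC hk.
rewrite !horner_bernsteinS lerD // ler_wpM2l ?subr_ge0 //; apply: IH => i ni /=.
  by rewrite hk // ltnW.
exact: hk.
Qed.

Lemma segment_uniform_continuity (f : R -> R) a b (e : R) : continuous f -> 0 < e ->
  exists2 d : R, 0 < d &
    forall x y, a <= x <= b -> `|x - y| < d -> `|f x - f y| <= e.
Proof.
move=> cf e0.
have := @segment_compact R a b; rewrite compact_near_coveringP.
move=> /(_ R (0^'+) (fun d x => forall y, `|x - y| < d -> `|f x - f y| <= e)).
case=> [x abx|d /= d0 hd].
  have /cvgrPdist_lt /(_ (e / 2)) := cf x.
  case=> [|d /= d0 hd]; first by rewrite divr_gt0.
  exists (ball x (d / 2), [set t | t < d / 2]) => /=.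
    split; first by apply: nbhsx_ballx; rewrite divr_gt0.
    by apply: nbhs_right_lt; rewrite divr_gt0.
  move=> [x' t] [/= xx' td] y xy.
  have h1 : `|f x - f x'| < e / 2.
    by apply: hd; apply: lt_trans xx' _; rewrite ltr_pdivrMr // mulr_natr mulr2n ltrDl.
  have h2 : `|f x - f y| < e / 2.
    apply: hd; rewrite /= -(subrKA x') (le_lt_trans (ler_normD _ _)) // (splitr d) ltrD //.
    exact: lt_trans xy td.
  rewrite -(subrKA (f x)) (le_trans (ler_normD _ _)) // (splitr e) lerD //; last exact: ltW.
  by rewrite distrC ltW.
exists (d / 2); first by rewrite divr_gt0.
have d2 : 0 < d / 2 by rewrite divr_gt0.
have d2d : ball 0 d (d / 2).
  by rewrite /ball /= sub0r normrN gtr0_norm // ltr_pdivrMr // mulr_natr mulr2n ltrDl.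
move=> x y xab; apply: (hd (d / 2) d2d d2 x).
by rewrite /= in_itv.
Qed.

(** Bernstein's proof: on the segment rescaled to [0, 1], the difference of two
   values of f is at most e / 2 plus a multiple of the squared distance, and
   the Bernstein operator is positive and maps (x - i / n)^2 to
   x (1 - x) / n. *)
Theorem weierstrass (f : R -> R) (A e : R) : continuous f -> 0 < A -> 0 < e ->
  exists p : {poly R}, forall x, `|x| <= A -> `|f x - p.[x]| <= e.
Proof.
move=> cf A0 e0.
have e20 : 0 < e / 2 by rewrite divr_gt0.
have [d d0 hd] := @segment_uniform_continuity f (- A) A _ cf e20.
have [M M0 fM] : exists2 M : R, 0 <= M & forall x, `|x| <= A -> `|f x| <= M.
  have AA : - A <= A by rewrite ge0_cp // ltW.
  have cfn : {within `[- A, A], continuous (fun x => `|f x|)}.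
    by apply: continuous_subspaceT => x; apply: continuous_comp (cf x) _; exact: norm_continuous.
  have [z _ zM] := EVT_max AA cfn.
  by exists `|f z| => // x xA; apply: zM; rewrite in_itv /= -ler_norml.
pose g (u : R) := f (2 * A * u - A).
have gA u : 0 <= u <= 1 -> `|2 * A * u - A| <= A.
  by move=> /andP[u0 u1]; rewrite ler_norml; apply/andP; split; nra.
pose c := 2 * M / (d / (2 * A)) ^+ 2.
have dA0 : 0 < d / (2 * A) by rewrite divr_gt0 // mulr_gt0.
have c0 : 0 <= c by apply: divr_ge0; [exact: mulr_ge0|exact: sqr_ge0].
(* uniform continuity for close points, the bound M for distant ones *)
have gc x u : 0 <= x <= 1 -> 0 <= u <= 1 -> `|g x - g u| <= e / 2 + c * (x - u) ^+ 2.
  move=> x01 u01; have [xu|xu] := ltP (`|(2 * A * x - A) - (2 * A * u - A)|) d.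
    apply: le_trans (hd _ _ _ xu) _; first by rewrite -ler_norml gA.
    by rewrite lerDl mulr_ge0 // sqr_ge0.
  apply: (@le_trans _ _ (M + M)).
    by rewrite (le_trans (ler_normB _ _)) // lerD // fM // gA.
  have -> : M + M = c * (d / (2 * A)) ^+ 2.
    rewrite /c divfK; first by rewrite mulr_natl mulr2n.
    by rewrite expf_neq0 // gt_eqF.
  apply: (@le_trans _ _ (c * (x - u) ^+ 2)); last by rewrite lerDr ltW.
  rewrite ler_wpM2l // -[leRHS]real_normK ?num_real // lerXn2r ?nnegrE //.
    exact: ltW.
  move: xu; rewrite (_ : _ - _ = (x - u) * (2 * A)); last by ring.
  by rewrite normrM [X in _ * X]gtr0_norm ?mulr_gt0 // -ler_pdivrMr ?mulr_gt0.
pose n := (Num.truncn (c / (e / 2))).+1.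
have n0 : 0 < n%:R :> R by rewrite ltr0n.
pose B := bernstein n (fun i => g (i%:R / n%:R)).
have hB x : 0 <= x <= 1 -> `|g x - B.[x]| <= e.
  move=> x01; have [x0 x1] := andP x01.
  pose t i : R := e / 2 + c * (x - i%:R / n%:R) ^+ 2.
  (* the variance of the binomial law *)
  have tE : (bernstein n t).[x] <= e.
    have -> : t = (fun i => (c / n%:R ^+ 2) * i%:R ^+ 2 + ((- (2 * c * x / n%:R)) * i%:R + (e / 2 + c * x ^+ 2))).
      by apply/funext => i; rewrite /t; field; rewrite gt_eqF.
    rewrite bernstein_linear (bernstein_linear _ _ _ (fun=> _)) bernstein_cst.
    rewrite bernstein_id bernstein_sqr.
    rewrite (_ : _ + _ = e / 2 + c * (x * (1 - x)) / n%:R); last by field; rewrite gt_eqF.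
    rewrite [leRHS](splitr e) lerD2l ler_pdivrMr // -ler_pdivrMl //.
    apply: (@le_trans _ _ (c / (e / 2))); last by rewrite ltW // truncnS_gt.
    rewrite [leRHS]mulrC ler_wpM2l ?invr_ge0 ?(ltW e20) // ler_piMr //.
    by rewrite mulr_ile1 ?subr_ge0 // gerBl.
  rewrite ler_norml; apply/andP; split.
    rewrite lerNl opprB lerBlDl.
    apply: le_trans (_ : g x + (bernstein n t).[x] <= _); last by rewrite lerD2l.
    have -> : g x + (bernstein n t).[x] = (bernstein n (fun i => 1 * t i + g x)).[x].
      by rewrite (bernstein_linear _ _ _ (fun=> g x)) bernstein_cst mul1r addrC.
    apply: le_bernstein => // i ni; rewrite mul1r -lerBlDr.
    apply: le_trans (ler_norm _) _; rewrite distrC gc //.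
    by rewrite divr_ge0 //= ler_pdivrMr // mul1r ler_nat.
  rewrite lerBlDl.
  apply: le_trans (_ : B.[x] + (bernstein n t).[x] <= _); last by rewrite lerD2l.
  rewrite -[leLHS](bernstein_cst n _ x).
  have -> : B.[x] + (bernstein n t).[x] = (bernstein n (fun i => 1 * t i + g (i%:R / n%:R))).[x].
    by rewrite bernstein_linear mul1r addrC.
  apply: le_bernstein => // i ni; rewrite mul1r -lerBlDr.
  apply: le_trans (ler_norm _) _; rewrite gc //.
  by rewrite divr_ge0 //= ler_pdivrMr // mul1r ler_nat.
clearbody B.
exists (B \Po ((2 * A)^-1 *: ('X + A%:P))) => y yA.
rewrite horner_comp !(hornerZ, hornerD, hornerX, hornerC).
set u := (2 * A)^-1 * _.
have yE : y = 2 * A * u - A by rewrite /u mulrA divff ?mul1r ?addrK // mulf_neq0 // gt_eqF.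
rewrite {1}yE; apply: hB; move: yA; rewrite ler_norml => /andP[y1 y2].
by rewrite /u ler_pdivlMl ?ler_pdivrMl ?mulr_gt0 // mulr0 mulr1; apply/andP; split; lra.
Qed.

End bernstein.

(** * Empirical measures, quantiles and Riemann sums *)

Section riemann.
Context {R : realType}.
Implicit Types (s : seq R) (f q : R -> R).
Local Notation leb := (@lebesgue_measure R).

Definition average s f : R := (size s)%:R^-1 * \sum_(x <- s) f x.

Lemma integral_empirical_measure s f : measurable_fun setT f ->
  (\int[empirical_measure s]_x (f x)%:E = (average s f)%:E)%E.
Proof.
move=> mf.
have ge0 (g : R -> \bar R) : measurable_fun setT g -> (forall x, 0 <= g x)%E ->
    (\int[empirical_measure s]_x g x = (size s)%:R^-1%:E * \sum_(x <- s) g x)%E.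
  move=> mg g0; rewrite ge0_integral_mscale //=; congr (_ * _)%E.
  rewrite ge0_integral_measure_sum // (big_nth 0) big_mkord; apply: eq_bigr => i _.
  by rewrite integral_dirac // diracT mul1e.
rewrite integralE !ge0 //; last 2 first.
- by apply: measurable_funeneg; exact/measurable_EFinP.
- by apply: measurable_funepos; exact/measurable_EFinP.
have E1 x : ((EFin \o f)^\+ x = (Num.max (f x) 0)%:E)%E by rewrite funeposE EFin_max.
have E2 x : ((EFin \o f)^\- x = (Num.max (- f x) 0)%:E)%E by rewrite funenegE EFin_max.
under eq_bigr do rewrite E1; under [X in (_ - _ * X)%E]eq_bigr do rewrite E2.
rewrite !sumEFin -!EFinM -EFinB -mulrBr -sumrB /average; congr (_ * _)%:E.
apply: eq_bigr => x _; rewrite /Num.max.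
by case: (ltP (f x) 0) => h1; case: (ltP (- f x) 0) => h2; lra.
Qed.

(** On each of the K intervals, f o q varies by at most L times the increment of
   q; these increments add up to at most 2 A. *)
Lemma riemann_sum_monotone q f (A L : R) K :
  {homo q : x y / x <= y} -> (forall x, `|q x| <= A) -> 0 <= L ->
  measurable_fun setT f ->
  (forall x y, `|x| <= A -> `|y| <= A -> `|f x - f y| <= L * `|x - y|) ->
  (0 < K)%N ->
  leb.-integrable `[0, 1] (EFin \o (f \o q)) /\
  `|\int[leb]_(u in `[0, 1]) f (q u) - K%:R^-1 * \sum_(j < K) f (q (j%:R / K%:R))|
    <= L * (2 * A) / K%:R.
Proof.
move=> qh qA L0 mf fL K0.
have K0' : 0 < K%:R :> R by rewrite ltr0n.
have mq : measurable_fun setT q by apply: nondecreasing_measurable.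
have mfq : measurable_fun setT (f \o q) by exact: measurableT_comp.
have fb : forall x, `|f (q x)| <= `|f (q 0)| + L * (2 * A).
  move=> x; rewrite -[f (q x)](subrK (f (q 0))) addrC (le_trans (ler_normD _ _)) // lerD2l.
  rewrite (le_trans (fL _ _ (qA _) (qA _))) // ler_wpM2l // (le_trans (ler_normB _ _)) //.
  by rewrite mulr_natl mulr2n lerD.
have intg (a b : itv_bound R) : (leb [set` Interval a b] < +oo)%E ->
    leb.-integrable [set` Interval a b] (EFin \o (f \o q)).
  move=> fin; apply: measurable_bounded_integrable => //.
    exact: measurable_funTS.
  exists (`|f (q 0)| + L * (2 * A)); split; first exact: num_real.
  by move=> M bM x _ /=; rewrite (le_trans (fb x)) // ltW.
have mitv (x y : R) b0 b1 : (leb [set` Interval (BSide b0 x) (BSide b1 y)] < +oo)%E.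
  by rewrite lebesgue_measure_itv /=; case: ifP => _; rewrite ?ltry // -EFinB ltry.
split; first exact: intg.
pose p j : R := j%:R / K%:R.
have pS j : p j.+1 = p j + K%:R^-1 by rewrite /p -natr1 mulrDl mul1r.
have pl j : p j < p j.+1 by rewrite pS ltrDl invr_gt0.
have piece j : `|\int[leb]_(u in `]p j, p j.+1]) f (q u) - K%:R^-1 * f (q (p j))| <=
    L * (q (p j.+1) - q (p j)) / K%:R.
  have lebp : fine (leb `]p j, p j.+1]) = K%:R^-1.
    by rewrite lebesgue_measure_itv /= lte_fin pl -EFinB /= pS addrAC subrr add0r.
  have -> : K%:R^-1 * f (q (p j)) = \int[leb]_(u in `]p j, p j.+1]) f (q (p j)).
    by rewrite Rintegral_cst // lebp mulrC.
  have ic c : leb.-integrable `]p j, p j.+1] (EFin \o (fun=> c)).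
    apply: measurable_bounded_integrable => //; first exact: mitv.
    exists `|c|; split; first exact: num_real.
    by move=> M cM x _ /=; exact: ltW.
  rewrite -RintegralB //; last exact: intg.
  have iB : leb.-integrable `]p j, p j.+1] (EFin \o (fun u => f (q u) - f (q (p j)))).
    have mI : measurable (`]p j, p j.+1] : set (measurableTypeR R)) by exact: measurable_itv.
    have := integrableB mI (intg _ _ (mitv _ _ _ _)) (ic (f (q (p j)))).
    by apply: eq_integrable => // u _ /=; rewrite EFinB.
  apply: le_trans (le_normr_Rintegral _ iB) _ => //.
  rewrite -[X in _ * X]lebp -Rintegral_cst //; apply: le_Rintegral => //.
    by have := integrable_norm iB.
  move=> u /=; rewrite in_itv /= => /andP[u1 u2].
  rewrite (le_trans (fL _ _ (qA _) (qA _))) // ler_wpM2l // ger0_norm ?subr_ge0.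
    by rewrite lerD2r; exact: qh.
  by apply: qh; exact: ltW.
have ind j : `|\int[leb]_(u in `[0, p j]) f (q u) - K%:R^-1 * \sum_(i < j) f (q (p i))|
    <= L * (q (p j) - q 0) / K%:R.
  elim: j => [|j IH].
    rewrite big_ord0 mulr0 subr0 /p mul0r subrr mulr0 mul0r.
    by rewrite set_itv1 Rintegral_set1 normr0.
  have p0 : 0 <= p j by rewrite divr_ge0.
  have := @Rintegral_itvB R (f \o q) (BLeft 0) (BRight (p j.+1)) (p j) _ _ _.
  move=> /(_ (intg _ _ (mitv _ _ _ _))).
  rewrite !bnd_simp => /(_ p0 (ltW (pl j))) E.
  rewrite big_ord_recr /= mulrDr.
  rewrite (_ : _ - _ = (\int[leb]_(u in `[0, p j]) f (q u) - K%:R^-1 * \sum_(i < j) f (q (p i)))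
    + (\int[leb]_(u in `]p j, p j.+1]) f (q u) - K%:R^-1 * f (q (p j)))); last first.
    by move: E; rewrite /comp => <-; ring.
  apply: le_trans (ler_normD _ _) _; apply: le_trans (lerD IH (piece j)) _.
  by rewrite le_eqVlt; apply/orP; left; apply/eqP; ring.
have pK : p K = 1 by rewrite /p divff // gt_eqF.
have := ind K; rewrite pK => h; apply: le_trans h _.
rewrite ler_pM2r ?invr_gt0 // ler_wpM2l // mulr_natl mulr2n.
have := qA 1; have := qA 0; rewrite !ler_norml; lra.
Qed.

Definition quantile s (u : R) : R :=
  nth 0 (sort <=%R s) (minn (Num.truncn (u * (size s)%:R)) (size s).-1).

Lemma quantile_le s (A : R) u : (0 < size s)%N -> (forall x, x \in s -> `|x| <= A) ->
  `|quantile s u| <= A.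
Proof.
move=> s0 sA; apply: sA; rewrite -(mem_sort <=%R) mem_nth // size_sort.
by rewrite (leq_ltn_trans (geq_minr _ _)) // prednK.
Qed.

Lemma quantile_homo s : (0 < size s)%N -> {homo quantile s : x y / x <= y}.
Proof.
move=> s0 x y xy.
have srt : sorted <=%R (sort <=%R s) by apply: sort_sorted; exact: le_total.
have lt u : (minn (Num.truncn (u * (size s)%:R)) (size s).-1 < size (sort <=%R s))%N.
  by rewrite size_sort (leq_ltn_trans (geq_minr _ _)) // prednK.
apply: (sorted_leq_nth le_trans le_refl 0 srt); rewrite ?inE //.
rewrite leq_min geq_minr andbT (leq_trans (geq_minl _ _)) //.
by apply: le_truncn; rewrite ler_wpM2r.
Qed.

Lemma sum_divn (g : nat -> R) N t : (0 < t)%N ->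
  \sum_(j < N * t) g (j %/ t)%N = t%:R * \sum_(i < N) g i.
Proof.
move=> t0; elim: N => [|N IH]; first by rewrite mul0n !big_ord0 mulr0.
rewrite mulSn addnC big_split_ord /= IH big_ord_recr /= mulrDr; congr (_ + _).
rewrite (eq_bigr (fun=> g N)); last first.
  by move=> i _; rewrite divnMDl // divn_small // addn0.
by rewrite sumr_const card_ord mulr_natl.
Qed.

(** On a grid with mesh 1 / (t * size s), the Riemann sum of f o quantile takes
   each value f (s_i) exactly t times. *)
Lemma average_quantile s f N t : (0 < t)%N -> size s = N.+1 ->
  (N.+1 * t)%N%:R^-1 * \sum_(j < N.+1 * t) f (quantile s (j%:R / (N.+1 * t)%N%:R)) =
  average s f.
Proof.
move=> t0 sN; rewrite natrM invfM -mulrA.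
rewrite (eq_bigr (fun j : 'I_(N.+1 * t) => f (nth 0 (sort <=%R s) (j %/ t)%N))); last first.
  move=> j _; rewrite /quantile sN succnK.
  have -> : j%:R * (N.+1%:R^-1 / t%:R) * N.+1%:R = j%:R / t%:R :> R.
    by field; rewrite ?nat1r ?natr1 !pnatr_eq0 -lt0n t0.
  have -> : Num.truncn (j%:R / t%:R : R) = (j %/ t)%N.
    apply: truncn_def; rewrite ler_pdivlMr ?ltr0n // ltr_pdivrMr ?ltr0n //.
    by rewrite -!natrM ler_nat ltr_nat leq_divM ltn_ceil.
  by congr (f (nth _ _ _)); apply/minn_idPl; rewrite -ltnS ltn_divLR.
rewrite (sum_divn (fun i => f (nth 0 (sort <=%R s) i))) // [t%:R^-1 * _]mulrA.
rewrite mulVf ?pnatr_eq0 -?lt0n // mul1r /average sN; congr (_ * _).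
rewrite -(perm_big _ (permEl (perm_sort <=%R s))) /= [RHS](big_nth 0) size_sort sN.
by rewrite big_mkord.
Qed.

End riemann.

(** * A quantile function with prescribed moments *)

Lemma ultra_fmap (T T' : Type) (f : T -> T') (F : set_system T) :
  UltraFilter F -> UltraFilter (f @ F).
Proof.
move=> FU; split; first exact: fmap_proper_filter.
move=> G GF FG; rewrite predeqE => A; split; last exact: FG.
move=> GA; have [//|FnA] := in_ultra_setVsetC (f @^-1` A) FU.
have GnA : G (~` A) by apply: FG; rewrite /= preimage_setC.
by have /filter_ex [? []] : G (A `&` ~` A) by exact: filterI.
Qed.

Section representation.
Context {R : realType}.
Implicit Types (s : seq R) (f q : R -> R) (p : {poly R}).
Local Notation leb := (@lebesgue_measure R).

Lemma eq0_of_le_div_nat (x C : R) : (forall t, (0 < t)%N -> `|x| <= C / t%:R) -> x = 0.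
Proof.
move=> h; apply/eqP/negPn/negP => x0; rewrite -normr_gt0 in x0.
pose t := (Num.truncn (C / `|x|)).+1.
have t0 : 0 < t%:R :> R by rewrite ltr0n.
have := h t (ltn0Sn _); rewrite leNgt => /negP; apply.
by rewrite ltr_pdivrMr // mulrC -ltr_pdivrMr // truncnS_gt.
Qed.

Definition lipschitz_within (A L : R) f :=
  forall x y, `|x| <= A -> `|y| <= A -> `|f x - f y| <= L * `|x - y|.

(** The average is itself a Riemann sum on arbitrarily fine grids, by
   [average_quantile], hence it is the integral of f o quantile. *)
Lemma average_riemann s f (A L : R) K : (0 < size s)%N ->
  (forall x, x \in s -> `|x| <= A) -> 0 <= L -> measurable_fun setT f ->
  lipschitz_within A L f -> (0 < K)%N ->
  `|average s f - K%:R^-1 * \sum_(j < K) f (quantile s (j%:R / K%:R))|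
    <= L * (2 * A) / K%:R.
Proof.
move=> s0 sA L0 mf fL K0.
have h t t0 := (@riemann_sum_monotone R (quantile s) f A L t (quantile_homo s0)
  (fun u => quantile_le u s0 sA) L0 mf fL t0).2.
suff -> : average s f = \int[leb]_(u in `[0, 1]) f (quantile s u) by exact: h.
apply/esym/eqP; rewrite -subr_eq0; apply/eqP.
apply: (@eq0_of_le_div_nat _ (L * (2 * A))) => t t0.
case sN : (size s) s0 => [//|N] _.
have Nt : (0 < N.+1 * t)%N by rewrite muln_gt0.
rewrite -(average_quantile f t0 sN) (le_trans (h _ Nt)) //.
have A0 : 0 <= A.
  case: s sN sA {h} => // x s _ sA.
  by rewrite (le_trans (normr_ge0 x)) // sA // mem_head.
rewrite ler_wpM2l ?mulr_ge0 // lef_pV2 ?posrE ?ltr0n // ler_nat.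
by rewrite mulSn leq_addr.
Qed.

Lemma poly_lipschitz p (A : R) : 0 <= A ->
  exists2 L : R, 0 <= L & lipschitz_within A L (horner p).
Proof.
move=> A0; suff [L [M [L0 M0 h _]]] : exists L M, [/\ 0 <= L, 0 <= M,
    lipschitz_within A L (horner p) & forall x, `|x| <= A -> `|p.[x]| <= M] by exists L.
elim/poly_ind: p => [|p c [L [M [L0 M0 pL pM]]]].
  exists 0, 0; split=> // [x y _ _|x _]; last by rewrite horner0 normr0.
  by rewrite !horner0 subrr normr0 mul0r.
exists (L * A + M), (M * A + `|c|); split.
- by rewrite addr_ge0 // mulr_ge0.
- by rewrite addr_ge0 // mulr_ge0.
- move=> x y xA yA; rewrite !hornerMXaddC.
  rewrite (_ : _ - _ = (p.[x] - p.[y]) * x + p.[y] * (x - y)); last by ring.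
  rewrite (le_trans (ler_normD _ _)) // [leRHS]mulrDl !normrM lerD //; last by rewrite ler_wpM2r // pM.
  by rewrite mulrAC ler_pM ?mulr_ge0 // pL.
- move=> x xA; rewrite hornerMXaddC (le_trans (ler_normD _ _)) // lerD2r normrM.
  by rewrite ler_pM // pM.
Qed.

Lemma le_average_diff s f q (A e : R) : (0 < size s)%N ->
  (forall x, x \in s -> `|x| <= A) ->
  (forall x, `|x| <= A -> `|f x - q x| <= e) -> `|average s f - average s q| <= e.
Proof.
move=> s0 sA fq; rewrite /average -mulrBr -sumrB normrM ger0_norm ?invr_ge0 //.
rewrite ler_pdivrMl ?ltr0n // (le_trans (ler_norm_sum _ _ _)) //.
rewrite big_seq (le_trans (ler_sum _ (fun x xs => fq x (sA x xs)))) //.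
by rewrite -big_seq big_const_seq count_predT iter_addr_0 mulr_natl.
Qed.

Lemma average_horner s p :
  average s (horner p) = \sum_(i < size p) p`_i * average s (fun x => x ^+ i).
Proof.
rewrite /average; under [RHS]eq_bigr do rewrite mulrCA.
rewrite -mulr_sumr; congr (_ * _).
under eq_bigr do rewrite horner_coef.
by rewrite exchange_big /=; apply: eq_bigr => i _; rewrite mulr_sumr.
Qed.

Lemma cvg_average_horner (s_ : nat -> seq R) (mom : nat -> R) p :
  (forall k, average (s_ n) (fun x => x ^+ k) @[n --> \oo] --> mom k) ->
  average (s_ n) (horner p) @[n --> \oo] --> \sum_(i < size p) p`_i * mom i.
Proof.
move=> h; under eq_fun do rewrite average_horner.
apply: cvg_big => [|i _]; first exact: add_continuous.
by apply: cvgM; [exact: cvg_cst|exact: h].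
Qed.

Section limit.
Variables (s_ : nat -> seq R) (A : R) (mom : nat -> R).
Hypothesis A0 : 0 < A.
Hypothesis s0 : forall n, (0 < size (s_ n))%N.
Hypothesis sA : forall n x, x \in s_ n -> `|x| <= A.
Hypothesis smom : forall k, average (s_ n) (fun x => x ^+ k) @[n --> \oo] --> mom k.

(** The quantile functions are bounded, so along an ultrafilter they converge
   pointwise; the limit is again nondecreasing, and Riemann sums with an error
   uniform in n carry the moments to the limit. *)
Lemma exists_limit_quantile : exists q : R -> R,
  [/\ {homo q : x y / x <= y}, (forall u, `|q u| <= A) &
   forall p, \int[leb]_(u in `[0, 1]) (p.[q u]) = \sum_(i < size p) p`_i * mom i].
Proof.
have [U [UU oU]] := ultraFilterLemma (_ : ProperFilter (\oo : set_system nat)).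
have Uc u : exists x : R, `|x| <= A /\ quantile (s_ n) u @[n --> U] --> x.
  have := @segment_compact R (- A) A; rewrite compact_ultra.
  move=> /(_ ((fun n => quantile (s_ n) u) @ U) (ultra_fmap _ UU)) [].
  - by apply: nearW => n /=; rewrite in_itv /= -ler_norml quantile_le // => x; exact: sA.
  - move=> x [/=]; rewrite in_itv /= -ler_norml => xA Ux; exists x; split=> //.
have [q qP] := choice Uc; exists q.
have qh : {homo q : x y / x <= y}.
  move=> x y xy; apply: (ler_cvg_to (qP x).2 (qP y).2).
  by apply: nearW => n; apply: quantile_homo.
split=> // [u|p]; first by have [] := qP u.
have [L L0 pL] := poly_lipschitz p (ltW A0).
have mp : measurable_fun setT (horner p).
  by apply: continuous_measurable_fun; exact: continuous_horner.
set l := \sum_(i < _) _.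
apply/eqP; rewrite -subr_eq0; apply/eqP.
apply: (@eq0_of_le_div_nat _ (2 * (L * (2 * A)))) => K K0.
have [_ h1] := @riemann_sum_monotone R q (horner p) A L K qh (fun u => (qP u).1) L0 mp pL K0.
have h2 : `|l - K%:R^-1 * \sum_(j < K) p.[q (j%:R / K%:R)]| <= L * (2 * A) / K%:R.
  have lim1 : average (s_ n) (horner p) @[n --> U] --> l.
    have h := cvg_average_horner (p := p) smom.
    by move=> B lB; apply: oU; exact: (h B lB).
  have lim2 : K%:R^-1 * \sum_(j < K) p.[quantile (s_ n) (j%:R / K%:R)] @[n --> U] -->
      K%:R^-1 * \sum_(j < K) p.[q (j%:R / K%:R)].
    apply: cvgM; first exact: cvg_cst.
    apply: cvg_big => [|j _]; first exact: add_continuous.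
    by apply: (cvg_comp _ (horner p) (qP _).2); exact: continuous_horner.
  apply: (ler_cvg_to (cvg_norm (cvgB lim1 lim2)) (cvg_cst _)).
  by apply: nearW => n; apply: (average_riemann _ (@sA n)).
rewrite -(subrKA (K%:R^-1 * \sum_(j < K) p.[q (j%:R / K%:R)])).
rewrite (le_trans (ler_normD _ _)) // -mulrA mulr_natl mulr2n lerD //.
by rewrite distrC.
Qed.
End limit.
End representation.

(** * The limit measure *)

Section limit_measure.
Context {R : realType}.
Implicit Types (s : seq R) (f q : R -> R) (p : {poly R}).
Local Notation leb := (@lebesgue_measure R).

Lemma integral_uniform01 (g : R -> \bar R) : measurable_fun setT g ->
  (\int[uniform_prob (@ltr01 R)]_x g x = \int[leb]_(x in `[0%R, 1%R]) g x)%E.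
Proof.
move=> mg; have ge0 h : measurable_fun setT h -> (forall x, 0 <= h x)%E ->
    (\int[uniform_prob (@ltr01 R)]_x h x = \int[leb]_(x in `[0%R, 1%R]) h x)%E.
  by move=> mh h0; rewrite integral_uniform // subr0 invr1 mul1e.
rewrite integralE [RHS]integralE !ge0 //.
- exact: measurable_funeneg.
- exact: measurable_funepos.
Qed.

Definition moments_cvg (A : R) (mom : nat -> R) (s_ : nat -> seq R) :=
  [/\ forall n, (0 < size (s_ n))%N, forall n x, x \in s_ n -> `|x| <= A &
      forall k, average (s_ n) (fun x => x ^+ k) @[n --> \oo] --> mom k].

(** The measure is the law of the limit quantile function q of
   [exists_limit_quantile] under the uniform law. It depends on the moments
   only: by polynomial approximation, the average of a continuous function over
   any sequence with these limiting moments tends to its integral. *)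
Theorem exists_limit_measure (A : R) (mom : nat -> R) : 0 < A ->
  (exists s_ : nat -> seq R, moments_cvg A mom s_) ->
  exists nu : probability R R, forall s_ : nat -> seq R, moments_cvg A mom s_ ->
    forall f, continuous f ->
      (average (s_ n) f)%:E @[n --> \oo] --> (\int[nu]_x (f x)%:E)%E.
Proof.
move=> A0 [s0_ [s01 s02 s03]].
have [q [qh qA qmom]] := exists_limit_quantile A0 s01 s02 s03.
have mq : measurable_fun setT q by apply: nondecreasing_measurable.
have mq' : @measurable_fun _ _ (measurableTypeR R) R setT q by exact: mq.
pose X : {RV (uniform_prob (@ltr01 R)) >-> R} :=
  @mfun_Sub _ _ (measurableTypeR R) R q (mem_set mq').
exists (distribution (uniform_prob (@ltr01 R)) X) => s_ [s1 s2 s3] f cf.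
pose I01 (g : R -> R) := \int[leb]_(u in `[0, 1]) g (q u).
have int01 g : continuous g -> leb.-integrable `[0, 1] (EFin \o (g \o q)).
  move=> cg; have [p hp] := weierstrass cg A0 ltr01.
  have [L L0 pL] := poly_lipschitz p (ltW A0).
  apply: measurable_bounded_integrable => //.
  - have : (leb `[0%R, 1%R]%classic < +oo)%E by rewrite lebesgue_measure_itv /= lte_fin ltr01 -EFinB ltry.
    by [].
  - apply: measurable_funTS; apply: measurableT_comp => //.
    exact: continuous_measurable_fun.
  exists (1 + (`|p.[0]| + L * A)); split; first exact: num_real.
  move=> M bM x _ /=; apply: le_trans (ltW bM).
  rewrite -[g (q x)](subrK p.[q x]) (le_trans (ler_normD _ _)) // lerD ?hp //.
  rewrite -[p.[q x]](subrK p.[0]) addrC (le_trans (ler_normD _ _)) // lerD2l.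
  have h0 : `|0 : R| <= A by rewrite normr0 ltW.
  by rewrite (le_trans (pL _ _ (qA x) h0)) // subr0 ler_wpM2l.
have nuE : (\int[distribution (uniform_prob (@ltr01 R)) X]_x (f x)%:E = (I01 f)%:E)%E.
  have mf : measurable_fun setT (EFin \o f).
    by apply/measurable_EFinP; exact: continuous_measurable_fun.
  have mfq : measurable_fun setT (EFin \o (f \o q)).
    apply/measurable_EFinP; apply: measurableT_comp => //.
    exact: continuous_measurable_fun.
  rewrite integralE !ge0_integral_distribution //; last 2 first.
  - exact: measurable_funeneg.
  - exact: measurable_funepos.
  transitivity (\int[uniform_prob (@ltr01 R)]_x (EFin \o (f \o q)) x)%E.
    rewrite [RHS]integralE; congr (_ - _)%E; apply: eq_integral => u _ /=.
      by rewrite !funeposE.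
    by rewrite !funenegE.
  rewrite (integral_uniform01 mfq) /I01 /Rintegral fineK //.
  exact: (integrable_fin_num _ (int01 f cf)).
rewrite nuE; apply: cvg_EFin; first exact: nearW.
apply/cvgrPdist_le => e e0.
have e3 : 0 < e / 3 by rewrite divr_gt0.
have [p hp] := weierstrass cf A0 e3.
have /cvgrPdist_le/(_ _ e3) := cvg_average_horner (p := p) s3.
apply: filterS => n; rewrite -qmom -/(I01 (horner p)) => hn.
have h1 : `|average (s_ n) f - average (s_ n) (horner p)| <= e / 3.
  by apply: (le_average_diff (s1 n) (@s2 n)).
have h2 : `|I01 f - I01 (horner p)| <= e / 3.
  rewrite /I01 -RintegralB //; last 2 first.
  - exact: int01.
  - by apply: int01; exact: continuous_horner.
  have iB : leb.-integrable `[0, 1] (EFin \o (fun u => f (q u) - p.[q u])).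
    apply: (int01 (fun x => f x - p.[x])) => x.
    by apply: cvgB; [exact: cf|exact: continuous_horner].
  apply: le_trans (le_normr_Rintegral _ iB) _ => //.
  have -> : e / 3 = \int[leb]_(u in `[0, 1]) (e / 3).
    have l1 : fine (leb `[0%R, 1%R]%classic) = 1.
      by rewrite lebesgue_measure_itv /= lte_fin ltr01 -EFinB subr0.
    have := @Rintegral_cst _ _ _ leb `[0%R, 1%R]%classic (measurable_itv _) (e / 3).
    by rewrite l1 mulr1.
  apply: le_Rintegral => //.
  - by have := integrable_norm iB.
  - by apply: (int01 (fun=> e / 3)) => x; exact: cvg_cst.
  - by move=> u _; exact: hp.
rewrite (_ : _ - _ = (I01 f - I01 (horner p)) + (I01 (horner p) - average (s_ n) (horner p)) -
  (average (s_ n) f - average (s_ n) (horner p))); last by rewrite /=; ring.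
rewrite (le_trans (ler_normB _ _)) // (_ : e = e / 3 + e / 3 + e / 3); last by field.
by rewrite lerD // (le_trans (ler_normD _ _)) // lerD.
Qed.

End limit_measure.

(** * Beta integrals *)

Section beta_integral.
Context {R : realType}.
Local Notation leb := (@lebesgue_measure R).

Section scaling.
Variables (s : R).
Hypothesis s0 : 0 < s.

Lemma measurable_scale : measurable_fun [set: measurableTypeR R]
  ((fun x : R => s * x) : _ -> measurableTypeR R).
Proof. by apply: (@measurable_funM _ _ R); [exact: measurable_cst|exact: measurable_id]. Qed.

(** Scaling the Lebesgue measure by s gives a measure with the same values on
   intervals. *)
Lemma ge0_integral_scale (f : R -> \bar R) : measurable_fun setT f ->
  (forall x, 0 <= f x)%E ->
  (\int[leb]_x f x = s%:E * \int[leb]_x f (s * x)%R)%E.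
Proof.
move=> mf f0.
have sE : ((NngNum (ltW s0))%:num = s)%R by [].
pose push : {measure set (measurableTypeR R) -> \bar R} :=
  measure_function_pushforward__canonical__measure_function_Measure leb measurable_scale.
transitivity (\int[mscale (NngNum (ltW s0)) push]_x f x)%E.
  apply: eq_measure_integral => A mA _.
  apply: lebesgue_measure_unique => // _ [[a b]] _ <-.
  rewrite /= /mscale /= /pushforward /=.
  have -> : (fun x : R => s * x) @^-1` `]a, b]%classic = `]a / s, b / s]%classic.
    by apply/seteqP; split=> x /=; rewrite !in_itv /= ltr_pdivrMr // ler_pdivlMr // (mulrC x).
  rewrite !lebesgue_measure_itv /= !lte_fin ltr_pM2r ?invr_gt0 //.
  case: ifP => _; last by rewrite mule0.
  by rewrite -!EFinD -EFinM; congr _%:E; field; rewrite gt_eqF.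
rewrite ge0_integral_mscale //; congr (_ * _)%E.
exact: (@ge0_integral_pushforward _ _ _ _ _ _ measurable_scale leb setT f measurableT mf (fun x _ => f0 x)).
Qed.
End scaling.

(** The density of the gamma law up to the exponential factor. Cutting it off at
   0 lets convolutions be integrals over the whole line. *)
Definition pos_power (x a : R) : R := if 0 < x then x `^ (a - 1) else 0.

Lemma pos_power_ge0 x a : 0 <= pos_power x a.
Proof. by rewrite /pos_power; case: ifP => // _; exact: powR_ge0. Qed.

Lemma mulr_pos_power x a : x * pos_power x a = pos_power x (a + 1).
Proof.
rewrite /pos_power; case: ifP => [x0|_]; last by rewrite mulr0.
rewrite -{1}(@powRr1 _ x) ?ltW // -powRD; first by congr (_ `^ _); ring.
by rewrite (gt_eqF x0) implybT.
Qed.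

Lemma pos_powerM s x a : 0 < s -> pos_power (s * x) a = s `^ (a - 1) * pos_power x a.
Proof.
move=> s0; rewrite /pos_power pmulr_rgt0 //; case: ifP => [x0|_]; last by rewrite mulr0.
by rewrite powRM // ltW.
Qed.

Lemma measurable_pos_power (a : R) : measurable_fun [set: R] (pos_power ^~ a).
Proof.
rewrite (_ : pos_power ^~ a = (fun x => x `^ (a - 1)) \* \1_`]0, +oo[).
  by apply: measurable_funM; [exact: measurable_powR|exact: measurable_indic].
apply/funext => x /=; rewrite /pos_power indicE mem_setE in_itv /= andbT.
by case: ifP => _; rewrite ?mulr1 ?mulr0.
Qed.

Lemma measurable_pos_power_sub (s a : R) : measurable_fun [set: R] (fun x => pos_power (s - x) a).
Proof.
apply: (measurableT_comp (measurable_pos_power a)).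
by apply: measurable_funB; [exact: measurable_cst|exact: measurable_id].
Qed.

(** The unnormalized beta integral, over [0, s]. *)
Definition convolution a b (s : R) : \bar R :=
  (\int[leb]_x (pos_power x a * pos_power (s - x) b)%:E)%E.

Lemma measurable_convolution (a b s : R) :
  measurable_fun [set: R] (fun x => (pos_power x a * pos_power (s - x) b)%:E).
Proof.
apply/measurable_EFinP; apply: measurable_funM.
- exact: measurable_pos_power.
- exact: measurable_pos_power_sub.
Qed.

Lemma convolution_ge0 a b s : (0 <= convolution a b s)%E.
Proof. by apply: integral_ge0 => x _; rewrite lee_fin mulr_ge0 // pos_power_ge0. Qed.

(** The substitution x := s x. *)
Lemma convolutionE a b s : convolution a b s =
  ((pos_power s (a + b))%:E * convolution a b 1)%E.
Proof.
have [s0|s0] := ltP 0 s; last first.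
  rewrite /convolution integral0_eq; last first.
    move=> x _; rewrite /pos_power; case: ifP => [x0|]; last by rewrite mul0r.
    by rewrite ltNge (_ : s - x <= 0) ?mulr0 // subr_le0 (le_trans s0) // ltW.
  by rewrite /pos_power ltNge s0 /= mul0e.
rewrite {1}/convolution (ge0_integral_scale s0) //; last 2 first.
- exact: measurable_convolution.
- by move=> x; rewrite lee_fin mulr_ge0 // pos_power_ge0.
have -> : (fun x => (pos_power (s * x) a * pos_power (s - s * x) b)%:E) =
    (fun x => (s `^ (a - 1) * s `^ (b - 1))%:E * (pos_power x a * pos_power (1 - x) b)%:E)%E.
  apply/funext => x; rewrite -[X in pos_power (X - _)]mulr1 -mulrBr !pos_powerM //.
  by rewrite -EFinM mulrACA.
rewrite ge0_integralZl //; last 3 first.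
- exact: measurable_convolution.
- by move=> x _; rewrite lee_fin mulr_ge0 // pos_power_ge0.
- by rewrite lee_fin mulr_ge0 // powR_ge0.
rewrite muleA -EFinM; congr (_%:E * _)%E.
rewrite /pos_power s0 -{1}(@powRr1 _ s) ?ltW // -!powRD ?(gt_eqF s0) ?implybT //.
by congr (_ `^ _); ring.
Qed.

(** x + (s - x) = s. *)
Lemma convolution_split a b s :
  (convolution (a + 1) b s + convolution a (b + 1) s = s%:E * convolution a b s)%E.
Proof.
have [s0|s0] := ltP 0 s; last first.
  have z x y : convolution x y s = 0%E.
    by rewrite convolutionE /pos_power ltNge s0 /= mul0e.
  by rewrite !z mule0 adde0.
rewrite /convolution -ge0_integralD //; last 4 first.
- by move=> x _; rewrite lee_fin mulr_ge0 // pos_power_ge0.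
- exact: measurable_convolution.
- by move=> x _; rewrite lee_fin mulr_ge0 // pos_power_ge0.
- exact: measurable_convolution.
rewrite -ge0_integralZl //; last 3 first.
- exact: measurable_convolution.
- by move=> x _; rewrite lee_fin mulr_ge0 // pos_power_ge0.
- by rewrite lee_fin ltW.
by apply: eq_integral => x _; rewrite -EFinD -EFinM -!mulr_pos_power; congr _%:E; ring.
Qed.

Lemma itv01_exhaustion :
  \bigcup_n `[n.+3%:R^-1, 1 - n.+3%:R^-1]%classic = `]0, 1[%classic :> set R.
Proof.
apply/seteqP; split=> [x [n _]|x]; rewrite /= !in_itv /= => /andP[x0 x1].
  have n0 : 0 < (n.+3)%:R^-1 :> R by rewrite invr_gt0.
  by rewrite (lt_le_trans n0) //= (le_lt_trans x1) // gerBl.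
pose m := Num.min x (1 - x); have m0 : 0 < m by rewrite lt_min x0 subr_gt0.
pose n := Num.truncn m^-1; exists n => //=; rewrite in_itv /=.
have nm : (n.+3)%:R^-1 <= m.
  rewrite -[leRHS]invrK lef_pV2 ?posrE ?invr_gt0 // (le_trans (ltW (truncnS_gt _))) //.
  by rewrite ler_nat; exact: leqW (leqW (leqnn _)).
have h1 : m <= x by rewrite ge_min lexx.
have h2 : m <= 1 - x by rewrite ge_min lexx orbT.
by rewrite (le_trans nm) //= lerBrDr -lerBrDl (le_trans nm).
Qed.

Lemma within_itv01_continuous (h : R -> R) (e : R) : 0 < e ->
  (forall x, 0 < x < 1 -> {for x, continuous h}) ->
  {within `[e, 1 - e], continuous h}.
Proof.
move=> e0 ch; apply/subspace_continuousP => x /=; rewrite in_itv /= => /andP[ex xe].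
apply: cvg_within_filter; apply: ch.
by rewrite (lt_le_trans e0) //= (le_lt_trans xe) // gtrBl.
Qed.

Lemma continuous_powR_gt0 (a x : R) : 0 < x -> {for x, continuous (fun y : R => y `^ a)}.
Proof.
move=> x0; apply: differentiable_continuous; apply/derivable1_diffP.
by apply: derivable_powR; rewrite in_itv /= x0.
Qed.

Lemma continuous_powR_onem (a x : R) : x < 1 -> {for x, continuous (fun y : R => (1 - y) `^ a)}.
Proof.
move=> x1; have := @continuous_comp R R R (fun y : R => 1 - y) (fun y : R => y `^ a) x.
apply; first by apply: cvgB; [exact: cvg_cst|exact: cvg_id].
by apply: continuous_powR_gt0; rewrite subr_gt0.
Qed.

Lemma integrable_powRM (a b e : R) : 0 < e ->
  leb.-integrable `[e, 1 - e] (EFin \o (fun x => x `^ a * (1 - x) `^ b)).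
Proof.
move=> e0; apply: continuous_compact_integrable; first exact: segment_compact.
apply: within_itv01_continuous => // x /andP[x0 x1].
by apply: cvgM; [exact: continuous_powR_gt0|exact: continuous_powR_onem].
Qed.

(** Staying away from 0 and 1 keeps all the integrands continuous; the boundary
   terms vanish as e tends to 0, because a and b are positive. *)
Lemma beta_by_parts (a b : R) (e : R) : 0 < e < 1 - e ->
  b * \int[leb]_(x in `[e, 1 - e]) (x `^ a * (1 - x) `^ (b - 1)) =
  a * \int[leb]_(x in `[e, 1 - e]) (x `^ (a - 1) * (1 - x) `^ b) +
  (e `^ a * (1 - e) `^ b - (1 - e) `^ a * e `^ b).
Proof.
move=> /andP[e0 e1].
pose F x : R := x `^ a; pose f x : R := a * x `^ (a - 1).
pose G x : R := - (1 - x) `^ b; pose g x : R := b * (1 - x) `^ (b - 1).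
have dF (x : R) : 0 < x -> is_derive x 1 F (f x) by move=> x0; exact: is_derive1_powR.
have dG (x : R) : x < 1 -> is_derive x 1 G (g x).
  move=> x1.
  have h1 : is_derive x 1 (fun y : R => 1 - y) (- 1).
    by have := is_deriveB (is_derive_cst (1 : R^o) x 1) (is_derive_id x 1); rewrite sub0r.
  have h2 : is_derive (1 - x) 1 (fun y : R => y `^ b) (b * (1 - x) `^ (b - 1)).
    by apply: is_derive1_powR; rewrite subr_gt0.
  have := is_deriveN (@is_derive1_comp R (fun y => y `^ b) (fun y => 1 - y) x _ _ h2 h1).
  by rewrite mulrN1 opprK.
have cont (h : R -> R) k (x : R) : is_derive x 1 h k -> {for x, continuous h}.
  by case=> dh _; apply: differentiable_continuous; apply/derivable1_diffP.
have e01 (x : R) : e <= x <= 1 - e -> 0 < x < 1.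
  by move=> /andP[ex xe]; rewrite (lt_le_trans e0) //= (le_lt_trans xe) // gtrBl.
have LR (h k : R -> R) : (forall x : R, 0 < x < 1 -> is_derive x 1 h (k x)) ->
    derivable_oo_LRcontinuous h e (1 - e) /\ {in `]e, 1 - e[, h^`()%classic =1 k}.
  move=> hk; have e01' x : x \in `]e, 1 - e[ -> 0 < x < 1.
    by rewrite in_itv /= => /andP[x0 x1]; rewrite e01 // !ltW.
  split; first split.
  - by move=> x /e01' /hk [].
  - by apply: cvg_at_right_filter; apply: cont (hk e _); rewrite e01 // lexx ltW.
  - by apply: cvg_at_left_filter; apply: cont (hk _ _); rewrite e01 // lexx ltW.
  - by move=> x /e01' /hk [_ <-]; rewrite derive1E.
have [LF DF] := LR F f (fun x x01 => dF x (proj1 (andP x01))).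
have [LG DG] := LR G g (fun x x01 => dG x (proj2 (andP x01))).
have cf : {within `[e, 1 - e], continuous f}.
  apply: within_itv01_continuous => // x /andP[x0 _].
  by apply: cvgM; [exact: cvg_cst|exact: continuous_powR_gt0].
have cg : {within `[e, 1 - e], continuous g}.
  apply: within_itv01_continuous => // x /andP[_ x1].
  by apply: cvgM; [exact: cvg_cst|exact: continuous_powR_onem].
have := Rintegration_by_parts e1 cf LF DF cg LG DG.
rewrite /F /G /f /g subKr.
have mI : measurable (`[e, 1 - e] : set (measurableTypeR R)) by exact: measurable_itv.
under eq_Rintegral do rewrite mulrCA.
rewrite RintegralZl //; last exact: integrable_powRM.
under [X in _ = _ - X]eq_Rintegral do rewrite mulrN -mulrA -mulNr.
rewrite RintegralZl //; last exact: integrable_powRM.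
by move=> ->; ring.
Qed.

Lemma convolution_by_parts (a b : R) : 0 < a -> 0 < b ->
  (b%:E * convolution (a + 1) b 1 = a%:E * convolution a (b + 1) 1)%E.
Proof.
move=> a0 b0; pose e n : R := n.+3%:R^-1.
pose I n : set R := `[e n, 1 - e n]%classic.
have e0 n : 0 < e n by rewrite invr_gt0.
have e1 n : e n < 1 - e n.
  rewrite ltrBrDl -mulr2n -mulr_natl /e ltr_pdivrMr // mul1r ltr_nat.
  by [].
have lim c d : (\int[leb]_(x in I n) (x `^ (c - 1) * (1 - x) `^ (d - 1))%:E)%E @[n --> \oo]
    --> convolution c d 1.
  have -> : convolution c d 1 =
      (\int[leb]_(x in \bigcup_n I n) (x `^ (c - 1) * (1 - x) `^ (d - 1))%:E)%E.
    rewrite itv01_exhaustion [RHS]integral_mkcond; apply: eq_integral => x _.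
    rewrite patchE /pos_power mem_setE in_itv /= subr_gt0.
    by case: ifP => _ //=; case: ifP => _; rewrite ?mulr0 ?mul0r.
  apply: ge0_nondecreasing_set_cvg_integral.
  - apply/nondecreasing_seqP => n; apply/subsetPset => x.
    rewrite /I /= !in_itv /= => /andP[x0 x1].
    have ee : e n.+1 <= e n by rewrite lef_pV2 ?posrE // ler_nat.
    by rewrite (le_trans ee) //= (le_trans x1) // lerD2l lerN2.
  - by move=> n; exact: measurable_itv.
  - move=> n; apply: measurable_funTS; apply/measurable_EFinP; apply: measurable_funM.
      exact: measurable_powR.
    apply: (measurableT_comp (@measurable_powR R (d - 1))).
    by apply: measurable_funB; [exact: measurable_cst|exact: measurable_id].
  - by move=> n x _; rewrite lee_fin mulr_ge0 // powR_ge0.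
have RI c d n : (\int[leb]_(x in I n) (x `^ c * (1 - x) `^ d)%:E)%E =
    (\int[leb]_(x in I n) (x `^ c * (1 - x) `^ d))%:E.
  rewrite /Rintegral fineK //.
  exact: (integrable_fin_num _ (integrable_powRM c d (e0 n))).
pose r n : R := e n `^ a * (1 - e n) `^ b - (1 - e n) `^ a * e n `^ b.
have r0 : (r n)%:E @[n --> \oo] --> 0%E.
  have ec : e n @[n --> \oo] --> (0 : R).
    have := @cvg_harmonic R; rewrite -(cvg_shiftn 2%N) /harmonic.
    by under eq_fun do rewrite addn2.
  have pc c : 0 < c -> e n `^ c @[n --> \oo] --> (0 : R).
    by move=> c0; have /cvg_at_rightP := powR_cvg0 c0; apply.
  have qc c : (1 - e n) `^ c @[n --> \oo] --> (1 : R).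
    have h : {for 0, continuous (fun y : R => (1 - y) `^ c)}.
      exact: continuous_powR_onem.
    have := cvg_comp _ _ ec h; rewrite /= subr0 powR1.
    by [].
  apply: cvg_EFin; first exact: nearW.
  rewrite (_ : (0 : R) = 0 * 1 - 1 * 0); last by ring.
  by apply: cvgB; apply: cvgM; [exact: pc|exact: qc|exact: qc|exact: pc].
have l1 := lim (a + 1) b; have l2 := lim a (b + 1).
have fb : (b%:E : \bar R) \is a fin_num by [].
have fa : (a%:E : \bar R) \is a fin_num by [].
have l1' := cvgeZl fb l1.
have df : ((a%:E * convolution a (b + 1) 1) +? (0 : \bar R))%E by exact: fin_num_adde_defl.
have l2' := cvgeD df (cvgeZl fa l2) r0.
rewrite adde0 in l2'.
have E : (fun n => b%:E * \int[leb]_(x in I n) (x `^ (a + 1 - 1) * (1 - x) `^ (b - 1))%:E)%E =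
    (fun n => a%:E * (\int[leb]_(x in I n) (x `^ (a - 1) * (1 - x) `^ (b + 1 - 1))%:E) + (r n)%:E)%E.
  apply/funext => n; rewrite !addrK !RI -!EFinM -EFinD beta_by_parts // e0.
  exact: e1.
rewrite E in l1'.
exact: (cvg_unique (@ereal_hausdorff R) l1' (l2' _)).
Qed.

(** Two linear equations, [convolution_split] and [convolution_by_parts],
   determine both integrals from [convolution a b s]. Without divisions, the
   identities also make sense for infinite integrals. *)
Lemma convolution_ratio (a b s : R) : 0 < a -> 0 < b ->
  ((a + b)%:E * convolution (a + 1) b s = a%:E * (s%:E * convolution a b s))%E /\
  ((a + b)%:E * convolution a (b + 1) s = b%:E * (s%:E * convolution a b s))%E.
Proof.
move=> a0 b0.
have K0 := convolution_ge0.
have eq1 : ((a + b)%:E * convolution (a + 1) b 1 = a%:E * convolution a b 1)%E.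
  rewrite EFinD ge0_muleDl ?lee_fin ?(ltW a0) ?(ltW b0) // convolution_by_parts //.
  by rewrite -ge0_muleDr // convolution_split mul1e.
have eq2 : ((a + b)%:E * convolution a (b + 1) 1 = b%:E * convolution a b 1)%E.
  rewrite EFinD ge0_muleDl ?lee_fin ?(ltW a0) ?(ltW b0) // -convolution_by_parts //.
  by rewrite -ge0_muleDr // convolution_split mul1e.
rewrite convolutionE [in X in _ /\ X]convolutionE (convolutionE a b s).
have e1 : pos_power s (a + 1 + b) = s * pos_power s (a + b).
  by rewrite mulr_pos_power; congr pos_power; ring.
have e2 : pos_power s (a + (b + 1)) = s * pos_power s (a + b).
  by rewrite mulr_pos_power; congr pos_power; ring.
rewrite e1 e2 !EFinM; split.
- by rewrite [LHS]muleCA eq1 [LHS]muleCA -muleA.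
- by rewrite [LHS]muleCA eq2 [LHS]muleCA -muleA.
Qed.

End beta_integral.

(** * Iterated integrals over tuples *)

Section tuple_integral.
Context {R : realType}.
Local Notation leb := (@lebesgue_measure R).
Local Open Scope ereal_scope.

Lemma tuple_integral_ge0 k (f : k.-tuple R -> \bar R) :
  (forall y, 0 <= f y) -> 0 <= tuple_integral f.
Proof.
elim: k f => [|k IH] f f0 /=; first exact: f0.
by apply: integral_ge0 => x _; exact: IH.
Qed.

Lemma eq_tuple_integral k (f g : k.-tuple R -> \bar R) :
  f =1 g -> tuple_integral f = tuple_integral g.
Proof. by move=> /funext ->. Qed.

Lemma measurable_tuple_cons k :
  measurable_fun [set: R * k.-tuple R] (fun z => [tuple of z.1 :: z.2] : k.+1.-tuple R).
Proof. exact: measurable_cons. Qed.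

(** The parameter absorbs the coordinates one by one, so the induction needs an
   arbitrary measurable space of parameters. *)
Lemma measurable_param_tuple_integral d (T : measurableType d) k
    (f : T -> k.-tuple R -> \bar R) :
  measurable_fun [set: T * k.-tuple R] (fun z => f z.1 z.2) ->
  (forall t y, 0 <= f t y) ->
  measurable_fun setT (fun t => tuple_integral (f t)).
Proof.
elim: k d T f => [|k IH] d T f mf f0 /=.
  have m : measurable_fun setT (fun t : T => (t, [tuple] : 0.-tuple R)).
    by apply: measurable_fun_pair => //; exact: measurable_cst.
  exact: measurableT_comp mf m.
pose g (z : T * measurableTypeR R) := tuple_integral (fun y : k.-tuple R => f z.1 [tuple of z.2 :: y]).
have mg : measurable_fun setT g.
  apply: (IH _ _ (fun (z : T * measurableTypeR R) y => f z.1 [tuple of z.2 :: y])); last first.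
    by move=> t y; exact: f0.
  have m : measurable_fun setT (fun w : (T * measurableTypeR R) * k.-tuple R =>
      (w.1.1, [tuple of w.1.2 :: w.2] : k.+1.-tuple R)).
    apply: measurable_fun_pair; first exact: measurableT_comp.
    apply: (@measurable_cons _ _ _ _ (fun w : (T * measurableTypeR R) * k.-tuple R => w.1.2 : R)).
      exact: (measurableT_comp measurable_snd measurable_fst).
    exact: measurable_snd.
  exact: (measurableT_comp mf m).
have g0 z : 0 <= g z by apply: tuple_integral_ge0 => y; exact: f0.
exact: (@measurable_fun_fubini_tonelli_F _ _ _ _ R leb g mg g0).
Qed.

Section slices.
Variables (k : nat) (f : k.+1.-tuple R -> \bar R).
Hypothesis mf : measurable_fun setT f.
Hypothesis f0 : forall y, 0 <= f y.

Lemma measurable_slice x : measurable_fun setT (fun y : k.-tuple R => f [tuple of x :: y]).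
Proof.
apply: (measurableT_comp mf).
by apply: (@measurable_cons _ _ _ _ (fun=> x)); [exact: measurable_cst|exact: measurable_id].
Qed.

Lemma measurable_slice_integral :
  measurable_fun [set: R] (fun x => tuple_integral (fun y : k.-tuple R => f [tuple of x :: y])).
Proof.
apply: (@measurable_param_tuple_integral _ R k (fun x y => f [tuple of x :: y])) => [|t y].
  apply: (measurableT_comp mf); exact: measurable_tuple_cons.
exact: f0.
Qed.

Lemma slice_integral_ge0 x : 0 <= tuple_integral (fun y : k.-tuple R => f [tuple of x :: y]).
Proof. by apply: tuple_integral_ge0. Qed.

End slices.

Lemma tuple_integralD k (f g : k.-tuple R -> \bar R) :
  measurable_fun setT f -> (forall y, 0 <= f y) ->
  measurable_fun setT g -> (forall y, 0 <= g y) ->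
  tuple_integral (fun y => f y + g y) = tuple_integral f + tuple_integral g.
Proof.
elim: k f g => [//|k IH] f g mf f0 mg g0 /=.
rewrite -ge0_integralD //; last 4 first.
- by move=> x _; exact: slice_integral_ge0.
- exact: measurable_slice_integral.
- by move=> x _; exact: slice_integral_ge0.
- exact: measurable_slice_integral.
by apply: eq_integral => x _; rewrite IH //; exact: measurable_slice.
Qed.

Lemma tuple_integralZl k (f : k.-tuple R -> \bar R) (c : \bar R) :
  measurable_fun setT f -> (forall y, 0 <= f y) -> 0 <= c ->
  tuple_integral (fun y => c * f y) = c * tuple_integral f.
Proof.
elim: k f => [//|k IH] f mf f0 c0 /=.
rewrite -ge0_integralZl //; last 2 first.
- exact: measurable_slice_integral.
- by move=> x _; exact: slice_integral_ge0.
by apply: eq_integral => x _; rewrite IH //; exact: measurable_slice.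
Qed.

Lemma tuple_integral0 k : tuple_integral (fun _ : k.-tuple R => 0) = 0.
Proof. by elim: k => [//|k IH] /=; apply: integral0_eq => x _. Qed.

Lemma tuple_integral_sum k (I : Type) (s : seq I) (f : I -> k.-tuple R -> \bar R) :
  (forall i, measurable_fun setT (f i)) -> (forall i y, 0 <= f i y) ->
  tuple_integral (fun y => \sum_(i <- s) f i y) = \sum_(i <- s) tuple_integral (f i).
Proof.
move=> mf f0; elim: s => [|i s IH].
  by rewrite big_nil -[RHS](tuple_integral0 k); apply: eq_tuple_integral => y; rewrite big_nil.
rewrite big_cons -IH -tuple_integralD //.
- by apply: eq_tuple_integral => y; rewrite big_cons.
- exact: emeasurable_sum.
- by move=> y; exact: sume_ge0.
Qed.

Lemma le_tuple_integral k (f g : k.-tuple R -> \bar R) :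
  measurable_fun setT f -> (forall y, 0 <= f y) -> measurable_fun setT g ->
  (forall y, f y <= g y) -> tuple_integral f <= tuple_integral g.
Proof.
elim: k f g => [|k IH] f g mf f0 mg fg /=; first exact: fg.
have g0 y : 0 <= g y by exact: le_trans (f0 y) (fg y).
apply: ge0_le_integral => //.
- by move=> x _; exact: slice_integral_ge0.
- exact: measurable_slice_integral.
- exact: measurable_slice_integral.
- by move=> x _; apply: IH => //; exact: measurable_slice.
Qed.

Lemma cvg_monotone_tuple_integral k (f_ : nat -> k.-tuple R -> \bar R) (f : k.-tuple R -> \bar R) :
  (forall n, measurable_fun setT (f_ n)) -> (forall n y, 0 <= f_ n y) ->
  measurable_fun setT f ->
  (forall y, nondecreasing_seq (f_ ^~ y)) ->
  (forall y, f_ n y @[n --> \oo] --> f y) ->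
  tuple_integral (f_ n) @[n --> \oo] --> tuple_integral f.
Proof.
elim: k f_ f => [|k IH] f_ f mf f0 mlim nd lim /=; first exact: lim.
have sl x : tuple_integral (fun y : k.-tuple R => f_ n [tuple of x :: y]) @[n --> \oo] -->
    tuple_integral (fun y : k.-tuple R => f [tuple of x :: y]).
  apply: (IH (fun n (y : k.-tuple R) => f_ n [tuple of x :: y])) => //.
  - by move=> n; exact: measurable_slice.
  - exact: measurable_slice.
rewrite [X in _ --> X](_ : _ = \int[leb]_x limn (fun n =>
    tuple_integral (fun y : k.-tuple R => f_ n [tuple of x :: y]))); last first.
  by apply: eq_integral => x _; apply/esym/cvg_lim => //; exact: sl.
apply: cvg_monotone_convergence => //.
- by move=> n; exact: measurable_slice_integral.
- by move=> n x _; exact: slice_integral_ge0.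
- move=> x _ a b ab; apply: le_tuple_integral => //; try exact: measurable_slice.
  by move=> y; exact: nd.
Qed.

End tuple_integral.

(** * Dirichlet integrals over the simplex *)

Section simplex_integral.
Context {R : realType}.
Local Notation leb := (@lebesgue_measure R).

(** The Dirichlet density on the simplex of size s, whose last coordinate is s
   minus the sum of the others. *)
Definition simplex_integrand k (a : nat -> R) (s : R) (y : k.-tuple R) : R :=
  (\prod_(i < k) pos_power (tnth y i) (a i)) * pos_power (s - \sum_(z <- y) z) (a k).

Definition simplex_integral k (a : nat -> R) (s : R) : \bar R :=
  tuple_integral (fun y : k.-tuple R => (simplex_integrand a s y)%:E).

Lemma simplex_integrand_ge0 k a s (y : k.-tuple R) : 0 <= simplex_integrand a s y.
Proof. by rewrite mulr_ge0 ?pos_power_ge0 // prodr_ge0 // => i _; exact: pos_power_ge0. Qed.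

Lemma measurable_tuple_sum k : measurable_fun [set: k.-tuple R] (fun y => \sum_(z <- y) z).
Proof.
under eq_fun do rewrite big_tuple.
by apply: measurable_sum => i; exact: measurable_tnth.
Qed.

Lemma measurable_simplex_integrand k a (s : R) :
  measurable_fun [set: k.-tuple R] (simplex_integrand a s).
Proof.
apply: measurable_funM.
  apply: measurable_prod => i _; apply: (measurableT_comp (measurable_pos_power _)).
  exact: measurable_tnth.
apply: (measurableT_comp (measurable_pos_power_sub _ _)).
exact: measurable_tuple_sum.
Qed.

Lemma simplex_integral0 a s : simplex_integral 0 a s = (pos_power s (a 0%N))%:E.
Proof. by rewrite /simplex_integral /= /simplex_integrand big_ord0 big_nil subr0 mul1r. Qed.

Lemma simplex_integralS k a s : simplex_integral k.+1 a s =
  (\int[leb]_x ((pos_power x (a 0%N))%:E * simplex_integral k (a \o S) (s - x)))%E.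
Proof.
rewrite /simplex_integral /=; apply: eq_integral => x _.
rewrite -tuple_integralZl //; last 3 first.
- by apply/measurable_EFinP; exact: measurable_simplex_integrand.
- by move=> y; rewrite lee_fin simplex_integrand_ge0.
- by rewrite lee_fin pos_power_ge0.
apply: eq_tuple_integral => y; rewrite -EFinM; congr _%:E.
rewrite /simplex_integrand big_ord_recl big_cons tnth0 -mulrA; congr (_ * (_ * _)).
  by apply: eq_bigr => i _; rewrite tnthS.
by congr pos_power; ring.
Qed.

Lemma integral_convolutionZl c a b s : (0 <= c)%E ->
  (\int[leb]_x ((pos_power x a)%:E * (c * (pos_power (s - x) b)%:E)) = c * convolution a b s)%E.
Proof.
move=> c0; rewrite -ge0_integralZl //; last 2 first.
- exact: measurable_convolution.
- by move=> x _; rewrite lee_fin mulr_ge0 // pos_power_ge0.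
by apply: eq_integral => x _; rewrite muleCA EFinM.
Qed.

(** Integrating out the coordinates one at a time only uses
   pos_power a * pos_power b = const . pos_power (a + b). *)
Lemma simplex_integralE k a : exists2 c : \bar R, (0 <= c)%E &
  forall s, simplex_integral k a s = (c * (pos_power s (\sum_(i < k.+1) a i))%:E)%E.
Proof.
elim: k a => [|k IH] a.
  by exists 1%E => // s; rewrite simplex_integral0 big_ord_recl big_ord0 addr0 mul1e.
have [c c0 cE] := IH (a \o S).
exists (c * convolution (a 0%N) (\sum_(i < k.+1) (a \o S) i) 1)%E.
  by rewrite mule_ge0 // convolution_ge0.
move=> s; rewrite simplex_integralS.
under eq_integral do rewrite cE.
rewrite integral_convolutionZl // convolutionE -muleA [X in (_ * X)%E]muleC.
congr (_ * (_ * (pos_power _ _)%:E))%E.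
by rewrite [RHS]big_ord_recl.
Qed.

Definition add_one (a : nat -> R) i j : R := a j + (j == i)%:R.

Lemma pos_power1 (a : R) : pos_power 1 a = 1.
Proof. by rewrite /pos_power ltr01 powR1. Qed.

(** E[r_i] for a Dirichlet vector: raising the i-th parameter by one multiplies
   the integral by s a_i / sum a. The first coordinate is a beta integral against
   the others, to which the induction hypothesis applies. *)
Lemma simplex_integral_ratio k (a : nat -> R) i s : (forall j, 0 < a j) -> (i <= k)%N ->
  ((\sum_(j < k.+1) a j)%:E * simplex_integral k (add_one a i) s =
   (a i)%:E * (s%:E * simplex_integral k a s))%E.
Proof.
elim: k a i s => [|k IH] a i s a0.
  rewrite leqn0 => /eqP ->; rewrite !simplex_integral0 big_ord_recl big_ord0 addr0.
  by rewrite /add_one eqxx -!EFinM mulr_pos_power.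
have sum0 m (b : nat -> R) : (forall j, 0 < b j) -> 0 < \sum_(j < m.+1) b j.
  by move=> b0; rewrite big_ord_recl ltr_pwDl // sumr_ge0 // => j _; exact: ltW.
set B := \sum_(j < k.+1) (a \o S) j.
have B0 : 0 < B by apply: sum0 => j; exact: a0.
have sE : \sum_(j < k.+2) a j = a 0%N + B by rewrite big_ord_recl.
have [c c0 cE] := simplex_integralE k (a \o S).
have FE : simplex_integral k.+1 a s = (c * convolution (a 0%N) B s)%E.
  by rewrite simplex_integralS; under eq_integral do rewrite cE; rewrite integral_convolutionZl.
rewrite sE FE; case: i => [_|i ik].
  have -> : simplex_integral k.+1 (add_one a 0) s = (c * convolution (a 0%N + 1) B s)%E.
    rewrite simplex_integralS.
    have -> : add_one a 0 \o S = a \o S by apply/funext => j; rewrite /add_one /= addr0.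
    under eq_integral do rewrite cE.
    by rewrite integral_convolutionZl // /add_one eqxx.
  have [r _] := convolution_ratio s (a0 0%N) B0.
  by rewrite muleCA r; rewrite muleCA; congr (_ * _)%E; rewrite muleCA.
have a'E : add_one a i.+1 \o S = add_one (a \o S) i by [].
have [c' c'0 c'E] := simplex_integralE k (add_one (a \o S) i).
have B'E : \sum_(j < k.+1) add_one (a \o S) i j = B + 1.
  rewrite /add_one big_split /=; congr (_ + _).
  rewrite (bigD1 (Ordinal (ik : (i < k.+1)%N))) //= eqxx big1 ?addr0 // => j.
  by rewrite -val_eqE /= => /negbTE ->.
have cc' : (B%:E * c' = (a i.+1)%:E * c)%E.
  have := IH (a \o S) i 1 (fun j => a0 j.+1) ik.
  by rewrite c'E cE B'E !pos_power1 !mule1 mul1e.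
have -> : simplex_integral k.+1 (add_one a i.+1) s = (c' * convolution (a 0%N) (B + 1) s)%E.
  rewrite simplex_integralS a'E; under eq_integral do rewrite c'E B'E.
  by rewrite integral_convolutionZl // /add_one /= addr0.
have [_ r] := convolution_ratio s (a0 0%N) B0.
by rewrite muleCA r muleA [(c' * _)%E]muleC cc' -muleA; congr (_ * _)%E; rewrite muleCA.
Qed.

End simplex_integral.

(** * Weight vectors and integration against a Dirichlet law *)

Import HBNNSimple.

Section valid_weights.
Context {R : realType}.
Variable k : nat.
Implicit Types (r : k.+1.-tuple R).

Definition valid_weights r : bool :=
  [forall i, 0 < tnth r i] && (\sum_(i < k.+1) tnth r i == 1).

Definition uniform_weights : k.+1.-tuple R := [tuple k.+1%:R^-1 | _ < k.+1].

(** A Dirichlet vector is valid almost surely; replacing the invalid ones makes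
   the chain real-rooted for every outcome. *)
Definition normalized_weights r := if valid_weights r then r else uniform_weights.

Lemma valid_uniform_weights : valid_weights uniform_weights.
Proof.
apply/andP; split; first by apply/forallP => i; rewrite tnth_mktuple invr_gt0.
under eq_bigr do rewrite tnth_mktuple.
by rewrite sumr_const card_ord -(mulr_natl k.+1%:R^-1) divff // pnatr_eq0.
Qed.

Lemma valid_normalized_weights r : valid_weights (normalized_weights r).
Proof. by rewrite /normalized_weights; case: ifP => // _; exact: valid_uniform_weights. Qed.

Lemma valid_weights_gt0 r i : valid_weights r -> 0 < tnth r i.
Proof. by case/andP => /forallP/(_ i). Qed.

Lemma valid_weights_sum r : valid_weights r -> \sum_(i < k.+1) tnth r i = 1.
Proof. by case/andP => _ /eqP. Qed.

Lemma valid_weights_le1 r i : valid_weights r -> tnth r i <= 1.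
Proof.
move=> vr; rewrite -(valid_weights_sum vr) (bigD1 i) //= lerDl sumr_ge0 // => j _.
by rewrite ltW // valid_weights_gt0.
Qed.

Lemma measurable_valid_weights : measurable [set r | valid_weights r].
Proof.
have -> : [set r | valid_weights r] =
    (\bigcap_(i in [set: 'I_k.+1]) ((@tnth _ R ^~ i) @^-1` `]0, +oo[)) `&`
    ((fun r => \sum_(i < k.+1) tnth r i) @^-1` [set 1]).
  apply/seteqP; split=> [r /= /andP[/forallP r0 /eqP r1]|r /= [r0 r1]].
    by split=> // i _ /=; rewrite in_itv /= r0.
  apply/andP; split; last exact/eqP.
  by apply/forallP => i; have := r0 i I; rewrite /= in_itv /= andbT.
apply: measurableI.
  apply: fin_bigcap_measurable => // i _; rewrite -[X in measurable X]setTI.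
  by apply: measurable_tnth => //; exact: measurable_itv.
rewrite -[X in measurable X]setTI; apply: measurable_sum => //.
by move=> i; exact: measurable_tnth.
Qed.

Lemma measurable_normalized_weights :
  measurable_fun [set: k.+1.-tuple R] normalized_weights.
Proof.
apply: measurable_fun_ifT.
- apply: (measurable_fun_bool true); rewrite setTI.
  exact: measurable_valid_weights.
- exact: measurable_id.
- exact: measurable_cst.
Qed.

Lemma dirichlet_kernelE (a : 'I_k.+1 -> R) r :
  dirichlet_kernel a r = \prod_(i < k.+1) pos_power (tnth r i) (a i).
Proof.
rewrite /dirichlet_kernel; case: ifP => [/forallP r0|/negbT].
  by apply: eq_bigr => i _; rewrite /pos_power r0.
rewrite negb_forall => /existsP[i /negbTE ri].
by rewrite (bigD1 i) //= /pos_power ri mul0r.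
Qed.

Lemma measurable_dirichlet_kernel (a : 'I_k.+1 -> R) :
  measurable_fun [set: k.+1.-tuple R] (dirichlet_kernel a).
Proof.
rewrite (funext (dirichlet_kernelE a)).
apply: measurable_prod => i _; apply: (measurableT_comp (measurable_pos_power _)).
exact: measurable_tnth.
Qed.

Lemma dirichlet_kernel_ge0 (a : 'I_k.+1 -> R) r : 0 <= dirichlet_kernel a r.
Proof. by rewrite dirichlet_kernelE prodr_ge0 // => i _; exact: pos_power_ge0. Qed.

Lemma tnth_simplex_point_lift (y : k.-tuple R) (i : 'I_k) :
  tnth (simplex_point y) (widen_ord (leqnSn k) i) = tnth y i.
Proof. by rewrite (tnth_nth 0) /= nth_rcons size_tuple ltn_ord -tnth_nth. Qed.

Lemma tnth_simplex_point_max (y : k.-tuple R) :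
  tnth (simplex_point y) ord_max = 1 - \sum_(z <- y) z.
Proof. by rewrite (tnth_nth 0) /= nth_rcons size_tuple ltnn eqxx. Qed.

Lemma sum_simplex_point (y : k.-tuple R) : \sum_(i < k.+1) tnth (simplex_point y) i = 1.
Proof.
rewrite big_ord_recr /= tnth_simplex_point_max.
under eq_bigr do rewrite tnth_simplex_point_lift.
by rewrite big_tuple addrC subrK.
Qed.

Lemma measurable_simplex_point : measurable_fun [set: k.-tuple R] (@simplex_point R k).
Proof.
apply/measurable_fun_tnthP => i /=.
have [->|ik] := eqVneq i ord_max.
  rewrite /comp; under eq_fun do rewrite tnth_simplex_point_max.
  by apply: measurable_funB; [exact: measurable_cst|exact: measurable_tuple_sum].
have ik' : (i < k)%N.
  by rewrite ltn_neqAle -ltnS ltn_ord andbT; move: ik; rewrite -val_eqE.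
have -> : i = widen_ord (leqnSn k) (Ordinal ik') by apply/val_inj.
rewrite /comp; under eq_fun do rewrite tnth_simplex_point_lift.
exact: measurable_tnth.
Qed.

Lemma dirichlet_kernel_neq0 (a : 'I_k.+1 -> R) (y : k.-tuple R) :
  dirichlet_kernel a (simplex_point y) != 0 -> valid_weights (simplex_point y).
Proof.
rewrite /dirichlet_kernel; case: ifP => [r0 _|]; last by rewrite eqxx.
by rewrite /valid_weights r0 sum_simplex_point eqxx.
Qed.

Lemma dirichlet_kernel_integrand (a : nat -> R) (y : k.-tuple R) :
  dirichlet_kernel (fun i => a i) (simplex_point y) = simplex_integrand a 1 y.
Proof.
rewrite dirichlet_kernelE big_ord_recr /= tnth_simplex_point_max /simplex_integrand.
by congr (_ * _); apply: eq_bigr => i _; rewrite tnth_simplex_point_lift.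
Qed.

Section law.
Variables (Q : {measure set (k.+1.-tuple R) -> \bar R}) (a : 'I_k.+1 -> R) (C : R).
Hypothesis lawQ : forall B, measurable B -> Q B = (C%:E * dirichlet_mass a B)%E.

(** From indicators to nonnegative simple functions by linearity, and then by
   monotone convergence on both sides. *)
Lemma ge0_integral_dirichlet (g : k.+1.-tuple R -> R) :
  measurable_fun setT g -> (forall x, 0 <= g x) ->
  (\int[Q]_x (g x)%:E = C%:E * tuple_integral (fun y : k.-tuple R =>
     (dirichlet_kernel a (simplex_point y) * g (simplex_point y))%:E))%E.
Proof.
move=> mg g0.
have mg' : measurable_fun setT (EFin \o g) by exact/measurable_EFinP.
pose h := nnsfun_approx measurableT mg'.
have hlim x : (h n x)%:E @[n --> \oo] --> (g x)%:E.
  by apply: (@cvg_nnsfun_approx _ _ _ _ measurableT _ mg') => // z _; rewrite lee_fin.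
have hnd x : nondecreasing_seq (fun n => (h n x)%:E).
  by move=> m n mn; rewrite lee_fin; exact/lefP/nd_nnsfun_approx.
have mw : measurable_fun setT (fun y : k.-tuple R => dirichlet_kernel a (simplex_point y)).
  exact: (measurableT_comp (measurable_dirichlet_kernel a) measurable_simplex_point).
have mwg (f : k.+1.-tuple R -> R) : measurable_fun setT f ->
    measurable_fun setT (fun y : k.-tuple R =>
      (dirichlet_kernel a (simplex_point y) * f (simplex_point y))%:E).
  move=> mf; apply/measurable_EFinP; apply: measurable_funM => //.
  exact: (measurableT_comp mf measurable_simplex_point).
have simple n : (\int[Q]_x (h n x)%:E = C%:E * tuple_integral (fun y : k.-tuple R =>
     (dirichlet_kernel a (simplex_point y) * h n (simplex_point y))%:E))%E.
  rewrite integralT_nnsfun sintegralE (fsbig_finite _ _ (fimfunP (h n))) /=.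
  set rs := finmap.enum_fset _.
  have mI (r : R) : measurable (h n @^-1` [set r]) by exact: measurable_funPTI.
  have mind (r : R) : measurable_fun setT (\1_(h n @^-1` [set r]) : k.+1.-tuple R -> R).
    exact: measurable_indic.
  have -> : tuple_integral (fun y : k.-tuple R =>
      (dirichlet_kernel a (simplex_point y) * h n (simplex_point y))%:E) =
    (\sum_(v <- rs) tuple_integral (fun y : k.-tuple R =>
      v%:E * (dirichlet_kernel a (simplex_point y) * \1_(h n @^-1` [set v]) (simplex_point y))%:E))%E.
    rewrite -tuple_integral_sum.
    - apply: eq_tuple_integral => y.
      rewrite [in LHS](fimfunE (h n)) (fsbig_finite _ _ (fimfunP (h n))) -/rs mulr_sumr -sumEFin.
      by apply: eq_bigr => r _; rewrite -EFinM mulrCA.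
    - by move=> r; apply: measurable_funeM; exact: mwg.
    - move=> r y; rewrite -EFinM mulrCA lee_fin mulr_ge0 ?dirichlet_kernel_ge0 //.
      by have := nnfun_muleindic_ge0 (h n) r (simplex_point y); rewrite lee_fin.
  rewrite ge0_sume_distrr; last first.
    move=> r _; apply: tuple_integral_ge0 => y; rewrite -EFinM mulrCA lee_fin.
    rewrite mulr_ge0 ?dirichlet_kernel_ge0 //.
    by have := nnfun_muleindic_ge0 (h n) r (simplex_point y); rewrite lee_fin.
  apply: eq_bigr => r _; rewrite lawQ // muleCA; congr (_ * _)%E.
  have [r0|r0] := leP (0 : R) r.
    rewrite tuple_integralZl //; first exact: mwg.
    by move=> y; rewrite lee_fin mulr_ge0 ?dirichlet_kernel_ge0.
  rewrite /dirichlet_mass preimage_nnfun0 // indic0.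
  rewrite (eq_tuple_integral (g := fun=> 0%E)) ?tuple_integral0 ?mule0; last first.
    by move=> y; rewrite mulr0.
  rewrite (eq_tuple_integral (g := fun=> 0%E)) ?tuple_integral0 //.
  by move=> y; rewrite mulr0 mule0.
have lim1 : (\int[Q]_x (h n x)%:E)%E @[n --> \oo] --> (\int[Q]_x (g x)%:E)%E.
  rewrite (_ : (\int[Q]_x (g x)%:E)%E = (\int[Q]_x (limn (fun n => (h n x)%:E)))%E); last first.
    by apply: eq_integral => x _; apply/esym/cvg_lim.
  apply: cvg_monotone_convergence => //.
  - by move=> n; apply/measurable_EFinP.
  - by move=> n x _; rewrite lee_fin.
have lim2 : tuple_integral (fun y : k.-tuple R =>
     (dirichlet_kernel a (simplex_point y) * h n (simplex_point y))%:E) @[n --> \oo] -->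
   tuple_integral (fun y : k.-tuple R =>
     (dirichlet_kernel a (simplex_point y) * g (simplex_point y))%:E).
  apply: cvg_monotone_tuple_integral.
  - by move=> n; apply: mwg.
  - by move=> n y; rewrite lee_fin mulr_ge0 // dirichlet_kernel_ge0.
  - exact: mwg.
  - move=> y m n mn; rewrite lee_fin ler_wpM2l ?dirichlet_kernel_ge0 //.
    by have := hnd (simplex_point y) _ _ mn; rewrite lee_fin.
  - move=> y; under eq_fun do rewrite EFinM; rewrite EFinM.
    by apply: cvgeZl.
have fC : (C%:E : \bar R) \is a fin_num by [].
have lim3 := cvgeZl fC lim2.
move: lim1; rewrite (_ : (fun n => \int[Q]_x (h n x)%:E)%E = (fun n => C%:E * tuple_integral (fun y : k.-tuple R =>
     (dirichlet_kernel a (simplex_point y) * h n (simplex_point y))%:E))%E); last exact/funext.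
by move=> lim1; exact: (cvg_unique (@ereal_hausdorff R) lim1 lim3).
Qed.

End law.
End valid_weights.

(** * Moments of the Polya urn *)

Section urn.
Context {R : realType}.
Variables (k : nat) (alpha : R).
Hypothesis alpha0 : 0 < alpha.
Implicit Types (l : seq 'I_k.+1) (x : 'I_k.+1 -> R).

Local Notation aN := (alpha * k.+1%:R).

(** The probability that the draws of a Polya urn, starting with weight alpha on
   each colour, are the colours of l, the head of l being the last draw. *)
Fixpoint urn_moment l : R :=
  if l is i :: t
  then (alpha + (count_mem i t)%:R) / (aN + (size t)%:R) * urn_moment t
  else 1.

Lemma aN_gt0 : 0 < aN.
Proof. by rewrite mulr_gt0. Qed.

Lemma urn_denominator_gt0 n : 0 < aN + n%:R.
Proof. by rewrite ltr_pwDl // aN_gt0. Qed.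

Lemma urn_moment_ge0 l : 0 <= urn_moment l.
Proof.
elim: l => [//|i t IH] /=; rewrite mulr_ge0 // divr_ge0 ?ltW ?urn_denominator_gt0 //.
by rewrite ltr_pwDl.
Qed.

Lemma sum_count_mem l x : \sum_i x i * (count_mem i l)%:R = \sum_(j <- l) x j.
Proof.
elim: l => [|j l IH]; first by rewrite big_nil big1 // => i _; rewrite mulr0.
rewrite big_cons -IH /=; under eq_bigr do rewrite natrD mulrDr.
rewrite big_split /=; congr (_ + _).
rewrite (bigD1 j) //= eqxx mulr1 big1 ?addr0 // => i ij.
by rewrite eq_sym (negbTE ij) mulr0.
Qed.

Lemma sum_urn_moment l : \sum_i urn_moment (i :: l) = urn_moment l.
Proof.
rewrite /= -!mulr_suml big_split /= sumr_const card_ord -[alpha *+ _]mulr_natr.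
have -> : \sum_i (count_mem i l)%:R = (size l)%:R :> R.
  have := sum_count_mem l (fun=> 1); under eq_bigr do rewrite mul1r.
  by move=> ->; rewrite big_const_seq count_predT iter_addr_0.
by rewrite divff ?mul1r // gt_eqF // urn_denominator_gt0.
Qed.

(** Exchangeability of the urn. *)
Lemma urn_momentC i j l : urn_moment (i :: j :: l) = urn_moment (j :: i :: l).
Proof.
rewrite /=; have [->|ij] := eqVneq i j; first by [].
by rewrite !add0n; ring.
Qed.

Section centered.
Variable x : 'I_k.+1 -> R.
Hypothesis x0 : \sum_i x i = 0.

(** E[(\sum_i x_i r_i)^p \prod_(i <- l) r_i] for r Dirichlet, expanded one factor
   of the power at a time. *)
Fixpoint linear_moment p l : R :=
  if p is p'.+1 then \sum_i x i * linear_moment p' (i :: l) else urn_moment l.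

Lemma linear_momentC p i j l :
  linear_moment p (i :: j :: l) = linear_moment p (j :: i :: l).
Proof.
suff h l1 : linear_moment p (l1 ++ i :: j :: l) = linear_moment p (l1 ++ j :: i :: l) by exact: (h [::]).
elim: p l1 => [|p IH] l1 /=.
  elim: l1 => [|a l1 IH]; first exact: urn_momentC.
  rewrite /= IH !size_cat /= !count_cat /=.
  by rewrite [((i == a) + _)%N]addnCA.
by apply: eq_bigr => a _; congr (_ * _); exact: (IH (a :: l1)).
Qed.

(** Given the draws l, the next draw of the urn is uniform up to the weights of
   the previous draws, and the uniform part vanishes as x is centered. So the
   next factor x_i is paired with an equal one, either in l or among the p
   other factors. *)
Lemma linear_moment_rec p l :
  (aN + (size l + p)%:R) * linear_moment p.+1 l =
  (\sum_(j <- l) x j) * linear_moment p l +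
  p%:R * \sum_i x i ^+ 2 * linear_moment p.-1 (i :: l).
Proof.
elim: p l => [|p IH] l.
  rewrite mul0r addr0 addn0 /= mulr_sumr -[X in _ = X * _]sum_count_mem [RHS]mulr_suml.
  have n0 : aN + (size l)%:R != 0 by rewrite gt_eqF // urn_denominator_gt0.
  transitivity (\sum_i (x i * alpha * urn_moment l + x i * (count_mem i l)%:R * urn_moment l)).
    by apply: eq_bigr => i _; move: (aN + _) n0 => N n0; field.
  by rewrite big_split /= -2!mulr_suml x0 !mul0r add0r.
rewrite -[linear_moment p.+2 l]/(\sum_i x i * linear_moment p.+1 (i :: l)) mulr_sumr.
have E i : (aN + (size l + p.+1)%:R) * (x i * linear_moment p.+1 (i :: l)) =
    x i ^+ 2 * linear_moment p (i :: l) + (\sum_(j <- l) x j) * (x i * linear_moment p (i :: l)) +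
    p%:R * (\sum_j x j ^+ 2 * (x i * linear_moment p.-1 (i :: j :: l))).
  have := IH (i :: l); rewrite [size _]/= addSnnS big_cons => h.
  have -> : \sum_j x j ^+ 2 * (x i * linear_moment p.-1 (i :: j :: l)) =
      x i * \sum_j x j ^+ 2 * linear_moment p.-1 (j :: i :: l).
    by rewrite mulr_sumr; apply: eq_bigr => j _; rewrite linear_momentC mulrCA.
  by rewrite mulrCA h; ring.
under eq_bigr do rewrite E.
rewrite !big_split -!mulr_sumr exchange_big.
rewrite -[\sum_i x i * linear_moment p (i :: l)]/(linear_moment p.+1 l).
have -> : p%:R * \sum_j \sum_i x j ^+ 2 * (x i * linear_moment p.-1 (i :: j :: l)) =
    p%:R * \sum_j x j ^+ 2 * linear_moment p (j :: l).
  case: p {IH E} => [|p]; first by rewrite !mul0r.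
  by congr (_ * _); apply: eq_bigr => j _; rewrite -mulr_sumr.
rewrite -natr1 -[LHS]/(\sum_i x i ^+ 2 * linear_moment p (i :: l) +
  (\sum_(j <- l) x j) * linear_moment p.+1 l +
  p%:R * \sum_j x j ^+ 2 * linear_moment p (j :: l)).
by rewrite -[p.+1.-1]/p; ring.
Qed.

(** The recursion leaves the three pairings of the four factors, each of which
   costs two denominators of size aN. *)
Lemma linear_moment4_le (D : R) : (forall i, `|x i| <= D) ->
  linear_moment 4 [::] <= 6 * D ^+ 4 / aN ^+ 2.
Proof.
move=> xD; have D2 i : 0 <= x i ^+ 2 <= D ^+ 2.
  rewrite sqr_ge0 -[x i ^+ 2]real_normK ?num_real // lerXn2r ?nnegrE //.
  exact: le_trans (normr_ge0 _) (xD i).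
have aN0 := aN_gt0.
have den n : 0 < aN + n%:R by exact: urn_denominator_gt0.
have rec1 i : linear_moment 1 [:: i] = x i * urn_moment [:: i] / (aN + 1).
  have := linear_moment_rec 0 [:: i]; rewrite mul0r addr0 addn0 big_seq1 [size _]/= => h.
  by apply: (canRL (mulfK (lt0r_neq0 (den 1%N)))); rewrite mulrC h.
have rec2 i : linear_moment 2 [:: i] =
    (x i * linear_moment 1 [:: i] + \sum_j x j ^+ 2 * urn_moment [:: j; i]) / (aN + 2).
  have := linear_moment_rec 1 [:: i]; rewrite mul1r addn1 big_seq1 [size _]/= => h.
  by apply: (canRL (mulfK (lt0r_neq0 (den 2%N)))); rewrite mulrC h.
have rec4 : linear_moment 4 [::] =
    3 * (\sum_i x i ^+ 2 * linear_moment 2 [:: i]) / (aN + 3).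
  have := linear_moment_rec 3 [::]; rewrite big_nil mul0r add0r add0n => h.
  by apply: (canRL (mulfK (lt0r_neq0 (den 3%N)))); rewrite mulrC h.
have sum1 : \sum_i urn_moment [:: i] = 1 by rewrite sum_urn_moment.
have m0 l : 0 <= urn_moment l by exact: urn_moment_ge0.
have b2 i : linear_moment 2 [:: i] <= D ^+ 2 * ((aN + 1)^-1 + 1) / (aN + 2) * urn_moment [:: i].
  have -> : D ^+ 2 * ((aN + 1)^-1 + 1) / (aN + 2) * urn_moment [:: i] =
      (D ^+ 2 * (urn_moment [:: i] / (aN + 1)) + D ^+ 2 * urn_moment [:: i]) / (aN + 2) by ring.
  rewrite rec2 rec1 ler_pM2r ?invr_gt0 ?(den 2%N) //; apply: lerD.
    rewrite -mulrA mulrA -expr2 ler_wpM2r ?divr_ge0 ?m0 ?(ltW (den 1%N)) //.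
    by have /andP[] := D2 i.
  rewrite -(sum_urn_moment [:: i]) mulr_sumr; apply: ler_sum => j _.
  by rewrite ler_wpM2r //; have /andP[] := D2 j.
have D20 : 0 <= D ^+ 2 by exact: sqr_ge0.
have c0 : 0 <= D ^+ 2 * ((aN + 1)^-1 + 1) / (aN + 2).
  by rewrite divr_ge0 ?(ltW (den 2%N)) // mulr_ge0 // addr_ge0 // invr_ge0 (ltW (den 1%N)).
have s4 : \sum_i x i ^+ 2 * linear_moment 2 [:: i] <=
    D ^+ 2 * (D ^+ 2 * ((aN + 1)^-1 + 1) / (aN + 2)).
  rewrite -[leRHS]mulr1 -[X in _ <= _ * X]sum1 mulr_sumr; apply: ler_sum => i _.
  apply: (@le_trans _ _ (x i ^+ 2 * (D ^+ 2 * ((aN + 1)^-1 + 1) / (aN + 2) * urn_moment [:: i]))).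
    by rewrite ler_wpM2l ?sqr_ge0.
  rewrite [leLHS]mulrA; apply: ler_wpM2r; first exact: m0.
  by rewrite ler_wpM2r ?c0 //; have /andP[] := D2 i.
rewrite rec4 ler_pdivrMr ?(den 3%N) //.
apply: (@le_trans _ _ (3 * (D ^+ 2 * (D ^+ 2 * ((aN + 1)^-1 + 1) / (aN + 2))))).
  by rewrite ler_pM2l.
have i1 : (aN + 1)^-1 <= 1 by rewrite invf_le1 ?(den 1%N) // lerDr ltW.
have i2 : (aN + 2)^-1 <= aN^-1 by rewrite lef_pV2 ?posrE ?(den 2%N) // lerDl.
have i3 : aN ^+ 2 <= aN * (aN + 3) by rewrite expr2 ler_pM2l // lerDl.
have D40 : 0 <= D ^+ 2 * D ^+ 2 by rewrite mulr_ge0.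
apply: (@le_trans _ _ (6 * (D ^+ 2 * D ^+ 2) / aN)).
  rewrite (_ : 3 * _ = 3 * (D ^+ 2 * D ^+ 2) * (((aN + 1)^-1 + 1) / (aN + 2))); last by ring.
  rewrite (_ : 6 * _ / _ = 3 * (D ^+ 2 * D ^+ 2) * (2 / aN)); last by ring.
  apply: ler_wpM2l; first exact: mulr_ge0.
  apply: ler_pM => //.
  - by rewrite addr_ge0 // invr_ge0 (ltW (den 1%N)).
  - by rewrite invr_ge0 (ltW (den 2%N)).
  - by rewrite -[leRHS]/(1 + 1) lerD2r.
have X0 : 0 <= 6 * (D ^+ 2 * D ^+ 2) / aN.
  by apply: divr_ge0; [exact: mulr_ge0|exact: ltW].
have ge1 : 1 <= (aN + 3) / aN by rewrite ler_pdivlMr // mul1r lerDl.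
apply: (le_trans (ler_peMr X0 ge1)); rewrite le_eqVlt; apply/orP; left; apply/eqP.
by move: aN (lt0r_neq0 aN0) => N N0; field.
Qed.

End centered.
End urn.

(** * Fourth moment of a centered linear form in Dirichlet weights *)

Section dirichlet_moments.
Context {R : realType} (k : nat) (Q : probability (k.+1.-tuple R) R) (alpha : R).
Hypothesis alpha0 : 0 < alpha.
Hypothesis lawQ : forall B, measurable B -> Q B = dirichlet_law (fun=> alpha) B.
Implicit Types (l : seq 'I_k.+1).

Let mass : \bar R := dirichlet_mass (fun _ : 'I_k.+1 => alpha) setT.
Let C : R := (fine mass)^-1.

Let law B : measurable B -> Q B = (C%:E * dirichlet_mass (fun=> alpha) B)%E.
Proof. exact: lawQ. Qed.

(** The Dirichlet kernel vanishes off the valid weights. *)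
Lemma valid_weights_ae : Q (~` [set r | valid_weights r]) = 0%E.
Proof.
rewrite law; last by apply: measurableC; exact: measurable_valid_weights.
rewrite /dirichlet_mass (eq_tuple_integral (g := fun=> 0%E)).
  by rewrite tuple_integral0 mule0.
move=> y; have [->|/dirichlet_kernel_neq0 vy] := eqVneq (dirichlet_kernel (fun=> alpha) (simplex_point y)) 0.
  by rewrite mul0r.
by rewrite indicE memNset ?mulr0 //= => /(_ vy).
Qed.

Definition weight_product l (r : k.+1.-tuple R) : R :=
  \prod_(j <- l) tnth (normalized_weights r) j.

Lemma weight_product_bounds l r : 0 <= weight_product l r <= 1.
Proof.
have vr := valid_normalized_weights r.
rewrite /weight_product; elim: l => [|j l /andP[h0 h1]]; first by rewrite big_nil ler01 lexx.
have r0 : 0 <= tnth (normalized_weights r) j by rewrite ltW // valid_weights_gt0.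
by rewrite big_cons mulr_ge0 //= mulr_ile1 // valid_weights_le1.
Qed.

Lemma measurable_normalized_tnth j :
  measurable_fun [set: k.+1.-tuple R] (fun r => tnth (normalized_weights r) j).
Proof.
exact: (measurableT_comp (measurable_tnth j) (@measurable_normalized_weights R k)).
Qed.

Lemma measurable_weight_product l : measurable_fun [set: k.+1.-tuple R] (weight_product l).
Proof. by apply: measurable_prod => j _; exact: measurable_normalized_tnth. Qed.

Let parameters l (i : nat) : R := alpha + (count (fun j : 'I_k.+1 => val j == i) l)%:R.

Lemma kernel_weight_product l (y : k.-tuple R) :
  dirichlet_kernel (fun=> alpha) (simplex_point y) * weight_product l (simplex_point y) =
  simplex_integrand (parameters l) 1 y.
Proof.
rewrite -dirichlet_kernel_integrand.
have [k0|/dirichlet_kernel_neq0 vy] := eqVneq (dirichlet_kernel (fun=> alpha) (simplex_point y)) 0.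
  rewrite k0 mul0r; move: k0; rewrite !dirichlet_kernelE => /eqP.
  rewrite prodf_seq_eq0 => /hasP[i _]; rewrite andTb /pos_power; case: ifP => i0.
    by move=> /eqP/powR_eq0_eq0 E; rewrite E ltxx in i0.
  by move=> _; rewrite (bigD1 i) //= /pos_power i0 mul0r.
rewrite !dirichlet_kernelE /weight_product /normalized_weights vy.
elim: l => [|j l IH].
  by rewrite big_nil mulr1; apply: eq_bigr => i _; rewrite /parameters /= addr0.
rewrite big_cons mulrCA IH (bigD1 j) //= [RHS](bigD1 j) //= mulrA mulr_pos_power.
congr (_ * _).
  by congr pos_power; rewrite /parameters /= eqxx natrD -addrA [1 + _]addrC.
apply: eq_bigr => i ij; congr pos_power; rewrite /parameters /=.
by rewrite (_ : (val j == val i) = false) //; apply/negbTE; rewrite val_eqE eq_sym.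
Qed.

Lemma integral_weight_product l : (\int[Q]_r (weight_product l r)%:E =
  C%:E * simplex_integral k (parameters l) 1)%E.
Proof.
rewrite (ge0_integral_dirichlet law (measurable_weight_product l)); last first.
  by move=> r; have /andP[] := weight_product_bounds l r.
by congr (_ * _)%E; apply: eq_tuple_integral => y; rewrite kernel_weight_product.
Qed.

(** Multiplying the Dirichlet density by a coordinate raises a parameter by one,
   so [simplex_integral_ratio] gives the recursion of [urn_moment]; the
   normalization is fixed by Q being a probability, without evaluating the beta
   function. *)
Lemma dirichlet_urn l : (\int[Q]_r (weight_product l r)%:E = (urn_moment alpha l)%:E)%E.
Proof.
elim: l => [|i l IH].
  rewrite (eq_integral (cst 1%E)) ?integral_cst //= ?probability_setT ?mule1 //.
  by move=> r _; rewrite /weight_product big_nil.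
have par0 j : 0 < parameters l j by rewrite ltr_pwDl.
have := simplex_integral_ratio (a := parameters l) 1 par0 (ltnSE (ltn_ord i)).
have -> : add_one (parameters l) i = parameters (i :: l).
  apply/funext => j; rewrite /add_one /parameters /= natrD addrAC -addrA; congr (_ + (_ + _)).
  by rewrite eq_sym.
have -> : \sum_(j < k.+1) parameters l j = alpha * k.+1%:R + (size l)%:R.
  rewrite /parameters big_split /= sumr_const card_ord mulr_natr; congr (_ + _).
  have /= := sum_count_mem l (fun=> 1 : R); under eq_bigr do rewrite mul1r.
  rewrite [in X in _ = X -> _]big_const_seq count_predT iter_addr_0 => <-.
  by apply: eq_bigr => j _; congr _%:R; apply: eq_count => a; rewrite /= val_eqE.
rewrite mul1e => h.
have := congr1 (fun z => (C%:E * z)%E) h.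
rewrite muleCA -integral_weight_product [RHS]muleCA -integral_weight_product IH.
set I := (\int[Q]_r _)%E.
have I1 : I \is a fin_num.
  rewrite ge0_fin_numE; last first.
    by apply: integral_ge0 => r _; rewrite lee_fin; have /andP[] := weight_product_bounds (i :: l) r.
  apply: (@le_lt_trans _ _ (\int[Q]_r 1)%E); last first.
    by rewrite integral_cst //= probability_setT mule1 ltry.
  apply: ge0_le_integral => //.
  - by move=> r _; rewrite lee_fin; have /andP[] := weight_product_bounds (i :: l) r.
  - by apply/measurable_EFinP; exact: measurable_weight_product.
  - by move=> r _; rewrite lee_fin; have /andP[] := weight_product_bounds (i :: l) r.
rewrite -(fineK I1) -!EFinM => -[E]; congr _%:E.
rewrite /= -[LHS](mulKf (lt0r_neq0 (@urn_denominator_gt0 R k alpha alpha0 (size l)))) E.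
have -> : parameters l i = alpha + (count_mem i l)%:R.
  by congr (_ + _%:R); apply: eq_count => a; rewrite /= val_eqE.
by rewrite mulrA [_^-1 * _]mulrC.
Qed.

Section linear_statistic.
Variable x : 'I_k.+1 -> R.

Definition linear_statistic (r : k.+1.-tuple R) : R :=
  \sum_i x i * tnth (normalized_weights r) i.

Lemma measurable_linear_statistic : measurable_fun [set: k.+1.-tuple R] linear_statistic.
Proof.
apply: measurable_sum => i; apply: measurable_funM; first exact: measurable_cst.
exact: measurable_normalized_tnth.
Qed.

Lemma linear_statistic_le r : `|linear_statistic r| <= \sum_i `|x i|.
Proof.
have vr := valid_normalized_weights r.
apply: le_trans (ler_norm_sum _ _ _) _; apply: ler_sum => i _.
rewrite normrM ler_piMr // ger0_norm ?valid_weights_le1 //.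
by rewrite ltW // valid_weights_gt0.
Qed.

Lemma measurable_moment l p :
  measurable_fun [set: k.+1.-tuple R] (fun r => weight_product l r * linear_statistic r ^+ p).
Proof.
apply: measurable_funM; first exact: measurable_weight_product.
by apply: measurable_funX; exact: measurable_linear_statistic.
Qed.

Lemma integrable_moment l p :
  Q.-integrable setT (EFin \o (fun r => weight_product l r * linear_statistic r ^+ p)).
Proof.
apply: measurable_bounded_integrable => //.
- by apply: (le_lt_trans (probability_le1 Q measurableT)); exact: ltry.
- exact: measurable_moment.
exists ((\sum_i `|x i|) ^+ p); split; first exact: num_real.
move=> M bM r _ /=; apply: le_trans (ltW bM).
have /andP[w0 w1] := weight_product_bounds l r.
rewrite normrM normrX (ger0_norm w0).
apply: (@le_trans _ _ (1 * `|linear_statistic r| ^+ p)).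
  by rewrite ler_wpM2r // exprn_ge0.
rewrite mul1r lerXn2r ?nnegrE ?linear_statistic_le //.
by apply: sumr_ge0.
Qed.

Lemma dirichlet_linear_moment l p :
  (\int[Q]_r (weight_product l r * linear_statistic r ^+ p)%:E =
   (linear_moment alpha x p l)%:E)%E.
Proof.
elim: p l => [|p IH] l.
  by rewrite -dirichlet_urn; apply: eq_integral => r _; rewrite expr0 mulr1.
rewrite /= -sumEFin.
rewrite (eq_bigr (fun i => \int[Q]_r ((x i)%:E *
    (weight_product (i :: l) r * linear_statistic r ^+ p)%:E)%E)%E); last first.
  by move=> i _; rewrite EFinM -IH -integralZl //; exact: integrable_moment.
rewrite -integral_sum //; last first.
  by move=> i; apply: integrableZl => //; exact: integrable_moment.
apply: eq_integral => r _.
under [RHS]eq_bigr do rewrite -EFinM; rewrite sumEFin; congr _%:E.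
rewrite exprS {1}/linear_statistic mulrA mulr_sumr mulr_suml; apply: eq_bigr => i _.
by rewrite /weight_product big_cons; ring.
Qed.
End linear_statistic.

Lemma dirichlet_fourth_moment (x : 'I_k.+1 -> R) (D : R) : \sum_i x i = 0 ->
  (forall i, `|x i| <= D) ->
  (\int[Q]_r (linear_statistic x r ^+ 4)%:E <=
   (6 * D ^+ 4 / (alpha * k.+1%:R) ^+ 2)%:E)%E.
Proof.
move=> x0 xD; rewrite (eq_integral (fun r => (weight_product [::] r * linear_statistic x r ^+ 4)%:E)).
  by rewrite dirichlet_linear_moment lee_fin linear_moment4_le.
by move=> r _; rewrite /weight_product big_nil mul1r.
Qed.

End dirichlet_moments.

(** * Zeros and moments along the chain *)

Section chain.
Context {R : realType}.
Implicit Types (s y : seq R) (p : {poly R}).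

Lemma ordered_zeros_eq p s : sorted <=%R s -> p %= monic_of_zeros s -> ordered_zeros p = s.
Proof.
move=> ss ps; rewrite /ordered_zeros; case: xgetP => [t -> [st pt]|/(_ s)]; last by case.
apply: (sorted_eq le_trans le_anti st ss).
apply: prod_XsubC_eq; apply/eqP; rewrite -eqp_monic ?monic_prod_XsubC //.
by rewrite (eqp_trans _ ps) // eqp_sym.
Qed.

Lemma monic_of_zeros_sort s : monic_of_zeros (sort <=%R s) = monic_of_zeros s.
Proof. by apply: perm_big; rewrite perm_sort. Qed.

Section weights.
Variable n : nat.
Implicit Types (r : forall m, (n - m).+1.-tuple R).

Definition chain_zeros (s : seq R) r m : seq R := ordered_zeros (poly_chain s r m).

Variables (A : R) (s : seq R) (r : forall m, (n - m).+1.-tuple R).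
Hypothesis ss : size s = n.
Hypothesis s_sorted : sorted <=%R s.
Hypothesis sA : forall x, x \in s -> `|x| <= A.
Hypothesis vr : forall m, (0 < m <= n)%N -> valid_weights (r m).

(** By induction on m, each step being [pair_derivative_real_rooted]. *)
Lemma chain_zerosP m : (m <= n)%N ->
  [/\ size (chain_zeros s r m) = (n - m)%N, sorted <=%R (chain_zeros s r m),
      forall x, x \in chain_zeros s r m -> `|x| <= A &
      poly_chain s r m = monic_of_zeros (chain_zeros s r m)].
Proof.
elim: m => [_|m IH mn].
  have -> : chain_zeros s r 0 = s by apply: ordered_zeros_eq => //=; exact: eqpxx.
  by rewrite subn0.
have [sz srt bnd pE] := IH (ltnW mn).
set t := chain_zeros s r m in sz srt bnd pE.
have st : size t = (n - m.+1).+1 by rewrite sz subnSK.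
have vrm : valid_weights (r m.+1) by apply: vr.
have sr : size (r m.+1) = (n - m.+1).+1 by rewrite size_tuple.
have pcE : poly_chain s r m.+1 = pair_derivative (zip (r m.+1) t).
  by rewrite -weighted_derivativeE.
have sumr : \sum_(a <- zip (r m.+1) t) a.1 = 1.
  rewrite -(big_map fst xpredT id) -/unzip1 unzip1_zip ?sr ?st //.
  by rewrite big_tuple valid_weights_sum.
have sz1 : size (zip (r m.+1) t) = (n - m.+1).+1 by rewrite size_zip sr st minnn.
have [|||y [sy yA yE]] := @pair_derivative_real_rooted R (zip (r m.+1) t) A.
- by rewrite sz1.
- move=> a at_; have : a.1 \in unzip1 (zip (r m.+1) t) by exact: map_f.
  rewrite unzip1_zip ?sr ?st // => /tnthP[i ->].
  exact: valid_weights_gt0.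
- move=> a at_; apply: bnd; have : a.2 \in unzip2 (zip (r m.+1) t) by exact: map_f.
  by rewrite unzip2_zip ?sr ?st.
rewrite sumr scale1r in yE.
have E : chain_zeros s r m.+1 = sort <=%R y.
  apply: ordered_zeros_eq; first by apply: sort_sorted; exact: le_total.
  by rewrite pcE yE monic_of_zeros_sort eqpxx.
rewrite E; split.
- by rewrite size_sort sy sz1.
- by apply: sort_sorted; exact: le_total.
- by move=> x; rewrite mem_sort; exact: yA.
- by rewrite pcE yE monic_of_zeros_sort.
Qed.

(** Pairs (weight, zero) that produce P_{n,m+1}; the weights of this step have
   the index m.+1. *)
Definition chain_pairs m : seq (R * R) := zip (r m.+1) (chain_zeros s r m).

Lemma chain_pairsE m : (m < n)%N ->
  [/\ size (r m.+1) = size (chain_zeros s r m), map snd (chain_pairs m) = chain_zeros s r m,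
      size (chain_pairs m) = (size (chain_zeros s r m.+1)).+1 &
      pair_derivative (chain_pairs m) = monic_of_zeros (chain_zeros s r m.+1)].
Proof.
move=> mn; have [sz srt bnd pE] := chain_zerosP (ltnW mn).
have [sz' _ _ pE'] := chain_zerosP mn.
have sr : size (r m.+1) = size (chain_zeros s r m) by rewrite size_tuple sz subnSK.
split=> //.
- by rewrite -/unzip2 unzip2_zip ?sr.
- by rewrite size_zip sr minnn sz sz' subnSK.
by rewrite -pE' -weighted_derivativeE // sz subnSK.
Qed.

End weights.

Definition moment s k : R := average s (fun x => x ^+ k).

Lemma momentE s k : moment s k = (size s)%:R^-1 * power_sum s k.
Proof. by []. Qed.

Lemma moment0 s : (0 < size s)%N -> moment s 0 = 1.
Proof.
move=> s0; rewrite momentE /power_sum; under eq_bigr do rewrite expr0.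
by rewrite big_const_seq count_predT iter_addr_0 mulVf // pnatr_eq0 -lt0n.
Qed.

Lemma expr_le_bound (A x : R) i K : `|x| <= A -> (i <= K)%N -> `|x ^+ i| <= (1 + A) ^+ K.
Proof.
move=> xA iK; have A0 : 0 <= A := le_trans (normr_ge0 x) xA.
rewrite normrX (@le_trans _ _ ((1 + A) ^+ i)) //.
  by rewrite lerXn2r ?nnegrE ?addr_ge0 // (le_trans xA) // lerDr.
by rewrite ler_weXn2l // lerDl.
Qed.

Lemma moment_le (A : R) s i K : 0 <= A -> (forall x, x \in s -> `|x| <= A) -> (i <= K)%N ->
  `|moment s i| <= (1 + A) ^+ K.
Proof.
move=> A0 sA iK; case: (posnP (size s)) => [s0|s0].
  by rewrite momentE s0 invr0 mul0r normr0 exprn_ge0 // addr_ge0.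
rewrite momentE normrM ger0_norm ?invr_ge0 // ler_pdivrMl ?ltr0n //.
rewrite (le_trans (ler_norm_sum _ _ _)) // big_seq.
rewrite (le_trans (ler_sum _ (fun x xs => expr_le_bound (sA x xs) iK))) //.
by rewrite -big_seq big_const_seq count_predT iter_addr_0 mulr_natl.
Qed.

Section chain_moments.
Variables (n : nat) (A : R) (s : seq R) (r : forall m, (n - m).+1.-tuple R).
Hypothesis ss : size s = n.
Hypothesis s_sorted : sorted <=%R s.
Hypothesis sA : forall x, x \in s -> `|x| <= A.
Hypothesis vr : forall m, (0 < m <= n)%N -> valid_weights (r m).

Let lam m := chain_zeros s r m.
Definition chain_weighted m k := weighted_power_sum (chain_pairs s r m) k.
Definition chain_decrement m k := power_sum (chain_zeros s r m) k - power_sum (chain_zeros s r m.+1) k.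

Lemma sum_pairs_weights m : (m < n)%N -> \sum_(a <- chain_pairs s r m) a.1 = 1.
Proof.
move=> mn; have [sr _ _ _] := chain_pairsE ss s_sorted sA vr mn.
rewrite -(big_map fst xpredT id) -/unzip1 unzip1_zip ?sr //.
by rewrite big_tuple valid_weights_sum // vr.
Qed.

Lemma chain_newton m : (m < n)%N ->
  newton_relation (chain_weighted m) (chain_decrement m).
Proof.
move=> mn; have [sr sE sz pd] := chain_pairsE ss s_sorted sA vr mn.
split.
  rewrite /chain_weighted /weighted_power_sum; under eq_bigr do rewrite expr0 mulr1.
  exact: sum_pairs_weights.
by move=> k; have := power_sums_of_derivative sz pd k; rewrite sE.
Qed.

(** There are n - m zeros before the step and n - m - 1 after it. *)
Lemma chain_moment_step m k : (m.+1 < n)%N ->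
  moment (lam m.+1) k = moment (lam m) k +
    (moment (lam m) k - chain_decrement m k) / (n - m.+1)%:R.
Proof.
move=> mn; have [sz _ _ _] := chain_zerosP ss s_sorted sA vr (ltnW (ltnW mn)).
have [sz' _ _ _] := chain_zerosP ss s_sorted sA vr (ltnW mn).
rewrite !momentE /chain_decrement sz sz' -(subnSK (ltnW mn)) -natr1.
have : 0 < (n - m.+1)%:R :> R by rewrite ltr0n subn_gt0.
move: (n - m.+1)%:R (power_sum _ _) (power_sum (lam m.+1) k) => N p p' N0.
field; apply/andP; split; first by rewrite gt_eqF.
by rewrite gt_eqF // addr_gt0.
Qed.

Lemma chain_weighted_le m i K : 0 <= A -> (m < n)%N -> (i <= K)%N ->
  `|chain_weighted m i| <= (1 + A) ^+ K.
Proof.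
move=> A0 mn iK; have [sr sE sz pd] := chain_pairsE ss s_sorted sA vr mn.
have [_ _ bnd _] := chain_zerosP ss s_sorted sA vr (ltnW mn).
rewrite (le_trans (ler_norm_sum _ _ _)) // -[leRHS]mul1r -[X in _ <= X * _](sum_pairs_weights mn).
rewrite mulr_suml big_seq [leRHS]big_seq; apply: ler_sum => a at_.
have a1 : 0 <= a.1.
  have : a.1 \in unzip1 (chain_pairs s r m) by exact: map_f.
  rewrite unzip1_zip ?sr // => /tnthP[j ->].
  by rewrite ltW // valid_weights_gt0 // vr.
rewrite normrM (ger0_norm a1); apply: ler_wpM2l => //; apply: expr_le_bound iK.
by apply: bnd; rewrite -sE; exact: map_f.
Qed.
End chain_moments.

Section derivative.
Variables (n : nat) (A : R) (s : seq R).
Hypothesis ss : size s = n.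
Hypothesis s_sorted : sorted <=%R s.
Hypothesis sA : forall x, x \in s -> `|x| <= A.

(** The deterministic weights for which the chain is, up to constants, the
   sequence of the derivatives. *)
Definition uniform_chain m : (n - m).+1.-tuple R := @uniform_weights R (n - m).

Lemma pair_derivative_const (c : R) (t : seq R) k : size t = k ->
  pair_derivative (zip (nseq k c) t) = c *: (monic_of_zeros t)^`().
Proof.
elim: t k => [|x t IH] [|k] //=; first by rewrite /monic_of_zeros big_nil derivC scaler0.
case=> st; rewrite -/unzip2 unzip2_zip ?size_nseq ?st // (IH k st).
by rewrite monic_of_zeros_cons derivM derivXsubC mul1r scalerDr scalerAr.
Qed.

Lemma poly_chain_uniform m : (m <= n)%N -> exists2 c, c != 0 &
  poly_chain s uniform_chain m = c *: (monic_of_zeros s)^`(m).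
Proof.
have vu m' : (0 < m' <= n)%N -> valid_weights (uniform_chain m').
  by move=> _; exact: valid_uniform_weights.
elim: m => [_|m IH mn]; first by exists 1; rewrite ?oner_neq0 //= scale1r.
have [c c0 pE] := IH (ltnW mn).
have [sz _ _ pE'] := chain_zerosP ss s_sorted sA vu (ltnW mn).
have st : size (chain_zeros s uniform_chain m) = (n - m.+1).+1 by rewrite sz subnSK.
exists ((n - m.+1).+1%:R^-1 * c); first by rewrite mulf_neq0 // invr_eq0 pnatr_eq0.
rewrite /= -/(chain_zeros s uniform_chain m) weighted_derivativeE //.
have -> : tval (uniform_chain m.+1) = nseq (n - m.+1).+1 (n - m.+1).+1%:R^-1.
  apply: (@eq_from_nth _ 0); rewrite size_tuple ?size_nseq // => i ik.
  by rewrite nth_nseq ik (nth_mktuple _ _ (Ordinal ik)).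
by rewrite pair_derivative_const // -pE' pE derivZ scalerA.
Qed.

Lemma ordered_zeros_derivn m : (m <= n)%N ->
  ordered_zeros ((monic_of_zeros s)^`(m)) = chain_zeros s uniform_chain m.
Proof.
move=> mn; have vu m' : (0 < m' <= n)%N -> valid_weights (uniform_chain m').
  by move=> _; exact: valid_uniform_weights.
have [_ srt _ pE] := chain_zerosP ss s_sorted sA vu mn.
apply: ordered_zeros_eq => //; rewrite -pE.
have [c c0 ->] := poly_chain_uniform mn.
by rewrite eqp_sym eqp_scale.
Qed.

(** This closes the recursion for the moments. *)
Lemma chain_weighted_uniform m k : (m < n)%N ->
  chain_weighted s uniform_chain m k = moment (chain_zeros s uniform_chain m) k.
Proof.
move=> mn; have vu m' : (0 < m' <= n)%N -> valid_weights (uniform_chain m').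
  by move=> _; exact: valid_uniform_weights.
have [sr sE _ _] := chain_pairsE ss s_sorted sA vu mn.
have [sz _ _ _] := chain_zerosP ss s_sorted sA vu (ltnW mn).
rewrite momentE sz /power_sum -[in RHS]sE big_map mulr_sumr.
rewrite /chain_weighted /weighted_power_sum big_seq [RHS]big_seq.
apply: eq_bigr => a at_; congr (_ * _).
have : a.1 \in unzip1 (chain_pairs s uniform_chain m) by exact: map_f.
rewrite unzip1_zip ?sr // => /tnthP[j ->].
by rewrite tnth_mktuple subnSK.
Qed.
End derivative.

End chain.

(** * Independence *)

Section independence.
Context {R : realType} {d : measure_display} {Omega : measurableType d}.
Variable P : probability Omega R.

Section fubini.
Context {d1 d2 : measure_display} {T1 : measurableType d1} {T2 : measurableType d2}.
Variables (X : {RV P >-> T1}) (Y : {RV P >-> T2}).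
Hypothesis indep : forall A B, measurable A -> measurable B ->
  P (X @^-1` A `&` Y @^-1` B) = (P (X @^-1` A) * P (Y @^-1` B))%E.

(** The joint law is the product of the laws; then Tonelli integrates over Y
   first. *)
Lemma integral_independent_le (h : T1 * T2 -> R) (c : R) :
  measurable_fun setT h -> (forall z, 0 <= h z) ->
  (forall w, (\int[distribution P Y]_y (h (X w, y))%:E <= c%:E)%E) ->
  (\int[P]_w (h (X w, Y w))%:E <= c%:E)%E.
Proof.
move=> mh h0 hc.
have mXY : measurable_fun setT (fun w => (X w, Y w)) by apply: measurable_fun_pair.
pose XY : {RV P >-> (T1 * T2)%type} := mfun_Sub (mem_set mXY).
have mh' : measurable_fun setT (EFin \o h) by exact/measurable_EFinP.
have h0' z : (0 <= (EFin \o h) z)%E by rewrite lee_fin.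
have -> : (\int[P]_w (h (X w, Y w))%:E = \int[distribution P XY]_z (h z)%:E)%E.
  by rewrite (ge0_integral_distribution XY mh').
have -> : (\int[distribution P XY]_z (h z)%:E =
    \int[distribution P X \x distribution P Y]_z (h z)%:E)%E.
  apply: eq_measure_integral => U mU _; apply/esym.
  by apply: product_measure_unique mU => A B mA mB; exact: indep.
rewrite (fubini_tonelli1 _ mh' h0') /fubini_F.
have mF : measurable_fun setT (fun x => (\int[distribution P Y]_y (EFin \o h) (x, y))%E).
  by apply: measurable_fun_fubini_tonelli_F.
have F0 x : (0 <= (\int[distribution P Y]_y (EFin \o h) (x, y)))%E by apply: integral_ge0.
rewrite (ge0_integral_distribution X mF F0).
apply: (@le_trans _ _ (\int[P]_w c%:E)%E); last first.
  by rewrite integral_cst //= probability_setT mule1.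
apply: ge0_le_integral => //.
- by move=> w _; exact: F0.
- by apply: (measurableT_comp mF).
- by move=> w _; exact: hc.
Qed.
End fubini.

(** The sets independent of F form a Dynkin system. *)
Lemma independent_generated (G : set (set Omega)) F :
  setI_closed G -> G `<=` measurable -> measurable F ->
  (forall E, G E -> P (E `&` F) = (P E * P F)%E) ->
  forall E, <<s G>> E -> P (E `&` F) = (P E * P F)%E.
Proof.
move=> GI Gm mF GF.
have sub : <<s G>> `<=` @measurable _ Omega.
  by apply: smallest_sub => //; exact: sigma_algebra_measurable.
have PF : P F \is a fin_num by rewrite fin_num_measure.
have HC (S : set Omega) : measurable S -> P (S `&` F) = (P S * P F)%E ->
    P (~` S `&` F) = (P (~` S) * P F)%E.
  move=> mS IS; have PS : P S \is a fin_num by rewrite fin_num_measure.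
  rewrite setIC -setDE measureD //; last first.
    by apply: (le_lt_trans (probability_le1 P mF)); exact: ltry.
  rewrite [X in (_ - P X)%E]setIC IS probability_setC //.
  have key (a b : \bar R) : a \is a fin_num -> b \is a fin_num ->
      (a - b * a = (1 - b) * a)%E.
    by move=> af bf; rewrite muleBl ?mul1e // fin_num_adde_defl // fin_numN.
  exact: key.
have HU (S : (set Omega)^nat) : (forall k, measurable (S k)) -> trivIset setT S ->
    (forall k, P (S k `&` F) = (P (S k) * P F)%E) ->
    P (\bigcup_k S k `&` F) = (P (\bigcup_k S k) * P F)%E.
  move=> mS tS IS; have mU : measurable (\bigcup_k S k) by exact: bigcup_measurable.
  rewrite setI_bigcupl measure_semi_bigcup //; first last.
  - by apply: bigcup_measurable => k _; exact: measurableI.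
  - by apply: trivIset_setIr.
  - by move=> i; exact: measurableI.
  rewrite (measure_semi_bigcup P mS tS mU) muleC -(fineK PF) -nneseriesZl //.
  by apply: eq_eseriesr => i _; rewrite (fineK PF) [RHS]muleC; exact: IS.
apply: (@dynkin_induction _ (g_sigma_algebraType G) G) => //.
- by rewrite setTI probability_setT mul1e.
- by move=> S mS; apply: HC; exact: sub.
- by move=> S mS tS IS; exact: (HU S (fun k => sub _ (mS k)) tS IS).
Qed.
End independence.

(** * Measurability of ordered zeros *)

Lemma continuous_clamp {R : realType} (a b : R) (g : R -> R) : continuous g ->
  continuous (fun x => Num.min b (Num.max a (g x))).
Proof.
move=> cg x; apply: (@continuous_min _ _ (fun=> b) (fun x => Num.max a (g x))).
  exact: cvg_cst.
apply: (@continuous_max _ _ (fun=> a) g); first exact: cvg_cst.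
exact: cg.
Qed.

Section measurable_zeros.
Context {R : realType} {d : measure_display} {T : measurableType d}.

Section ordered_family.
Variables (y : T -> seq R) (N : nat) (A : R).
Hypothesis A0 : 0 < A.
Hypothesis sy : forall w, size (y w) = N.
Hypothesis y_sorted : forall w, sorted <=%R (y w).
Hypothesis yA : forall w x, x \in y w -> `|x| <= A.
Hypothesis my : forall k, measurable_fun setT (fun w => power_sum (y w) k).

Let measurable_sum_horner (p : {poly R}) :
  measurable_fun setT (fun w => \sum_(x <- y w) p.[x]).
Proof.
rewrite (_ : (fun w => _) = (fun w => \sum_(i < size p) p`_i * power_sum (y w) i)).
  by apply: measurable_sum => i; apply: measurable_funM => //; exact: measurable_cst.
apply/funext => w; rewrite /power_sum.
under [RHS]eq_bigr do rewrite mulr_sumr.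
by rewrite exchange_big; apply: eq_bigr => x _; rewrite horner_coef.
Qed.

Let measurable_sum_continuous (f : R -> R) : continuous f ->
  measurable_fun setT (fun w => \sum_(x <- y w) f x).
Proof.
move=> cf.
have e0 n : 0 < n.+1%:R^-1 :> R by rewrite invr_gt0 ltr0n.
have /choice[p pP] n := weierstrass cf A0 (e0 n).
apply: (measurable_fun_cvg (h := fun n w => \sum_(x <- y w) (p n).[x])) => // w _.
rewrite big_seq; under eq_fun do rewrite big_seq.
apply: cvg_big => [|x xy]; first exact: add_continuous.
apply/cvgrPdist_le => e e_gt0; near=> n.
apply: le_trans (pP n x (yA xy)) _.
apply: ltW; near: n; exact: (near_infty_natSinv_lt (PosNum e_gt0)).
Unshelve. all: by end_near. Qed.

Let measurable_count (c : R) :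
  measurable_fun setT (fun w => (count (fun x => x < c) (y w))%:R : R).
Proof.
pose f n (x : R) := Num.min 1 (Num.max 0 (n%:R * (c - x))).
have cf n : continuous (f n).
  apply: continuous_clamp => x; apply: cvgM; first exact: cvg_cst.
  by apply: cvgB; [exact: cvg_cst|exact: cvg_id].
apply: (measurable_fun_cvg (h := fun n w => \sum_(x <- y w) f n x)).
  by move=> n; exact: measurable_sum_continuous.
move=> w _.
rewrite -sum1_count natr_sum big_mkcond.
apply: cvg_big => [|x _]; first exact: add_continuous.
apply: cvg_near_cst; case: ltP => xc.
  near=> n; rewrite /f; have nx : 1 <= n%:R * (c - x).
    rewrite -ler_pdivrMr ?subr_gt0 // mul1r ltW //; near: n.
    exact: nbhs_infty_gtr.
  by rewrite (max_idPr _) ?(min_idPl _) // (le_trans ler01).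
near=> n; rewrite /f (max_idPl _) ?(min_idPr _) //.
by rewrite mulr_ge0_le0 // subr_le0.
Unshelve. all: by end_near. Qed.

(** Power sums give the sums of polynomials over the zeros, then of continuous
   functions (uniform limits), then of indicators of half-lines (pointwise
   limits of ramps), that is, the number of zeros below c. The j-th zero is
   below c exactly when this number exceeds j. *)
Lemma measurable_ordered_family j : measurable_fun setT (fun w => (y w)`_j).
Proof.
have [Nj|jN] := leqP N j.
  rewrite (_ : (fun w => _) = cst 0) //; apply/funext => w.
  by rewrite nth_default // sy.
apply: (measurability _ (RGenInftyO.measurableE R)) => // _ [_ [c ->] <-].
rewrite setTI (_ : _ @^-1` _ = (fun w => (count (fun x => x < c) (y w))%:R : R) @^-1` `]j%:R, +oo[).
  by rewrite -[X in measurable X]setTI; apply: measurable_count => //.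
apply/seteqP; split=> w /=; rewrite !in_itv /= andbT ltr_nat => h.
  rewrite -(cat_take_drop j.+1 (y w)) count_cat.
  have st : size (take j.+1 (y w)) = j.+1 by rewrite size_takel // sy.
  suff -> : count (fun x => x < c) (take j.+1 (y w)) = j.+1 by rewrite leq_addr.
  rewrite -[RHS]st; apply/eqP; rewrite -all_count; apply/(all_nthP 0) => i.
  rewrite st ltnS => ij; rewrite nth_take // (le_lt_trans _ h) //.
  by apply: (sorted_leq_nth le_trans le_refl) => //; rewrite inE sy // (leq_ltn_trans ij).
rewrite ltNge; apply/negP => cy; move: h; rewrite ltnNge => /negP; apply.
rewrite -(cat_take_drop j (y w)) count_cat.
rewrite (_ : count _ (drop _ _) = 0%N); last first.
  apply/eqP; rewrite -leqn0 leqNgt -has_count; apply/negP => /(has_nthP 0)[i].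
  rewrite size_drop sy nth_drop => ij; rewrite ltNge => /negP; apply.
  apply: (le_trans cy); apply: (sorted_leq_nth le_trans le_refl) => //; rewrite ?inE ?sy ?leq_addr //.
  by rewrite -ltn_subRL.
by rewrite addn0 (leq_trans (count_size _ _)) // size_take sy jN.
Qed.
End ordered_family.

Lemma measurable_newton (w q : T -> nat -> R) :
  (forall t, newton_relation (w t) (q t)) ->
  (forall i, measurable_fun setT (fun t => w t i)) ->
  forall k, (0 < k)%N -> measurable_fun setT (fun t => q t k).
Proof.
move=> wq mw k; elim/ltn_ind: k => -[//|k] IH _.
rewrite (_ : (fun t => _) = (fun t => k.+1%:R * w t k.+1 -
    \sum_(i < k) w t i.+1 * q t (k - i)%N)).
  apply: measurable_funB; first by apply: measurable_funM => //; exact: measurable_cst.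
  apply: measurable_sum => i; apply: measurable_funM => //.
  by apply: IH; rewrite ?ltnS ?leq_subr // subn_gt0.
apply/funext => t; have [w0 <-] := wq t.
by rewrite big_ord_recl w0 mul1r subn0 addrK.
Qed.

Section chain.
Variables (n : nat) (A : R) (s : T -> seq R) (r : T -> forall m, (n - m).+1.-tuple R).
Hypothesis A0 : 0 < A.
Hypothesis ss : forall w, size (s w) = n.
Hypothesis s_sorted : forall w, sorted <=%R (s w).
Hypothesis sA : forall w x, x \in s w -> `|x| <= A.
Hypothesis vr : forall w m, (0 < m <= n)%N -> valid_weights (r w m).
Hypothesis ms : forall j, measurable_fun setT (fun w => (s w)`_j).

(** The power sums of the new zeros are polynomials in the weights and the old
   zeros, by [chain_newton]. *)
Lemma measurable_chain_zeros M : (M <= n)%N ->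
  (forall m, (0 < m <= M)%N -> forall j, measurable_fun setT (fun w => tnth (r w m) j)) ->
  forall j, measurable_fun setT (fun w => (chain_zeros (s w) (r w) M)`_j).
Proof.
elim: M => [_ _ j|M IH Mn mr].
  rewrite (_ : (fun w => _) = (fun w => (s w)`_j)) //; apply/funext => w.
  congr (_`_j); rewrite /chain_zeros /=; apply: ordered_zeros_eq => //; exact: eqpxx.
have {}IH : forall j, measurable_fun setT (fun w => (chain_zeros (s w) (r w) M)`_j).
  by apply: IH; [exact: ltnW|move=> m /andP[m0 mM]; apply: mr; rewrite m0 ltnW].
have szM w : size (chain_zeros (s w) (r w) M) = (n - M)%N.
  by have [] := chain_zerosP (ss w) (@s_sorted w) (@sA w) (@vr w) (ltnW Mn).
have mpow k : measurable_fun setT (fun w => power_sum (chain_zeros (s w) (r w) M) k).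
  rewrite (_ : (fun w => _) = (fun w => \sum_(i < n - M) (chain_zeros (s w) (r w) M)`_i ^+ k)).
    by apply: measurable_sum => i; exact: measurable_funX.
  by apply/funext => w; rewrite /power_sum (big_nth 0) big_mkord szM.
have mw k : measurable_fun setT (fun w => chain_weighted (s w) (r w) M k).
  rewrite (_ : (fun w => _) = (fun w => \sum_(i < (n - M.+1).+1) tnth (r w M.+1) i *
     (chain_zeros (s w) (r w) M)`_i ^+ k)).
    apply: measurable_sum => i; apply: measurable_funM; last exact: measurable_funX.
    by apply: mr; rewrite leqnn.
  apply/funext => w; rewrite /chain_weighted /weighted_power_sum /chain_pairs.
  rewrite (big_nth (0, 0)) big_mkord size_zip size_tuple szM -(subnSK Mn) minnn.
  apply: eq_bigr => i _; rewrite nth_zip ?size_tuple ?szM ?subnSK //=.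
  by rewrite (tnth_nth 0).
have mq := measurable_newton (fun w => chain_newton (ss w) (@s_sorted w) (@sA w) (@vr w) Mn) mw.
have P w := chain_zerosP (ss w) (@s_sorted w) (@sA w) (@vr w) Mn.
apply: (@measurable_ordered_family _ (n - M.+1)%N A) => //.
- by move=> w; have [] := P w.
- by move=> w; have [] := P w.
- by move=> w; have [] := P w.
case=> [|k].
  rewrite (_ : (fun w => _) = cst (n - M.+1)%:R) //; apply/funext => w.
  have [sz _ _ _] := P w; rewrite /power_sum; under eq_bigr do rewrite expr0.
  by rewrite big_const_seq count_predT iter_addr_0 sz.
rewrite (_ : (fun w => _) = (fun w => power_sum (chain_zeros (s w) (r w) M) k.+1 -
   chain_decrement (s w) (r w) M k.+1)).
  by apply: measurable_funB => //; exact: mq.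
by apply/funext => w; rewrite /chain_decrement opprB addrC subrK.
Qed.
End chain.

End measurable_zeros.

(** * Noise of the random chain *)

Section noise.
Context {R : realType} {d : measure_display} {Omega : measurableType d}.
Variable P : probability Omega R.
Variable zeros0 : forall n, {RV P >-> n.-tuple R}.
Variable rho : forall n m, {RV P >-> (n - m).+1.-tuple R}.

Section past.
Variables (n m : nat).
Hypothesis indep : mutually_independent P (@construction_family R d Omega P zeros0 rho n).
Hypothesis mn : (m < n)%N.
Let family := @construction_family R d Omega P zeros0 rho n.

(** A pi-system that generates the information on the zeros of P_{n,0} and the
   weights up to index m; the zeros of P_{n,m} are measurable with respect to
   it. *)
Definition past : set (set Omega) :=
  [set E | exists2 F : 'I_n.+1 -> set Omega,
     forall i, family i (F i) & E = [set w | forall i : 'I_n.+1, (i <= m)%N -> F i w]].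

Lemma family_measurable i E : family i E -> measurable E.
Proof.
by rewrite /family /construction_family; case: (val i) => [|k] [B mB <-];
  exact: (measurable_funP _ measurableT _ mB).
Qed.

Lemma familyT i : family i setT.
Proof.
by rewrite /family /construction_family; case: (val i) => [|k]; exists setT; rewrite // setTI.
Qed.

Lemma familyI i E E' : family i E -> family i E' -> family i (E `&` E').
Proof.
rewrite /family /construction_family; case: (val i) => [|k] [B mB <-] [B' mB' <-];
  (exists (B `&` B'); first exact: measurableI); by rewrite !setTI preimage_setI.
Qed.

Lemma family_zeros (i : 'I_n.+1) B : val i = 0 -> measurable B -> family i (zeros0 n @^-1` B).
Proof. by rewrite /family /construction_family => -> mB; exists B; rewrite // setTI. Qed.

Lemma family_weights (i : 'I_n.+1) k B : val i = k.+1 -> measurable B ->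
  family i (rho n k.+1 @^-1` B).
Proof. by rewrite /family /construction_family => -> mB; exists B; rewrite // setTI. Qed.

Lemma setI_closed_past : setI_closed past.
Proof.
move=> E E' [F FF ->] [F' FF' ->]; exists (fun i => F i `&` F' i).
  by move=> i; exact: familyI.
by apply/seteqP; split=> w /= => [[h h'] i im|h]; split; auto => i im; have [] := h i im.
Qed.

Lemma past_family (i : 'I_n.+1) E : (i <= m)%N -> family i E -> past E.
Proof.
move=> im fE; exists (fun j => if j == i then E else setT).
  by move=> j; case: eqP => [->//|_]; exact: familyT.
apply/seteqP; split=> w /= h; last by have := h i im; rewrite eqxx.
by move=> j _; case: eqP.
Qed.

Lemma past_measurable : past `<=` measurable.
Proof.
move=> E [F FF ->].
rewrite (_ : [set w | _] = \bigcap_(i in [set i : 'I_n.+1 | (i <= m)%N]) F i) //.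
apply: fin_bigcap_measurable; first exact: finite_finset.
by move=> i _; exact: (family_measurable (FF i)).
Qed.

(** Mutual independence for the indices up to m, with and without m + 1. *)
Lemma past_independent E B : past E -> measurable B ->
  P (E `&` rho n m.+1 @^-1` B) = (P E * P (rho n m.+1 @^-1` B))%E.
Proof.
move=> [F FF ->] mB; set G := _ @^-1` B.
have mn' : (m.+1 < n.+1)%N by [].
pose i0 := Ordinal mn'.
pose J := [set i : 'I_n.+1 | (i <= m)%N]%SET.
have iJ : i0 \notin J by rewrite inE /= ltnn.
pose F' i := if i == i0 then G else F i.
have FF' i : family i (F' i).
  by rewrite /F'; case: eqP => [->|//]; exact: family_weights.
have F'J i : i \in J -> F' i = F i by rewrite /F'; case: eqP => [->|//]; rewrite (negbTE iJ).
have h1 := indep (fun i (_ : i \in J) => FF' i).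
have h2 := indep (fun i (_ : i \in i0 |: J) => FF' i).
rewrite big_setU1 //= -h1 in h2.
have E1 : \bigcap_(i in [set` J]) F' i = [set w | forall i : 'I_n.+1, (i <= m)%N -> F i w].
  apply/seteqP; split=> w /= h i; last by rewrite /= => iJ'; rewrite F'J //; apply: h; move: iJ'; rewrite inE.
  by move=> im; have := h i; rewrite /= F'J ?inE //; apply.
rewrite -E1 muleC (_ : P G = P (F' i0)); last by rewrite /F' eqxx.
rewrite -h2; congr (P _); apply/seteqP; split=> w /=.
  move=> [h Gw] i /=; rewrite !inE => /orP[/eqP->|iJ']; first by rewrite /F' eqxx.
  by apply: h; rewrite /= inE.
move=> h; split=> [i iJ'|]; first by apply: h; rewrite /= !inE; rewrite /= inE in iJ'; rewrite iJ' orbT.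
by have := h i0; rewrite /= !inE eqxx /F' eqxx; apply.
Qed.
End past.

Definition normalized_chain n w m : (n - m).+1.-tuple R := normalized_weights (rho n m w).
Definition random_zeros n m w := chain_zeros (zeros0 n w) (normalized_chain n w) m.
(** The defect of the moment recursion: for uniform weights it would be 0. *)
Definition noise n m l w :=
  chain_weighted (zeros0 n w) (normalized_chain n w) m l - moment (random_zeros n m w) l.

Variable A : R.
Hypothesis A0 : 0 < A.
Hypothesis zeros_sorted : forall n w, sorted <=%R (zeros0 n w).
Hypothesis zerosA : forall n w x, x \in tval (zeros0 n w) -> `|x| <= A.

Lemma valid_normalized_chain n w m : (0 < m <= n)%N -> valid_weights (normalized_chain n w m).
Proof. by move=> _; exact: valid_normalized_weights. Qed.

Lemma random_zerosP n m w : (m <= n)%N ->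
  [/\ size (random_zeros n m w) = (n - m)%N, sorted <=%R (random_zeros n m w) &
      forall x, x \in random_zeros n m w -> `|x| <= A].
Proof.
move=> mn; have [] // := chain_zerosP (size_tuple (zeros0 n w)) (@zeros_sorted n w)
  (@zerosA n w) (@valid_normalized_chain n w) mn.
Qed.

Definition centered_power n m l w : (n - m.+1).+1.-tuple R :=
  [tuple (random_zeros n m w)`_i ^+ l - moment (random_zeros n m w) l | i < (n - m.+1).+1].

(** The weights sum to 1, so the moment can be subtracted from each power. *)
Lemma noiseE n m l w : (m < n)%N ->
  noise n m l w = linear_statistic (tnth (centered_power n m l w)) (rho n m.+1 w).
Proof.
move=> mn; have [sz _ _] := random_zerosP w (ltnW mn).
have vr := @valid_normalized_chain n w m.+1 mn.
rewrite /noise /linear_statistic -[X in _ - X]mulr1 -[X in _ - _ * X](valid_weights_sum vr).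
rewrite mulr_sumr /chain_weighted /weighted_power_sum /chain_pairs.
rewrite (big_nth (0, 0)) big_mkord size_zip size_tuple -/(random_zeros n m w) sz -(subnSK mn) minnn.
rewrite -sumrB; apply: eq_bigr => i _.
rewrite nth_zip ?size_tuple ?sz ?subnSK //= tnth_mktuple -tnth_nth.
by rewrite mulrBl [_ ^+ l * _]mulrC.
Qed.

Lemma sum_centered_power n m l w : (m < n)%N -> \sum_i tnth (centered_power n m l w) i = 0.
Proof.
move=> mn; have [sz _ _] := random_zerosP w (ltnW mn).
under eq_bigr do rewrite tnth_mktuple.
rewrite sumrB sumr_const card_ord momentE /power_sum.
rewrite [X in _ - _ * X *+ _](big_nth 0) big_mkord sz -(subnSK mn).
by rewrite -[X in _ - X]mulr_natl mulVKf ?subrr // pnatr_eq0.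
Qed.

Lemma centered_power_le n m l w i : (m < n)%N ->
  `|tnth (centered_power n m l w) i| <= 2 * (1 + A) ^+ l.
Proof.
move=> mn; have [sz _ bnd] := random_zerosP w (ltnW mn).
rewrite tnth_mktuple (le_trans (ler_normB _ _)) // mulr2n mulrDl !mul1r lerD //.
  by apply: expr_le_bound (leqnn l); apply: bnd; rewrite mem_nth // sz -(subnSK mn).
by apply: moment_le => //; exact: ltW.
Qed.

Section moments.
Variables (n m l : nat).
Hypothesis mn : (m < n)%N.

Lemma measurable_past_zeros j :
  measurable_fun [set: g_sigma_algebraType (past n m)] (fun w => (random_zeros n m w)`_j).
Proof.
pose Om := g_sigma_algebraType (past n m).
apply: (@measurable_chain_zeros R _ Om n A (fun w => zeros0 n w) (@normalized_chain n)) => //.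
- by move=> w; exact: size_tuple.
- by move=> w x; exact: zerosA.
- by move=> w k; exact: valid_normalized_chain.
- move=> k; have [nk|kn] := leqP n k.
    rewrite (_ : (fun w => _) = cst 0) //; apply/funext => w.
    by rewrite nth_default // size_tuple.
  move=> _ B mB; rewrite setTI; apply: sub_sigma_algebra.
  have -> : (fun w : Om => (zeros0 n w)`_k) @^-1` B =
      zeros0 n @^-1` ((@tnth n R ^~ (Ordinal kn)) @^-1` B).
    by apply/seteqP; split=> w /=; rewrite (tnth_nth 0).
  apply: (@past_family n m ord0) => //; apply: family_zeros => //.
  by rewrite -[X in measurable X]setTI; exact: measurable_tnth.
- exact: ltnW.
move=> k /andP[k0 km] j' _ B mB; rewrite setTI; apply: sub_sigma_algebra.
have kn : (k < n.+1)%N by rewrite ltnS (leq_trans km) // ltnW.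
case: k => [//|k] in k0 km j' kn *.
apply: (@past_family n m (Ordinal kn)) => //.
have -> : (fun w : Om => tnth (normalized_chain n w k.+1) j') @^-1` B =
    rho n k.+1 @^-1` ((fun r => tnth (normalized_weights r) j') @^-1` B) by [].
apply: family_weights => //.
by rewrite -[X in measurable X]setTI; exact: measurable_normalized_tnth.
Qed.

Lemma measurable_past_power :
  measurable_fun [set: g_sigma_algebraType (past n m)] (centered_power n m l).
Proof.
apply/measurable_fun_tnthP => i /=.
rewrite (_ : _ \o _ = fun w => (random_zeros n m w)`_i ^+ l - moment (random_zeros n m w) l); last first.
  by apply/funext => w /=; rewrite tnth_mktuple.
apply: measurable_funB; first by apply: measurable_funX; exact: measurable_past_zeros.
rewrite (_ : (fun w => _) = fun w => (n - m)%:R^-1 * \sum_(i < n - m) (random_zeros n m w)`_i ^+ l).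
  apply: measurable_funM; first exact: measurable_cst.
  by apply: measurable_sum => k; apply: measurable_funX; exact: measurable_past_zeros.
apply/funext => w; have [sz _ _] := random_zerosP w (ltnW mn).
by rewrite momentE /power_sum (big_nth 0) big_mkord sz.
Qed.

Lemma measurable_centered_power : measurable_fun setT (centered_power n m l).
Proof.
move=> _ B mB; have := measurable_past_power measurableT mB.
by apply: smallest_sub; [exact: sigma_algebra_measurable|exact: past_measurable].
Qed.

Lemma measurable_noise : measurable_fun setT (noise n m l).
Proof.
rewrite (funext (fun w => noiseE l w mn)); apply: measurable_sum => i.
apply: measurable_funM.
  exact: (measurableT_comp (measurable_tnth i) measurable_centered_power).
by apply: (measurableT_comp (measurable_normalized_tnth i)).
Qed.

Variable b : R.
Hypothesis b0 : 0 < b.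
Hypothesis law : forall B, measurable B ->
  distribution P (rho n m.+1) B = dirichlet_law (fun=> b / 2) B.
Hypothesis indep : mutually_independent P (@construction_family R d Omega P zeros0 rho n).

(** Conditionally on the past the centered powers are fixed, and the new weights
   are still Dirichlet. *)
Lemma noise_fourth_moment : (\int[P]_w (noise n m l w ^+ 4)%:E <=
  (6 * (2 * (1 + A) ^+ l) ^+ 4 / (b / 2 * (n - m)%:R) ^+ 2)%:E)%E.
Proof.
pose X : {RV P >-> (n - m.+1).+1.-tuple R} := mfun_Sub (mem_set measurable_centered_power).
rewrite (eq_integral (fun w => (linear_statistic (tnth (X w)) (rho n m.+1 w) ^+ 4)%:E)); last first.
  by move=> w _; rewrite noiseE.
apply: (@integral_independent_le _ _ _ P _ _ _ _ X (rho n m.+1) _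
  (fun z => linear_statistic (tnth z.1) z.2 ^+ 4)).
- move=> U V mU mV; apply: (@independent_generated _ _ _ P (past n m)).
  + exact: setI_closed_past.
  + exact: past_measurable.
  + by rewrite -[X in measurable X]setTI; exact: (measurable_funP (rho n m.+1) measurableT _ mV).
  + by move=> E pE; exact: past_independent.
  by have := measurable_past_power measurableT mU; rewrite setTI.
- apply: measurable_funX; apply: measurable_sum => i; apply: measurable_funM.
    exact: (measurableT_comp (measurable_tnth i) measurable_fst).
  exact: (measurableT_comp (measurable_normalized_tnth i) measurable_snd).
- by move=> z; rewrite exprn_even_ge0.
move=> w; rewrite -(subnSK mn).
have := @dirichlet_fourth_moment R _ (distribution P (rho n m.+1)) (b / 2) _ law
  (tnth (X w)) (2 * (1 + A) ^+ l) (sum_centered_power l w mn) (fun i => centered_power_le l w i mn).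
by apply; rewrite divr_gt0.
Qed.
End moments.
End noise.

(** * Almost sure convergence from fourth moments *)

Section summable.
Context {R : realType} {d : measure_display} {Omega : measurableType d}.
Variable P : probability Omega R.

Lemma sum_inv_square_le N : \sum_(n < N) (n%:R ^+ 2)^-1 <= 2 :> R.
Proof.
suff H k : \sum_(n < k.+2) (n%:R ^+ 2)^-1 <= 2 - k.+1%:R^-1 :> R.
  case: N => [|[|k]]; first by rewrite big_ord0.
    by rewrite big_ord_recr big_ord0 /= expr0n invr0 addr0.
  by apply: le_trans (H k) _; rewrite gerBl invr_ge0.
elim: k => [|k IH].
  by rewrite !big_ord_recr big_ord0 /= expr0n invr0 !add0r expr1n invr1; lra.
rewrite big_ord_recr /=; apply: le_trans (lerD IH (lexx _)) _.
have n0 : 0 < k.+1%:R :> R by rewrite ltr0n.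
rewrite -[k.+2]addn1 natrD; move: (k.+1%:R) n0 => x x0.
have x1 : 0 < x + 1 by rewrite addr_gt0.
rewrite -subr_ge0 (_ : _ - _ = (x * (x + 1) ^+ 2)^-1); last first.
  by field; rewrite !gt_eqF.
by rewrite invr_ge0 mulr_ge0 ?exprn_ge0 // ltW.
Qed.

(** The sum over n has finite expectation, hence is finite almost surely. *)
Lemma cvg0_of_summable_integral (Z : nat -> Omega -> R) (C : R) :
  (forall n, measurable_fun setT (Z n)) -> (forall n w, 0 <= Z n w) ->
  (forall n, (\int[P]_w (Z n w)%:E <= (C / n%:R ^+ 2)%:E)%E) ->
  {ae P, forall w, Z n w @[n --> \oo] --> 0}.
Proof.
move=> mZ Z0 ZC.
have mZ' n : measurable_fun setT (EFin \o Z n) by exact/measurable_EFinP.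
have Z0' n w : setT w -> (0 <= (Z n w)%:E)%E by move=> _; rewrite lee_fin.
pose S w := (\sum_(n <oo) (Z n w)%:E)%E.
have mS : measurable_fun setT S.
  have h := @ge0_emeasurable_sum _ _ _ setT (fun n w => (Z n w)%:E) xpredT
    (fun k w Dw _ => Z0' k w Dw) (fun k _ => mZ' k).
  exact: h.
have C0 : 0 <= C.
  have := ZC 1; rewrite expr1n divr1 => h; rewrite -lee_fin; apply: le_trans h.
  by apply: integral_ge0 => w _; rewrite lee_fin.
have iS : (\int[P]_w S w <= (C * 2)%:E)%E.
  rewrite integral_nneseries //.
  apply: lime_le; first by apply: is_cvg_nneseries => n _ _; apply: integral_ge0 => w _; exact: Z0'.
  apply: nearW => N; rewrite big_mkord.
  apply: (@le_trans _ _ (\sum_(n < N) (C / n%:R ^+ 2)%:E)%E).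
    by apply: lee_sum => n _; exact: ZC.
  rewrite sumEFin lee_fin -mulr_sumr ler_wpM2l //.
  exact: sum_inv_square_le.
have intS : P.-integrable setT S.
  apply/integrableP; split => //.
  rewrite (eq_integral S); last first.
    by move=> w _; rewrite gee0_abs // nneseries_ge0 // => n _ _; exact: Z0'.
  by apply: le_lt_trans iS _; rewrite ltry.
have := integrable_ae measurableT intS; apply: filterS => w /(_ I) Sw.
apply: cvg_series_cvg_0; apply: nondecreasing_is_cvgn.
  by apply/nondecreasing_seqP => n; rewrite /series /= big_nat_recr //= lerDl.
exists (fine (S w)) => _ [n _ <-].
rewrite -lee_fin fineK // /series /= -sumEFin.
by apply: nneseries_lim_ge => k _ _; rewrite lee_fin.
Qed.

Lemma sum_const_le n k (c : R) : (k <= n)%N -> 0 <= c -> n%:R^-1 * (\sum_(m < k) c) <= c.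
Proof.
move=> kn c0; rewrite sumr_const card_ord -[c *+ k]mulr_natl mulrA ler_piMl //.
have [->|n0] := posnP n; first by rewrite invr0 mul0r ler01.
by rewrite mulrC ler_pdivrMr ?ltr0n // mul1r ler_nat.
Qed.

(** Bound each `|x| by c + x^4 / c^3 with c = e / 2: the averages of the fourth
   powers tend to 0 almost surely by [cvg0_of_summable_integral]. *)
Lemma mean_abs_cvg0 (f : nat -> nat -> Omega -> R) (T : nat -> nat) (C : R) :
  (forall n, (T n <= n)%N) ->
  (forall n m, (m < T n)%N -> measurable_fun setT (f n m)) ->
  (forall n m, (m < T n)%N -> (\int[P]_w (f n m w ^+ 4)%:E <= (C / n%:R ^+ 2)%:E)%E) ->
  {ae P, forall w, n%:R^-1 * \sum_(m < T n) `|f n m w| @[n --> \oo] --> 0}.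
Proof.
move=> Tn mf fC.
pose Z n w := n%:R^-1 * \sum_(m < T n) f n m w ^+ 4.
have mZ n : measurable_fun setT (Z n).
  apply: measurable_funM; first exact: measurable_cst.
  by apply: measurable_sum => m; apply: measurable_funX; exact: mf.
have Z0 n w : 0 <= Z n w.
  by rewrite mulr_ge0 ?invr_ge0 // sumr_ge0 // => m _; rewrite exprn_even_ge0.
have mf4 n (m : 'I_(T n)) : measurable_fun setT (fun w => (f n m w ^+ 4)%:E).
  by apply/measurable_EFinP; apply: measurable_funX; exact: mf.
have ZC n : (\int[P]_w (Z n w)%:E <= (`|C| / n%:R ^+ 2)%:E)%E.
  have f40 (m : 'I_(T n)) w : setT w -> (0 <= (f n m w ^+ 4)%:E)%E.
    by move=> _; rewrite lee_fin exprn_even_ge0.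
  rewrite /Z; under eq_integral do rewrite EFinM -sumEFin.
  have mF : measurable_fun setT (fun w => \sum_(m < T n) (f n m w ^+ 4)%:E)%E.
    by apply: emeasurable_sum => m; exact: mf4.
  have F0 w : setT w -> (0 <= \sum_(m < T n) (f n m w ^+ 4)%:E)%E.
    by move=> _; apply: sume_ge0 => m _; exact: f40.
  rewrite (ge0_integralZl P measurableT mF F0) ?lee_fin ?invr_ge0 //.
  rewrite ge0_integral_sum //.
  apply: (@le_trans _ _ (n%:R^-1%:E * \sum_(m < T n) (`|C| / n%:R ^+ 2)%:E)%E).
    apply: lee_wpmul2l; first by rewrite lee_fin invr_ge0.
    apply: lee_sum => m _; apply: le_trans (fC n m (ltn_ord m)) _.
    by rewrite lee_fin ler_wpM2r ?invr_ge0 ?exprn_ge0 // ler_norm.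
  by rewrite sumEFin -EFinM lee_fin sum_const_le // divr_ge0 // exprn_ge0.
have := cvg0_of_summable_integral mZ Z0 ZC; apply: filterS => w Zw.
apply/cvgrPdist_le => e e0.
have e2 : 0 < e / 2 by rewrite divr_gt0.
have key (x : R) : `|x| <= e / 2 + (e / 2) ^- 3 * x ^+ 4.
  have [xe|ex] := leP `|x| (e / 2).
    by rewrite (le_trans xe) // lerDl mulr_ge0 ?exprn_even_ge0 // invr_ge0 exprn_ge0 // ltW.
  apply: (@le_trans _ _ ((e / 2) ^- 3 * x ^+ 4)); last by rewrite lerDr ltW.
  rewrite ler_pdivlMl ?exprn_gt0 // -(ger0_norm (exprn_even_ge0 x (erefl : ~~ odd 4))) normrX.
  by rewrite [leRHS]exprSr ler_wpM2r // lerXn2r ?nnegrE // ltW.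
have [c c0 cE] : exists2 c : R, 0 < c & (e / 2) ^- 3 * c = e / 2.
  by exists ((e / 2) ^+ 4); rewrite ?exprn_gt0 // [_ ^+ 4]exprSr mulKf // expf_neq0 // gt_eqF.
move/cvgrPdist_le : Zw => /(_ _ c0); apply: filterS => n.
rewrite !sub0r !normrN ger0_norm // => Zn.
rewrite ger0_norm ?mulr_ge0 ?invr_ge0 ?sumr_ge0 //.
apply: (@le_trans _ _ (n%:R^-1 * \sum_(m < T n) (e / 2 + (e / 2) ^- 3 * f n m w ^+ 4))).
  by rewrite ler_wpM2l ?invr_ge0 //; apply: ler_sum => m _; exact: key.
rewrite big_split /= -[X in _ * (_ + X)]mulr_sumr mulrDr [leRHS](splitr e) lerD //.
  by apply: sum_const_le; rewrite // ltW.
by rewrite mulrCA -/(Z n w) -[leRHS]cE ler_wpM2l // invr_ge0 exprn_ge0 // ltW.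
Qed.
End summable.

(** * From initial moments to weak limits *)

Section deterministic.
Context {R : realType}.
Variables (tau A : R).
Hypothesis tau01 : 0 < tau < 1.
Hypothesis A0 : 0 < A.

Lemma cvg_sum0 K (u : nat -> nat -> R) : (forall i, u n i @[n --> \oo] --> 0) ->
  \sum_(i < K) u n i @[n --> \oo] --> 0.
Proof.
move=> u0; have e : \sum_(i < K) (0 : R) = 0 by rewrite big1_eq.
rewrite -[X in _ --> X]e.
by apply: cvg_big => [|i _]; [exact: add_continuous|exact: u0].
Qed.

Definition depth n : nat := Num.truncn (n%:R * tau).

Lemma depth_le n : (depth n)%:R <= n%:R * tau.
Proof. by rewrite truncn_le // mulr_ge0 // ltW //; case/andP: tau01. Qed.

Lemma lt_of_le_tau n k : (0 < n)%N -> k%:R <= n%:R * tau -> (k < n)%N.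
Proof.
case/andP: tau01 => t0 t1 n0 kn; rewrite -(ltr_nat R) (le_lt_trans kn) //.
by rewrite gtr_pMr // ltr0n.
Qed.

Lemma lt_depth n k : (k < depth n)%N -> k.+1%:R <= n%:R * tau.
Proof. by move=> kn; rewrite (le_trans _ (depth_le n)) // ler_nat. Qed.

Lemma depth_lt n : (0 < n)%N -> (depth n < n)%N.
Proof. by move=> n0; apply: lt_of_le_tau => //; exact: depth_le. Qed.

Lemma depth_leq n : (depth n <= n)%N.
Proof.
by case: n => [|n]; [rewrite /depth mul0r truncn0|exact/ltnW/depth_lt].
Qed.

Definition bounded_zeros n (s : seq R) :=
  [/\ size s = n, sorted <=%R s & forall x, x \in s -> `|x| <= A].

Lemma power_bound_ge0 K : 0 <= (1 + A) ^+ K.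
Proof. by rewrite exprn_ge0 // addr_ge0 // ltW. Qed.

Lemma valid_uniform_chain n m : (0 < m <= n)%N -> valid_weights (@uniform_chain R n m).
Proof. by move=> _; exact: valid_uniform_weights. Qed.

Lemma uniform_chain_newton n s m : bounded_zeros n s -> (m < n)%N ->
  newton_relation (moment (chain_zeros s (@uniform_chain R n) m))
    (chain_decrement s (@uniform_chain R n) m).
Proof.
move=> [ss st sA] mn; rewrite -(funext (fun k => chain_weighted_uniform ss st sA k mn)).
exact: (chain_newton ss st sA (@valid_uniform_chain n) mn).
Qed.

(** [euler_cauchy] for the moments of the derivatives. *)
Lemma uniform_chain_moment_cvg (z : nat -> seq R) : (forall n, bounded_zeros n (z n)) ->
  (forall k, cvgn (fun n => moment (z n) k)) ->
  forall k, cvgn (fun n => moment (chain_zeros (z n) (@uniform_chain R n) (depth n)) k).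
Proof.
move=> zP z0 K.
have chain0 n : chain_zeros (z n) (@uniform_chain R n) 0 = z n.
  by have [_ st _] := zP n; apply: ordered_zeros_eq => //=; exact: eqpxx.
apply: (@euler_cauchy R K ((1 + A) ^+ K) tau
  (fun n m => moment (chain_zeros (z n) (@uniform_chain R n) m))
  (fun n m => chain_decrement (z n) (@uniform_chain R n) m)) => //.
- exact: power_bound_ge0.
- by case/andP: tau01 => /ltW-> ->.
- by move=> n m n0 /(lt_of_le_tau n0) mn; exact: uniform_chain_newton.
- move=> n m i n0 /(lt_of_le_tau n0) mn iK; have [ss st sA] := zP n.
  have [_ _ bnd _] := chain_zerosP ss st sA (@valid_uniform_chain n) (ltnW mn).
  by apply: moment_le => //; exact: ltW.
- move=> n m k n0 /(lt_of_le_tau n0) mn _; have [ss st sA] := zP n.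
  exact: (chain_moment_step ss st sA (@valid_uniform_chain n) k mn).
- by move=> i _; under eq_fun do rewrite chain0; exact: z0.
Qed.

(** [euler_perturbation] against a uniform chain: the initial moments of the two
   chains approach each other, and the averaged noise of the first one tends to
   0. *)
Lemma chain_moment_compare (z z' : nat -> seq R) (r : forall n m, (n - m).+1.-tuple R)
    (mom0 mom : nat -> R) :
  (forall n, bounded_zeros n (z n)) -> (forall n, bounded_zeros n (z' n)) ->
  (forall n m, (0 < m <= n)%N -> valid_weights (r n m)) ->
  (forall k, moment (z n) k @[n --> \oo] --> mom0 k) ->
  (forall k, moment (z' n) k @[n --> \oo] --> mom0 k) ->
  (forall k, n%:R^-1 * (\sum_(m < depth n)
     `|chain_weighted (z n) (r n) m k - moment (chain_zeros (z n) (r n) m) k|)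
     @[n --> \oo] --> 0) ->
  (forall k, moment (chain_zeros (z' n) (@uniform_chain R n) (depth n)) k
     @[n --> \oo] --> mom k) ->
  forall k, moment (chain_zeros (z n) (r n) (depth n)) k @[n --> \oo] --> mom k.
Proof.
move=> zP z'P vr z0 z'0 noise z'mom K.
case/andP: (tau01) => t0 t1.
have [C C0 hC] := euler_perturbation K (power_bound_ge0 K) t1.
have chain0 n (s : seq R) (p : forall m, (n - m).+1.-tuple R) : bounded_zeros n s ->
    chain_zeros s p 0 = s.
  by move=> [_ st _]; apply: ordered_zeros_eq => //=; exact: eqpxx.
pose zz n := moment (chain_zeros (z n) (r n) (depth n)).
pose MM n := moment (chain_zeros (z' n) (@uniform_chain R n) (depth n)).
pose noise_mean n i := n%:R^-1 * (\sum_(m < depth n)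
     `|chain_weighted (z n) (r n) m i - moment (chain_zeros (z n) (r n) m) i|).
pose bound n := C * (moment_dist K (moment (z n)) (moment (z' n)) + \sum_(i < K.+1) noise_mean n i).
have key n : (0 < n)%N -> `|zz n K - MM n K| <= bound n.
  move=> n0; have [ss st sA] := zP n; have [ss' st' sA'] := z'P n.
  have dn := depth_lt n0; have ltn k : (k < depth n)%N -> (k.+1 < n)%N.
    by move=> kn; exact: leq_ltn_trans dn.
  apply: le_trans (le_moment_dist (zz n) (MM n) (leqnn K)) _.
  have := hC n (depth n) (fun m => moment (chain_zeros (z n) (r n) m))
    (fun m => moment (chain_zeros (z' n) (@uniform_chain R n) m))
    (fun m => chain_weighted (z n) (r n) m) (fun m => chain_decrement (z n) (r n) m)
    (fun m => chain_decrement (z' n) (@uniform_chain R n) m) (fun=> 0) n0 (depth_le n)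
    (fun=> lexx 0).
  rewrite !(chain0 n) // big1_eq addr0 /bound.
  rewrite (_ : n%:R^-1 * _ = \sum_(i < K.+1) noise_mean n i); last first.
    by rewrite /noise_mean -mulr_sumr exchange_big.
  apply.
  - by move=> m /ltn/ltnW mn; exact: (chain_newton ss st sA (@vr n) mn).
  - by move=> m /ltn/ltnW mn; exact: uniform_chain_newton.
  - by move=> m i /ltn/ltnW mn iK; exact: (chain_weighted_le ss st sA (@vr n) (ltW A0) mn iK).
  - move=> m i /ltn/ltnW mn iK.
    have [_ _ bnd _] := chain_zerosP ss' st' sA' (@valid_uniform_chain n) (ltnW mn).
    by apply: moment_le => //; exact: ltW.
  - move=> m mn; have mn' := leq_ltn_trans mn dn.
    have [sz _ _ _] := chain_zerosP ss st sA (@vr n) (ltnW mn').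
    have [sz' _ _ _] := chain_zerosP ss' st' sA' (@valid_uniform_chain n) (ltnW mn').
    by rewrite !moment0 // ?sz ?sz' subn_gt0.
  - move=> m k /ltn mn _; rewrite (chain_moment_step ss st sA (@vr n) k mn).
    by rewrite subrr normr0.
  - move=> m k /ltn mn _.
    exact: (chain_moment_step ss' st' sA' (@valid_uniform_chain n) k mn).
have bound0 : bound n @[n --> \oo] --> 0.
  rewrite -[X in _ --> X](mulr0 C); apply: cvgM; first exact: cvg_cst.
  rewrite -[X in _ --> X](addr0 0); apply: cvgD.
    apply: (@cvg_sum0 K.+1 (fun n i => `|moment (z n) i - moment (z' n) i|)) => i.
    rewrite -(@normr0 _ R); apply: cvg_norm; rewrite -[X in _ --> X](subrr (mom0 i)).
    by apply: cvgB.
  exact: (@cvg_sum0 K.+1 noise_mean noise).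
have d0 : (zz n K - MM n K) @[n --> \oo] --> 0.
  apply/norm_cvg0P; apply: squeeze_cvgr (cvg_cst 0) bound0.
  by near=> n; rewrite normr_ge0 key //; near: n; exact: nbhs_infty_gt.
rewrite (_ : (fun n => _) = (fun n => (zz n K - MM n K) + MM n K)); last first.
  by apply/funext => n; rewrite subrK.
by rewrite -[X in _ --> X]add0r; apply: cvgD => //; exact: z'mom.
Unshelve. all: by end_near. Qed.

(** For n = 0 the list is empty, so the sequence is shifted by one. *)
Lemma weak_cvg_of_moments (mom : nat -> R) (s0 : nat -> seq R) (nu : probability R R) :
  (forall s_, moments_cvg A mom s_ -> forall f, continuous f ->
     (average (s_ n) f)%:E @[n --> \oo] --> (\int[nu]_x (f x)%:E)%E) ->
  (forall n, (0 < n)%N -> (0 < size (s0 n))%N) ->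
  (forall n x, x \in s0 n -> `|x| <= A) ->
  (forall k, moment (s0 n) k @[n --> \oo] --> mom k) ->
  weak_cvg (fun n => empirical_measure (s0 n)) nu.
Proof.
move=> hnu s00 sA smom f cf _.
have mf : measurable_fun setT f by exact: continuous_measurable_fun.
have E n : (\int[empirical_measure (s0 n)]_x (f x)%:E)%E = (average (s0 n) f)%:E.
  exact: integral_empirical_measure.
rewrite (funext E).
have h : (average (s0 n.+1) f)%:E @[n --> \oo] --> (\int[nu]_x (f x)%:E)%E.
  apply: (hnu (fun n => s0 n.+1)) => //; split => // [n|n x|k]; [exact: s00|exact: sA|].
  have := smom k; rewrite -(cvg_shiftS (fun n => moment (s0 n) k)).
  exact.
by move: h; rewrite (cvg_shiftS (fun n => (average (s0 n) f)%:E)).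
Qed.

(** Weak convergence tests bounded functions only, hence the powers are
   truncated outside [-A, A], which the zeros do not see. *)
Lemma initial_moment_cvg (z : nat -> seq R) (mu : probability R R) :
  (forall n, bounded_zeros n (z n)) ->
  weak_cvg (fun n => empirical_measure (z n)) mu ->
  forall k, moment (z n) k @[n --> \oo] -->
    fine (\int[mu]_x ((Num.min A (Num.max (- A) x)) ^+ k)%:E)%E.
Proof.
move=> zP zmu k; pose g (x : R) := Num.min A (Num.max (- A) x).
have gA x : `|g x| <= A.
  have NA : - A <= A by rewrite (le_trans _ (ltW A0)) // oppr_le0 ltW.
  by rewrite /g ler_norml ge_min lexx andbT le_min le_max lexx NA.
have cg : continuous g by apply: continuous_clamp => x; exact: cvg_id.
have ck : continuous (fun x => g x ^+ k).
  by move=> x; apply: (@continuous_comp _ _ _ g (fun y => y ^+ k)); [exact: cg|exact: exprn_continuous].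
have bk : [bounded g x ^+ k | x in [set: R]].
  exists (A ^+ k); split; first exact: num_real.
  move=> M AM x _ /=; rewrite normrX (le_trans _ (ltW AM)) // lerXn2r ?nnegrE //.
  exact: ltW.
have E n : (\int[empirical_measure (z n)]_x (g x ^+ k)%:E = (moment (z n) k)%:E)%E.
  rewrite integral_empirical_measure; last exact: continuous_measurable_fun.
  congr (_ * _)%:E; apply: eq_big_seq => x xz; have [_ _ zA] := zP n.
  have := zA x xz; rewrite ler_norml => /andP[Ax xA].
  by rewrite /g (max_idPr Ax) (min_idPr xA).
have := zmu _ ck bk; under eq_fun do rewrite E.
set I := (X in _ --> X) => h.
have If : I \is a fin_num.
  apply: integrable_fin_num => //; apply: measurable_bounded_integrable => //.
  - by apply: (le_lt_trans (probability_le1 mu measurableT)); exact: ltry.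
  - exact: continuous_measurable_fun.
by move: h; rewrite -(fineK If) => /fine_cvgP[].
Qed.
End deterministic.

(** * Almost sure limits *)

Lemma eq_poly_chain (R : realType) n (s : seq R) (r r' : forall m, (n - m).+1.-tuple R) M :
  (forall m, (0 < m <= M)%N -> r m = r' m) -> poly_chain s r M = poly_chain s r' M.
Proof.
elim: M => [//|M IH] rr' /=; rewrite IH ?rr' ?leqnn // => m /andP[m0 mM].
by rewrite rr' // m0 ltnW.
Qed.

Lemma uniform_weights_eq (R : realType) n m (t : (n - m).+1.-tuple R) : (m <= n)%N ->
  (forall j, tnth t j = (n.+1 - m)%:R^-1) -> t = @uniform_chain R n m.
Proof. by move=> mn h; apply: eq_from_tnth => j; rewrite h tnth_mktuple subSn. Qed.

Section almost_sure.
Context {R : realType} {d : measure_display} {Omega : measurableType d}.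
Variables (P : probability Omega R) (tau A b : R).
Variables (zeros0 : forall n, {RV P >-> n.-tuple R}) (rho : forall n k, {RV P >-> (n - k).+1.-tuple R}).
Hypothesis tau01 : 0 < tau < 1.
Hypothesis A0 : 0 < A.
Hypothesis b0 : 0 < b.
Hypothesis zeros_sorted : forall n w, sorted <=%R (zeros0 n w).
Hypothesis zerosA : forall n w x, x \in tval (zeros0 n w) -> `|x| <= A.
Hypothesis law : forall n m, (1 <= m <= n)%N -> forall B, measurable B ->
  distribution P (rho n m) B = dirichlet_law (fun=> b / 2) B.
Hypothesis indep : forall n, mutually_independent P (@construction_family R d Omega P zeros0 rho n).

Lemma weights_valid_ae : {ae P, forall w n m, (0 < m <= n)%N -> valid_weights (rho n m w)}.
Proof.
apply: ae_foralln => n; apply: ae_foralln => m.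
have [mn|nmn] := boolP (0 < m <= n)%N; last by apply: aeW => w h.
exists (rho n m @^-1` (~` [set r | valid_weights r])); split.
- rewrite -[X in measurable X]setTI; apply: (measurable_funP (rho n m)) => //.
  by apply: measurableC; exact: measurable_valid_weights.
- by apply: (@valid_weights_ae _ _ (distribution P (rho n m)) (b / 2)); exact: law.
by move=> w /= /not_implyP[].
Qed.

(** Below the time tau n, the number n - m of zeros is at least (1 - tau) n, so
   the bound of [noise_fourth_moment] is O(1/n^2) uniformly in m. *)
Lemma mean_noise_ae : {ae P, forall w l,
  n%:R^-1 * (\sum_(m < depth tau n) `|noise zeros0 rho n m l w|) @[n --> \oo] --> 0}.
Proof.
apply: ae_foralln => l.
apply: (@mean_abs_cvg0 _ _ _ P (fun n m => noise zeros0 rho n m l) (depth tau)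
  (6 * (2 * (1 + A) ^+ l) ^+ 4 / (b / 2 * (1 - tau)) ^+ 2)).
- by move=> n; exact: depth_leq.
- move=> n m mn; apply: (@measurable_noise _ _ _ P zeros0 rho A) => //.
  exact: leq_trans mn (depth_leq tau01 n).
move=> n m mT; have mn : (m < n)%N := leq_trans mT (depth_leq tau01 n).
apply: le_trans (@noise_fourth_moment _ _ _ P zeros0 rho A A0 zeros_sorted zerosA n m l mn b b0
  (law (mn : (1 <= m.+1 <= n)%N)) (@indep n)) _.
have n0 : 0 < n%:R :> R by rewrite ltr0n (leq_ltn_trans _ mn).
case/andP: tau01 => t0 t1.
have b2 : 0 < b / 2 by rewrite divr_gt0.
have nm : (1 - tau) * n%:R <= (n - m)%:R :> R.
  rewrite natrB ?(ltnW mn) // mulrBl mul1r lerD2l lerN2 mulrC.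
  by apply: le_trans (lt_depth tau01 mT); rewrite ler_nat.
have D0 : 0 < (1 - tau) * n%:R by rewrite mulr_gt0 // subr_gt0.
rewrite lee_fin -[leRHS]mulrA -invfM -exprMn -(mulrA (b / 2)) ler_wpM2l //.
  by rewrite mulr_ge0 // exprn_ge0 // mulr_ge0 // exprn_ge0 // addr_ge0 // ltW.
have h1 : 0 < b / 2 * (n - m)%:R by rewrite mulr_gt0 // (lt_le_trans D0).
have h2 : 0 < b / 2 * ((1 - tau) * n%:R) by rewrite mulr_gt0.
rewrite lef_pV2 ?posrE ?exprn_gt0 // lerXn2r ?nnegrE ?(ltW h1) ?(ltW h2) //.
by rewrite ler_wpM2l // ltW.
Qed.
End almost_sure.

Theorem theorem1 (R : realType) (d : measure_display)
    (Omega : measurableType d) (P : probability Omega R)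
    (tau A : R) (mu : probability R R)
    (zeros0 : forall n, {RV P >-> n.-tuple R}) :
  0 < tau < 1 -> 0 < A ->
  (forall n w, sorted <=%R (zeros0 n w)) ->
  (forall n w j, tnth (zeros0 n w) j \in `[- A, A]) ->
  {ae P, forall w, weak_cvg (fun n => empirical_measure (zeros0 n w)) mu} ->
  let m n := Num.truncn (n%:R * tau) in
  exists nu : probability R R,
    {ae P, forall w, weak_cvg (fun n => empirical_measure
       (ordered_zeros ((monic_of_zeros (zeros0 n w))^`(m n)))) nu} /\
    forall (beta : \bar R) (rho : forall n k, {RV P >-> (n - k).+1.-tuple R}),
      (0 < beta)%E -> weights_with_parameter zeros0 rho beta ->
      {ae P, forall w, weak_cvg (fun n => empirical_measure
         (ordered_zeros (poly_chain (zeros0 n w) (fun k => rho n k w) (m n))))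
         nu}.
Proof.
move=> tau01 A0 zsort zA0 zmu m.
have zA n w (x : R) : x \in tval (zeros0 n w) -> `|x| <= A.
  by move=> /tnthP[j ->]; have := zA0 n w j; rewrite in_itv /= -ler_norml.
have zP w n : bounded_zeros A n (zeros0 n w).
  by split; [exact: size_tuple|exact: zsort|exact: zA].
(* the derivatives at one outcome of full measure define the limit *)
have [w0 w0mu] : exists w, weak_cvg (fun n => empirical_measure (zeros0 n w)) mu.
  apply: contrapT => /forallNP h; have [N [mN N0 sub]] := zmu.
  have : P setT = 0%E.
    apply/eqP; rewrite -measure_le0 -N0; apply: le_measure; rewrite ?inE // => w _.
    by apply: sub; exact: h.
  by rewrite probability_setT => /eqP; rewrite onee_eq0.
pose mom0 k := fine (\int[mu]_x ((Num.min A (Num.max (- A) x)) ^+ k)%:E)%E.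
have zmom w : weak_cvg (fun n => empirical_measure (zeros0 n w)) mu ->
    forall k, moment (zeros0 n w) k @[n --> \oo] --> mom0 k.
  by move=> wmu; exact: (initial_moment_cvg A0 (zP w) wmu).
pose U w n := chain_zeros (zeros0 n w) (@uniform_chain R n).
pose mom k := limn (fun n => moment (U w0 n (m n)) k).
have U0 k : moment (U w0 n (m n)) k @[n --> \oo] --> mom k.
  apply: (uniform_chain_moment_cvg tau01 A0 (zP w0)) => j.
  by apply: cvgP; exact: zmom.
have szU w n : (0 < n)%N -> (0 < size (U w n (m n)))%N /\ (forall x, x \in U w n (m n) -> `|x| <= A).
  move=> n0; have [ss st sA] := zP w n.
  have [sz _ bnd _] := chain_zerosP ss st sA (@valid_uniform_chain R n) (depth_leq tau01 n).
  by split => //; rewrite sz subn_gt0 depth_lt.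
have [nu hnu] : exists nu : probability R R, forall s_, moments_cvg A mom s_ ->
    forall f : R -> R, continuous f ->
    (average (s_ n) f)%:E @[n --> \oo] --> (\int[nu]_x (f x)%:E)%E.
  apply: exists_limit_measure => //; exists (fun n => U w0 n.+1 (m n.+1)); split.
  - by move=> n; have [] := szU w0 n.+1 isT.
  - by move=> n; have [] := szU w0 n.+1 isT.
  - by move=> k; have := U0 k; rewrite -(cvg_shiftS (fun n => moment (U w0 n (m n)) k)).
exists nu.
(* chains with small averaged noise share the limit nu *)
have chain_weak w (r : forall n k, (n - k).+1.-tuple R) :
    weak_cvg (fun n => empirical_measure (zeros0 n w)) mu ->
    (forall n k, (0 < k <= n)%N -> valid_weights (r n k)) ->
    (forall k, n%:R^-1 * (\sum_(m < depth tau n)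
     `|chain_weighted (zeros0 n w) (r n) m k - moment (chain_zeros (zeros0 n w) (r n) m) k|)
     @[n --> \oo] --> 0) ->
    weak_cvg (fun n => empirical_measure (chain_zeros (zeros0 n w) (r n) (m n))) nu.
  move=> wmu vr noise; have dP n := chain_zerosP (size_tuple (zeros0 n w)) (@zsort n w)
    (@zA n w) (vr n) (depth_leq tau01 n).
  apply: (weak_cvg_of_moments hnu).
  - by move=> n n0; have [-> _ _ _] := dP n; rewrite subn_gt0 depth_lt.
  - by move=> n; have [] := dP n.
  exact: (chain_moment_compare tau01 A0 (zP w) (zP w0) vr (zmom w wmu) (zmom w0 w0mu) noise U0).
have uniform_weak w : weak_cvg (fun n => empirical_measure (zeros0 n w)) mu ->
    weak_cvg (fun n => empirical_measure (U w n (m n))) nu.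
  move=> wmu; apply: chain_weak => // [n k _|k]; first exact: valid_uniform_weights.
  rewrite (_ : (fun n => _) = cst 0); first exact: cvg_cst.
  apply/funext => n; rewrite big1 ?mulr0 // => i _.
  rewrite (chain_weighted_uniform (size_tuple _) (@zsort n w) (@zA n w)) ?subrr ?normr0 //.
  exact: leq_trans (ltn_ord i) (depth_leq tau01 n).
have eqU w n (r : forall k, (n - k).+1.-tuple R) :
    (forall k, (0 < k <= n)%N -> r k = @uniform_chain R n k) ->
    ordered_zeros (poly_chain (zeros0 n w) r (m n)) = U w n (m n).
  move=> rE; congr ordered_zeros; apply: eq_poly_chain => k /andP[k0 km].
  by rewrite rE // k0 (leq_trans km) // depth_leq.
split.
  move: zmu; apply: filterS => w wmu.
  rewrite (_ : (fun n => _) = (fun n => empirical_measure (U w n (m n)))); first exact: uniform_weak.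
  apply/funext => n; congr empirical_measure.
  exact: (ordered_zeros_derivn (size_tuple _) (@zsort n w) (@zA n w) (depth_leq tau01 n)).
case=> [b| |] rho //; last first.
  move=> _ uni; move: zmu; apply: filterS => w wmu.
  rewrite (_ : (fun n => _) = (fun n => empirical_measure (U w n (m n)))); first exact: uniform_weak.
  apply/funext => n; congr empirical_measure; apply: eqU => k kn.
  by apply: uniform_weights_eq; [case/andP: kn|move=> j; exact: uni].
rewrite lte_fin => b0 [law indep].
have val_ae := weights_valid_ae law.
have noise_ae := mean_noise_ae tau01 A0 b0 zsort zA law indep.
move: zmu val_ae noise_ae; apply: filterS3 => w wmu vw nw.
rewrite (_ : (fun n => _) = (fun n => empirical_measure
  (chain_zeros (zeros0 n w) (normalized_chain rho n w) (m n)))).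
  by apply: chain_weak => // n k; exact: valid_normalized_chain.
apply/funext => n; congr (empirical_measure (ordered_zeros _)).
apply: eq_poly_chain => k /andP[k0 km].
by rewrite /normalized_chain /normalized_weights vw // k0 (leq_trans km) // depth_leq.
Qed.
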